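(* Let $\rho=\{\rho_k\}_{k=0}^{T-1}\in\mathcal{R}_0$ be a given prior, $\rho_k=\mathcal{N}(0,\Sigma_{\rho_k})$ with $\Sigma_{\rho_k}\succ0$, and set $\bar B_k=B_k^{\rho}:=B_k(\Sigma_{\rho_k}^{-1}+I)^{-1/2}$ for $k\in\{0,\dots,T-1\}$. Suppose that, for this choice of $\bar B_k$, Assumption (A) (given in the context) holds. Let $Q_k$, $k\in\{0,\dots,T\}$, be the solution of $$Q_{k+1}=A_kQ_kA_k^\top-\bar B_k\bar B_k^\top,\qquad Q_0=G_c(T,0)^{1/2}S_0^{1/2}\mathcal{F}^{-1}S_0^{1/2}G_c(T,0)^{1/2}.$$ Then the unique optimal policy of the mutual information optimal density control problem with fixed prior $\rho$ (that is, minimization of $J(\pi,\rho)$ over policies $\pi$ only, subject to the constraints (i)–(iv) of the context) is $$\pi_k^{\rho}(\cdot|x)=\mathcal{N}(\mu_{\pi_k^\rho},\Sigma_{\pi_k^\rho}),\quad k\in\{0,\dots,T-1\},$$ where $$\Sigma_{\pi_k^\rho}:=\left(\Sigma_{\rho_k}^{-1}+I+B_k^\top Q_{k+1}^{-1}B_k\right)^{-1},\qquad \mu_{\pi_k^\rho}:=-\Sigma_{\pi_k^\rho}B_k^\top Q_{k+1}^{-1}A_kx.$$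
   Context: Notation. $T\ge1$ is an integer, $A_k\in\mathbb{R}^{n\times n}$, $B_k\in\mathbb{R}^{n\times m}$ for $k\in\{0,\dots,T-1\}$, and $\Sigma_{\mathrm{ini}},\Sigma_{\mathrm{fin}}\succ0$ are $n\times n$ symmetric positive definite. $\mathcal{N}(\mu,\Sigma)$ is the Gaussian distribution (and its density), $\mathcal{D}_{\mathrm{KL}}$ is the Kullback–Leibler divergence, $\|\cdot\|$ is the Euclidean norm, $A\succ0$ means symmetric positive definite; powers $1/2$ and $-1/2$ of positive (semi)definite matrices are the symmetric ones. Mutual information optimal density control problem. A policy is $\pi=\{\pi_k\}_{k=0}^{T-1}$ with $\pi_k(\cdot|x)$ a conditional probability density on $\mathbb{R}^m$ given $x_k=x$. A prior is $\rho=\{\rho_k\}_{k=0}^{T-1}$ with $\rho_k$ a probability density on $\mathbb{R}^m$; the prior class is $\mathcal{R}_0:=\{\rho\mid\rho_k=\mathcal{N}(0,\Sigma_{\rho_k}),\ \Sigma_{\rho_k}\succ0\}$. The problem is to minimize over $\pi$ and $\rho\in\mathcal{R}_0$ $$J(\pi,\rho):=\mathbb{E}\left[\sum_{k=0}^{T-1}\left\{\tfrac12\|u_k\|^2+\mathcal{D}_{\mathrm{KL}}[\pi_k(\cdot|x_k)\|\rho_k]\right\}\right]$$ subject to: (i) $x_{k+1}=A_kx_k+B_ku_k$; (ii) $u_k\sim\pi_k(\cdot|x)$ given $x=x_k$; (iii) $x_0\sim\mathcal{N}(0,\Sigma_{\mathrm{ini}})$; (iv) $x_T\sim\mathcal{N}(0,\Sigma_{\mathrm{fin}})$.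 Assumption (A), for matrices $A_k$, $\bar B_k$, $\Sigma_{\mathrm{ini}}$, $\Sigma_{\mathrm{fin}}$. Let $\Phi(k,l):=A_{k-1}A_{k-2}\cdots A_l$ for $k>l$, $\Phi(k,k):=I$, $\Phi(k,l):=A_k^{-1}A_{k+1}^{-1}\cdots A_{l-1}^{-1}$ for $k<l$, and for $k_0<k_1$ $$G_r(k_1,k_0):=\sum_{k=k_0}^{k_1-1}\Phi(k_1,k+1)\bar B_k\bar B_k^\top\Phi(k_1,k+1)^\top,$$ $$G_c(k_1,k_0):=\sum_{k=k_0}^{k_1-1}\Phi(k_0,k+1)\bar B_k\bar B_k^\top\Phi(k_0,k+1)^\top.$$ Assumption (A) consists of: (1) $A_k$ is invertible for all $k\in\{0,\dots,T-1\}$; (2) there is $k_r\in\{1,\dots,T\}$ such that $G_r(k,0)$ is invertible for all $k\in\{k_r,\dots,T\}$ and $G_r(T,k)$ is invertible for all $k\in\{0,\dots,k_r-1\}$; (3) with $S_0:=G_c(T,0)^{-1/2}\Sigma_{\mathrm{ini}}G_c(T,0)^{-1/2}$ and $S_T:=G_c(T,0)^{-1/2}\Phi(0,T)\Sigma_{\mathrm{fin}}\Phi(0,T)^\top G_c(T,0)^{-1/2}$, the two matrices $$\mathcal{F}:=S_0+\tfrac12I-\left(S_0^{1/2}S_TS_0^{1/2}+\tfrac14I\right)^{1/2},\qquad -S_0+\tfrac12I+\left(S_0^{1/2}S_TS_0^{1/2}+\tfrac14I\right)^{1/2}$$ are invertible. (It is known that under Assumption (A) the matrices $Q_k$ in the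 claim are invertible for all $k\in\{0,\dots,T\}$.) *)

(* Defs.v *)
From HB Require Import structures.
From mathcomp Require Import all_boot all_order all_algebra.
From mathcomp Require Import all_classical all_reals all_analysis.

Set Implicit Arguments.
Unset Strict Implicit.
Unset Printing Implicit Defensive.

Import Order.TTheory GRing.Theory Num.Theory.
Import numFieldNormedType.Exports.

Local Open Scope classical_set_scope.
Local Open Scope ring_scope.

(* Borel sigma-algebra of R^(m x n), generated by the entries; column vectors
   are the special case 'cV[R]_n = 'M[R]_(n, 1). *)
Definition mx_display : measure_display.
Proof. exact. Qed.

Section measurable_mx.
Context (R : realType) (m n : nat).

Definition mx_cylinders : set (set 'M[R]_(m, n)) :=
  [set A | exists i j (B : set R),
     measurable B /\ A = (fun M : 'M[R]_(m, n) => M i j) @^-1` B].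

Let mx_set0 : <<s mx_cylinders >> set0.
Proof. exact: sigma_algebra0. Qed.

Let mx_setC A : <<s mx_cylinders >> A -> <<s mx_cylinders >> (~` A).
Proof. exact: sigma_algebraC. Qed.

Let mx_bigcup (F : (set 'M[R]_(m, n))^nat) :
  (forall i, <<s mx_cylinders >> (F i)) -> <<s mx_cylinders >> (\bigcup_i F i).
Proof. exact: sigma_algebra_bigcup. Qed.

HB.instance Definition _ := @isMeasurable.Build mx_display 'M[R]_(m, n)
  <<s mx_cylinders >> mx_set0 mx_setC mx_bigcup.

Lemma measurable_mx_entry i j :
  measurable_fun setT (fun M : 'M[R]_(m, n) => M i j).
Proof.
move=> _ B mB; rewrite setTI; apply: sub_sigma_algebra.
by exists i, j, B.
Qed.

Lemma measurable_mxP d (T : measurableType d) (f : T -> 'M[R]_(m, n)) :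
  (forall i j, measurable_fun setT (fun t => f t i j)) -> measurable_fun setT f.
Proof.
move=> mf _ B mB; rewrite setTI.
suff : <<s mx_cylinders >> `<=` [set B | measurable (f @^-1` B)] by exact.
apply: smallest_sub.
- split => /=.
  + by rewrite preimage_set0.
  + by move=> A mA; rewrite setTD preimage_setC; exact: measurableC.
  + by move=> F mF; rewrite preimage_bigcup; exact: bigcupT_measurable.
- move=> _ [i [j [C [mC ->]]]] /=.
  by have := mf i j measurableT C mC; rewrite setTI.
Qed.

End measurable_mx.

Section lebesgue_cV.
Context (R : realType).

Definition cV_cons n (p : R * 'cV[R]_n) : 'cV[R]_n.+1 :=
  col_mx (p.1%:M : 'M[R]_1) p.2.

Definition cV_uncons n (x : 'cV[R]_n.+1) : R * 'cV[R]_n :=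
  (x ord0 ord0, dsubmx (x : 'cV[R]_(1 + n))).

Lemma cV_consK n : cancel (@cV_cons n) (@cV_uncons n).
Proof.
move=> [a y]; rewrite /cV_uncons /cV_cons /= col_mxKd; congr (_, _).
rewrite (_ : ord0 = lshift n (ord0 : 'I_1)); last exact: val_inj.
by rewrite [LHS]col_mxEu mxE eqxx mulr1n.
Qed.

Lemma cV_consKV n : cancel (@cV_uncons n) (@cV_cons n).
Proof.
move=> x; rewrite -[RHS](vsubmxK (x : 'M[R]_(1 + n, 1))).
congr (@col_mx R 1 n 1 _ _); apply/matrixP => i j; rewrite !ord1 !mxE eqxx mulr1n.
by congr (x _ _); exact: val_inj.
Qed.

Lemma measurable_cV_cons n : measurable_fun setT (@cV_cons n).
Proof.
apply: measurable_mxP => i j; rewrite ord1.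
case: (splitP (i : 'I_(1 + n))) => k ik.
- rewrite [X in measurable_fun _ X](_ : _ = fst)//.
  apply/funext => p; rewrite /cV_cons.
  have -> : i = lshift n k by exact: val_inj.
  by rewrite [LHS]col_mxEu !ord1 mxE eqxx mulr1n.
- rewrite [X in measurable_fun _ X](_ : _ =
    (fun y : 'cV[R]_n => y k ord0) \o snd).
    by apply: measurableT_comp => //; exact: measurable_mx_entry.
  apply/funext => p; rewrite /cV_cons.
  have -> : i = rshift 1 k by exact: val_inj.
  by rewrite [LHS]col_mxEd.
Qed.

Lemma measurable_cV_uncons n : measurable_fun setT (@cV_uncons n).
Proof.
apply: measurable_fun_pair; first exact: measurable_mx_entry.
apply: measurable_mxP => i j.
rewrite [X in measurable_fun _ X](_ : _ =
  (fun x : 'cV[R]_n.+1 => x (rshift 1 i) j)); first exact: measurable_mx_entry.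
by apply/funext => x; rewrite mxE.
Qed.

Section cons_measure.
Context (n : nat) (mu : {sigma_finite_measure set 'cV[R]_n -> \bar R}).

Definition cons_measure : set 'cV[R]_n.+1 -> \bar R :=
  pushforward (@lebesgue_measure R \x mu)%E (@cV_cons n).

Let cons_measure0 : cons_measure set0 = 0%E.
Proof. by rewrite /cons_measure /pushforward preimage_set0 measure0. Qed.

Let cons_measure_ge0 A : (0 <= cons_measure A)%E.
Proof. by rewrite /cons_measure /pushforward; exact: measure_ge0. Qed.

Let cons_measure_sigma_additive : semi_sigma_additive cons_measure.
Proof.
apply: (@measure_semi_sigma_additive _ _ _ (pushforward _ _)) => //.
exact: measurable_cV_cons.
Qed.

HB.instance Definition _ := isMeasure.Build _ _ _ cons_measure
  cons_measure0 cons_measure_ge0 cons_measure_sigma_additive.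

Let cons_measure_sigma_finite : sigma_finite setT cons_measure.
Proof.
have /sigma_finiteP[F [UF ndF mF]] := sigma_finiteT (@lebesgue_measure R).
have /sigma_finiteP[G [UG ndG mG]] := sigma_finiteT mu.
exists (fun i => @cV_uncons n @^-1` (F i `*` G i)).
  rewrite -preimage_bigcup (_ : \bigcup_i _ = setT) ?preimage_setT//.
  rewrite -subTset => -[a y] _.
  have [i _ Fia] : (\bigcup_i F i) a by rewrite -UF.
  have [j _ Gjy] : (\bigcup_i G i) y by rewrite -UG.
  exists (maxn i j) => //; split => /=.
    by move: a Fia; exact/subsetPset/ndF/leq_maxl.
  by move: y Gjy; exact/subsetPset/ndG/leq_maxr.
move=> i; have [mFi Fioo] := mF i; have [mGi Gioo] := mG i; split.
  rewrite -[X in measurable X]setTI; apply: measurable_cV_uncons => //.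
  exact: measurableX.
rewrite /cons_measure /pushforward -comp_preimage.
rewrite (_ : _ \o _ = id); last by apply/funext => p; exact: cV_consK.
by rewrite preimage_id product_measure1E// lte_mul_pinfty// ge0_fin_numE.
Qed.

HB.instance Definition _ := Measure_isSigmaFinite.Build _ _ _ cons_measure
  cons_measure_sigma_finite.

End cons_measure.

(* n-dimensional Lebesgue measure, as the n-fold product of the
   one-dimensional one; on R^0 it is the unit mass at the only point. *)
Fixpoint lebesgue_cV n : {sigma_finite_measure set 'cV[R]_n -> \bar R} :=
  match n with
  | 0 => dirac (0 : 'cV[R]_0)
  | k.+1 => cons_measure (lebesgue_cV k)
  end.

End lebesgue_cV.

Section matrices.
Context (R : realType).

Definition possemidefmx n (S : 'M[R]_n) : Prop :=
  S^T = S /\ forall v : 'cV[R]_n, 0 <= (v^T *m S *m v) 0 0.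

Definition posdefmx n (S : 'M[R]_n) : Prop :=
  S^T = S /\ forall v : 'cV[R]_n, v != 0 -> 0 < (v^T *m S *m v) 0 0.

(* The symmetric positive semidefinite square root; it is unique when it
   exists, and the value is the default 0 when it does not. *)
Definition sqrtmx n (S : 'M[R]_n) : 'M[R]_n :=
  xget 0 [set X | possemidefmx X /\ X *m X = S].

Definition invsqrtmx n (S : 'M[R]_n) : 'M[R]_n := invmx (sqrtmx S).

Definition enorm n (v : 'cV[R]_n) : R := Num.sqrt (\sum_i v i 0 ^+ 2).

End matrices.

Section densities.
Context (R : realType).

(* Density of N(mu, S) with respect to lebesgue_cV, for S positive definite. *)
Definition gauss_pdf n (mu : 'cV[R]_n) (S : 'M[R]_n) (v : 'cV[R]_n) : R :=
  (Num.sqrt ((2 * pi) ^+ n * \det S))^-1 *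
  expR (- (2^-1 * ((v - mu)^T *m invmx S *m (v - mu)) 0 0)).

Definition gaussian_rv n d (W : measurableType d) (P : probability W R)
    (X : {RV P >-> 'cV[R]_n}) (mu : 'cV[R]_n) (S : 'M[R]_n) : Prop :=
  forall C : set 'cV[R]_n, measurable C ->
    distribution P X C = (\int[lebesgue_cV R n]_(v in C) (gauss_pdf mu S v)%:E)%E.

(* a log (a / b) with the conventions 0 log (0 / b) = 0 and
   a log (a / 0) = +oo for a > 0. *)
Definition kl_integrand (a b : R) : \bar R :=
  if a == 0 then 0%E else if b == 0 then +oo%E else (a * ln (a / b))%:E.

(* The negative part of the integrand has a finite integral when p and q are
   probability densities, so that the value is then in [0, +oo]. *)
Definition kl_div m (p q : 'cV[R]_m -> R) : \bar R :=
  (\int[lebesgue_cV R m]_v kl_integrand (p v) (q v))%E.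

(* pi k x is the density of u_k given x_k = x. *)
Definition is_policy n m (T : nat) (pi : nat -> 'cV[R]_n -> 'cV[R]_m -> R) :=
  forall k, (k < T)%N ->
    [/\ measurable_fun setT (fun p : 'cV[R]_n * 'cV[R]_m => pi k p.1 p.2),
        forall x u, 0 <= pi k x u &
        forall x, (\int[lebesgue_cV R m]_u (pi k x u)%:E)%E = 1%E].

End densities.

(* Families indexed by time are total functions on nat; only the times
   k < T (k <= T for the state) are ever constrained or used. *)
Section control_problem.
Context (R : realType) (n m T : nat).
Context (A : nat -> 'M[R]_n) (B : nat -> 'M[R]_(n, m)) (Sini Sfin : 'M[R]_n).

(* The processes x, u on (W, P) are driven by the policy pi and meet the
   boundary conditions. The last clause says that pi k (x k) is the conditional
   density of u k given x k, in the form of the defining identity of a regular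
   conditional distribution. *)
Definition feasible (pi : nat -> 'cV[R]_n -> 'cV[R]_m -> R)
    d (W : measurableType d) (P : probability W R)
    (x : nat -> {RV P >-> 'cV[R]_n}) (u : nat -> {RV P >-> 'cV[R]_m}) : Prop :=
  [/\ forall k, (k < T)%N -> forall w, x k.+1 w = A k *m x k w + B k *m u k w,
      gaussian_rv (x 0%N) 0 Sini,
      gaussian_rv (x T) 0 Sfin &
      forall k, (k < T)%N -> forall (C : set 'cV[R]_n) (D : set 'cV[R]_m),
        measurable C -> measurable D ->
        (P (x k @^-1` C `&` u k @^-1` D) =
         \int[P]_(w in x k @^-1` C)
           \int[lebesgue_cV R m]_(v in D) (pi k (x k w) v)%:E)%E].

Definition cost (pi : nat -> 'cV[R]_n -> 'cV[R]_m -> R)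
    (rho : nat -> 'cV[R]_m -> R) d (W : measurableType d) (P : probability W R)
    (x : nat -> {RV P >-> 'cV[R]_n}) (u : nat -> {RV P >-> 'cV[R]_m}) : \bar R :=
  (\int[P]_w \sum_(k < T) ((2^-1 * enorm (u k w) ^+ 2)%:E
                           + kl_div (pi k (x k w)) (rho k)))%E.

(* The cost depends on the processes only through the laws of the pairs
   (x k, u k), which the policy determines; quantifying over all realizations
   thus compares the costs of the policies. *)
Definition optimal_policy (rho : nat -> 'cV[R]_m -> R)
    (pi : nat -> 'cV[R]_n -> 'cV[R]_m -> R) : Prop :=
  [/\ is_policy T pi,
      exists d (W : measurableType d) (P : probability W R)
        (x : nat -> {RV P >-> 'cV[R]_n}) (u : nat -> {RV P >-> 'cV[R]_m}),
        feasible pi x u &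
      forall d (W : measurableType d) (P : probability W R)
        (x : nat -> {RV P >-> 'cV[R]_n}) (u : nat -> {RV P >-> 'cV[R]_m}),
        feasible pi x u ->
      forall pi' d' (W' : measurableType d') (P' : probability W' R)
        (x' : nat -> {RV P' >-> 'cV[R]_n}) (u' : nat -> {RV P' >-> 'cV[R]_m}),
        is_policy T pi' -> feasible pi' x' u' ->
        (cost pi rho x u <= cost pi' rho x' u')%E].

End control_problem.

Section assumption_A.
Context (R : realType) (n m T : nat).
Context (A : nat -> 'M[R]_n) (Bb : nat -> 'M[R]_(n, m)) (Sini Sfin : 'M[R]_n).

(* A (k-1) *m ... *m A l if l <= k, (A k)^-1 *m ... *m (A (l-1))^-1 if k < l. *)
Definition Phi (k l : nat) : 'M[R]_n :=
  if (l <= k)%N then \big[mulmx/1%:M]_(i <- rev (index_iota l k)) A i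
  else \big[mulmx/1%:M]_(k <= i < l) invmx (A i).

Definition Gr (k1 k0 : nat) : 'M[R]_n :=
  \sum_(k0 <= k < k1)
    Phi k1 k.+1 *m Bb k *m (Bb k)^T *m (Phi k1 k.+1)^T.

Definition Gc (k1 k0 : nat) : 'M[R]_n :=
  \sum_(k0 <= k < k1)
    Phi k0 k.+1 *m Bb k *m (Bb k)^T *m (Phi k0 k.+1)^T.

Definition S_0 : 'M[R]_n := invsqrtmx (Gc T 0) *m Sini *m invsqrtmx (Gc T 0).

Definition S_T : 'M[R]_n :=
  invsqrtmx (Gc T 0) *m Phi 0 T *m Sfin *m (Phi 0 T)^T *m invsqrtmx (Gc T 0).

Definition sqrtS : 'M[R]_n :=
  sqrtmx (sqrtmx S_0 *m S_T *m sqrtmx S_0 + (4^-1)%:M).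

Definition F_mx : 'M[R]_n := S_0 + (2^-1)%:M - sqrtS.

Definition assumption_A : Prop :=
  [/\ forall k, (k < T)%N -> A k \in unitmx,
      exists kr, [/\ (1 <= kr <= T)%N,
        forall k, (kr <= k <= T)%N -> Gr k 0 \in unitmx &
        forall k, (k < kr)%N -> Gr T k \in unitmx] &
      F_mx \in unitmx /\ - S_0 + (2^-1)%:M + sqrtS \in unitmx].

Definition Q_0 : 'M[R]_n :=
  sqrtmx (Gc T 0) *m sqrtmx S_0 *m invmx F_mx *m sqrtmx S_0 *m sqrtmx (Gc T 0).

End assumption_A.

Section solution.
Context (R : realType) (n m : nat).
Context (A : nat -> 'M[R]_n) (B : nat -> 'M[R]_(n, m)).
Context (Srho : nat -> 'M[R]_m) (Q : nat -> 'M[R]_n).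

Definition Brho (k : nat) : 'M[R]_(n, m) :=
  B k *m invsqrtmx (invmx (Srho k) + 1%:M).

Definition Sigma_pi (k : nat) : 'M[R]_m :=
  invmx (invmx (Srho k) + 1%:M + (B k)^T *m invmx (Q k.+1) *m B k).

Definition mu_pi (k : nat) (x : 'cV[R]_n) : 'cV[R]_m :=
  - (Sigma_pi k *m (B k)^T *m invmx (Q k.+1) *m A k *m x).

Definition pi_rho (k : nat) (x : 'cV[R]_n) : 'cV[R]_m -> R :=
  gauss_pdf (mu_pi k x) (Sigma_pi k).

End solution.

(* Main.v *)
(* Completing the square in the recursion for [Q] gives, with
   [V_k x = x^T (Q k)^-1 x / 2] and constants [c_k],
     ln pi_rho_k(u|x) - ln rho_k(u) =
       c_k + V_k x - |u|^2 / 2 - V_(k+1) (A_k x + B_k u).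
   A policy of finite cost has finite second moments, so integrating this
   identity and telescoping yields
     cost = C + sum_k E[KL(pi_k(.|x_k) || pi_rho_k(.|x_k))],
   where [C] depends only on the laws of [x_0] and [x_T], which the constraints
   prescribe. Hence [pi_rho] is optimal as soon as it is feasible, and a policy
   of the same cost agrees with it almost everywhere, since the state then has a
   nondegenerate Gaussian law at every time.

   For feasibility, pass to the coordinates [Phi 0 k x], in which [Q k] becomes
   [Q_0 - Gc k 0]. With [N = Gc T 0], the matrix [K = N^-1 - Q_0^-1] is positive
   definite and solves
     K + K Sini K = N^-1 (Phi 0 T) Sfin (Phi 0 T)^T N^-1.
   Positivity of [K] makes every [1 + Bbar^T (Q k.+1)^-1 Bbar] positive definite,
   so that the covariances of [pi_rho] are; the equation says that the state
   covariance, which stays of the form [Q k - Q k M_k Q k] with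
   [M_k = A_k^T M_(k+1) A_k], is steered from [Sini] to [Sfin]. *)

Require Import Defs.
From HB Require Import structures.
From mathcomp Require Import all_boot all_order all_algebra complex.
From mathcomp Require Import all_classical all_reals all_analysis.
From mathcomp Require Import measurable_realfun.
From mathcomp Require Import ring lra.

Set Implicit Arguments.
Unset Strict Implicit.
Unset Printing Implicit Defensive.

Import Order.TTheory GRing.Theory Num.Theory.
Import numFieldNormedType.Exports.

Local Open Scope classical_set_scope.
Local Open Scope ring_scope.

(** * Real symmetric matrices *)

(** The matrices [Q k] may be indefinite, so neither the value function nor the log-likelihood ratio
    has a sign. Nothing may be subtracted or telescoped before the integrals involved are known to
    be finite, and this is what the second moments provide. A competitor of finite cost has
    square-integrable controls because effort and relative entropy are separately nonnegative; a
    competitor of infinite cost needs no analysis. For [pi_rho] the finiteness of the cost is itself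
    to be shown, so its moments come from its Gaussian kernels instead. The relative entropies may
    be infinite at intermediate stages, which is why they are always integrated through a
    nonnegative integrand.

    Indefiniteness also rules out monotonicity arguments for the inverses of [Q k]; they are
    replaced by one quadratic inequality, [gram_bound], applied in the coordinates of time 0.

    In the uniqueness proof, the law of the state under another optimal policy is not known in
    advance: it is determined at time [k] only once that policy has been identified, almost
    everywhere, at all earlier times. *)

Lemma interpolating_poly (F : fieldType) (s : seq F) (g : F -> F) :
  exists p : {poly F}, {in s, forall x, p.[x] = g x}.
Proof.
elim: s => [|a s [p ps]]; first by exists 0.
have [as_|as_] := boolP (a \in s).
  by exists p => x; rewrite inE => /orP[/eqP->|]; apply: ps.
pose q := \prod_(y <- s) ('X - y%:P).
have qa : q.[a] != 0 by rewrite -/(root q a) root_prod_XsubC.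
exists (p + ((g a - p.[a]) / q.[a]) *: q) => x; rewrite inE hornerD hornerZ.
move=> /orP[/eqP->|xs]; first by rewrite divfK// addrC subrK.
have /eqP-> : q.[x] == 0 by rewrite -/(root q x) root_prod_XsubC.
by rewrite mulr0 addr0 ps.
Qed.

Lemma tr_horner_mx (F : fieldType) n (M : 'M[F]_n.+1) (p : {poly F}) :
  M^T = M -> (horner_mx M p)^T = horner_mx M p.
Proof.
move=> Ms; elim/poly_ind: p => [|p c IH]; first by rewrite rmorph0 trmx0.
rewrite rmorphD rmorphM /= horner_mx_X horner_mx_C linearD /= tr_scalar_mx.
congr (_ + _); rewrite [LHS]trmx_mul IH Ms.
exact: comm_mx_horner.
Qed.

Section realmatrix.
Context (R : realType).

(** Over the complex numbers [M] is Hermitian, hence unitarily diagonalizable with real eigenvalues,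
    and a polynomial that vanishes on them annihilates [M]. Only the list of eigenvalues is brought
    back to the reals: it suffices to build square roots as polynomials in [M]. *)
Lemma symmx_functional_calculus n (M : 'M[R]_n.+1) : M^T = M ->
  exists2 s : seq R, {in s, forall x, eigenvalue M x} &
    forall p : {poly R}, {in s, forall x, p.[x] = 0} -> horner_mx M p = 0.
Proof.
move=> Ms.
pose MC := map_mx (real_complex R) M.
have MCs : MC \is symmetricmx.
  by apply/is_hermitianmxP; rewrite expr0 scale1r map_mx_id// /MC map_trmx Ms.
have MCr : MC \is a realmx.
  by apply/mxOverP => i j; rewrite mxE; apply/complex_realP; eexists.
have MCh := realsym_hermsym MCs MCr.
have MCn := hermitian_normalmx MCh.
pose P := spectralmx MC; pose D := spectral_diag MC.
have Pu : P \in unitmx := spectral_unit MC.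
have MCE : MC = invmx P *m diag_mx D *m P by apply/orthomx_spectralP.
have /mxOverP Dr := hermitian_spectral_diag_real MCh.
pose r := fun j => complex.Re (D 0 j).
have DE j : D 0 j = real_complex R (r j) by rewrite RRe_real.
exists (map r (enum 'I_n.+1)) => [_ /mapP[j _ ->]|p p0].
  (* Being an eigenvalue is a root condition on the characteristic polynomial, and this descends
     along [real_complex] although the eigenvector at hand is complex. *)
  rewrite eigenvalue_root_char -(fmorph_root (real_complex R)).
  rewrite map_char_poly -eigenvalue_root_char; apply/eigenvalueP.
  exists (row j P).
    rewrite -/MC [in LHS]MCE !mulmxA -row_mul mulmxV// row1.
    by rewrite -rowE row_diag_mx DE -scalemxAl -rowE.
  apply/eqP; rewrite rowE => /(congr1 (mulmx^~ (invmx P))).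
  rewrite mulmxK// mul0mx => /rowP/(_ j); rewrite !mxE !eqxx => /eqP.
  by rewrite oner_eq0.
apply: (map_mx_inj (f := real_complex R)); rewrite map_mx0 map_horner_mx -/MC MCE.
rewrite (horner_mx_uconjC _ _ (Pu : P \is a GRing.unit)) horner_mx_diag.
suff -> : map_mx (horner (map_poly (real_complex R) p)) D = 0.
  by rewrite linear0 mulmx0 mul0mx.
apply/rowP => j; rewrite !mxE DE horner_map p0 ?rmorph0//.
by rewrite map_f// mem_enum.
Qed.

Lemma sqnorm_ge0 n (v : 'cV[R]_n) : 0 <= (v^T *m v) 0 0.
Proof. by rewrite mxE sumr_ge0// => i _; rewrite mxE -expr2 sqr_ge0. Qed.

Lemma sqnorm_eq0 n (v : 'cV[R]_n) : ((v^T *m v) 0 0 == 0) = (v == 0).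
Proof.
rewrite mxE psumr_eq0; last by move=> i _; rewrite mxE -expr2 sqr_ge0.
apply/idP/idP => [/allP v0|/eqP->]; last by apply/allP => i _; rewrite !mxE mulr0 eqxx.
apply/eqP/colP => i; have := v0 i; rewrite mem_index_enum !mxE -expr2 sqrf_eq0.
by move=> /(_ isT)/eqP.
Qed.

Lemma sqnorm_gt0 n (v : 'cV[R]_n) : (0 < (v^T *m v) 0 0) = (v != 0).
Proof. by rewrite lt0r sqnorm_ge0 sqnorm_eq0 andbT. Qed.

Lemma quadform_congr n p (L : 'M[R]_(n, p)) (M : 'M[R]_n) (v : 'cV[R]_p) :
  (v^T *m (L^T *m M *m L) *m v) 0 0 = ((L *m v)^T *m M *m (L *m v)) 0 0.
Proof. by rewrite trmx_mul !mulmxA. Qed.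

Lemma possemidef_eigen n (M : 'M[R]_n) x :
  possemidefmx M -> eigenvalue M x -> 0 <= x.
Proof.
move=> [Ms Mp] /eigenvalueP[v vM v0].
have := Mp v^T; rewrite trmxK vM -scalemxAl mxE.
have := sqnorm_gt0 v^T; rewrite trmxK -(inj_eq trmx_inj) trmxK trmx0 v0 => vv.
by rewrite pmulr_lge0.
Qed.

Lemma possemidef_gram n p (L : 'M[R]_(n, p)) : possemidefmx (L^T *m L).
Proof.
split=> [|v]; first by rewrite trmx_mul trmxK.
by rewrite mulmxA -trmx_mul -mulmxA sqnorm_ge0.
Qed.

(** The root is a polynomial in [M] that interpolates the square root on the spectrum, so it
    commutes with whatever commutes with [M]. Interpolating the fourth root as well exhibits it as a
    Gram matrix, hence as positive semidefinite. *)
Lemma possemidef_sqrt_comm n (M : 'M[R]_n) : possemidefmx M ->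
  exists X, [/\ possemidefmx X, X *m X = M &
    forall Y, Y *m M = M *m Y -> Y *m X = X *m Y].
Proof.
case: n M => [|n] M Mp.
  by exists M; split=> //; apply/matrixP => -[].
have [Ms _] := Mp; have [s sM sp] := symmx_functional_calculus Ms.
have [f fE] := interpolating_poly s Num.sqrt.
have [g gE] := interpolating_poly s (Num.sqrt \o Num.sqrt).
have s0 x : x \in s -> 0 <= x by move=> /sM; exact: possemidef_eigen.
have fg : horner_mx M f = (horner_mx M g)^T *m horner_mx M g.
  rewrite tr_horner_mx// -[RHS]rmorphM; apply/eqP; rewrite -subr_eq0 -rmorphB.
  apply/eqP/sp => x xs; rewrite !hornerE fE// gE//= -expr2.
  by rewrite sqr_sqrtr ?subrr// sqrtr_ge0.
exists (horner_mx M f); split.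
- by rewrite fg; exact: possemidef_gram.
- rewrite -[LHS]rmorphM -[RHS](horner_mx_X M); apply/eqP.
  rewrite -subr_eq0 -rmorphB; apply/eqP/sp => x xs.
  by rewrite !hornerE fE// -expr2 sqr_sqrtr ?subrr// s0.
- by move=> Y; exact: comm_mx_horner.
Qed.

Lemma sqrtmxP n (M : 'M[R]_n) : possemidefmx M ->
  possemidefmx (sqrtmx M) /\ sqrtmx M *m sqrtmx M = M.
Proof.
move=> /possemidef_sqrt_comm[X [Xp XX _]].
exact: (@xgetPex _ 0 [set X | possemidefmx X /\ X *m X = M] (ex_intro _ X _)).
Qed.

Lemma posdef_possemidef n (M : 'M[R]_n) : posdefmx M -> possemidefmx M.
Proof.
move=> [Ms Mp]; split=> // v; have [->|v0] := eqVneq v 0; last exact/ltW/Mp.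
by rewrite mulmx0 mxE.
Qed.

Lemma unitmx_injP n (M : 'M[R]_n) : (forall v : 'cV_n, M *m v = 0 -> v = 0) ->
  M \in unitmx.
Proof.
move=> Mi; rewrite -unitmx_tr -row_free_unit -kermx_eq0; apply/eqP/row_matrixP => i.
rewrite row0; apply: trmx_inj; rewrite trmx0; apply: Mi.
apply: trmx_inj; rewrite trmx_mul trmxK trmx0 -row_mul.
by rewrite mulmx_ker row0.
Qed.

Lemma posdef_unit n (M : 'M[R]_n) : posdefmx M -> M \in unitmx.
Proof.
move=> [Ms Mp]; apply: unitmx_injP => v Mv; apply/eqP; apply: contraT => /Mp.
by rewrite -mulmxA Mv mulmx0 mxE ltxx.
Qed.

Lemma posdef_congr n p (M : 'M[R]_n) (L : 'M[R]_(n, p)) : posdefmx M ->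
  (forall v : 'cV_p, L *m v = 0 -> v = 0) -> posdefmx (L^T *m M *m L).
Proof.
move=> [Ms Mp] Li; split; first by rewrite !trmx_mul trmxK Ms mulmxA.
move=> v v0; rewrite quadform_congr Mp//; apply: contra_neq v0; exact: Li.
Qed.

Lemma unitmx_inj n (L : 'M[R]_n) (v : 'cV_n) : L \in unitmx -> L *m v = 0 -> v = 0.
Proof. by move=> Lu /(congr1 (mulmx (invmx L))); rewrite mulKmx// mulmx0. Qed.

Lemma posdef_congr_unit n (M L : 'M[R]_n) : posdefmx M -> L \in unitmx ->
  posdefmx (L *m M *m L^T).
Proof.
move=> Mp Lu; rewrite -{1}[L]trmxK; apply: posdef_congr => // v.
by apply: unitmx_inj; rewrite unitmx_tr.
Qed.

Lemma posdef_inv n (M : 'M[R]_n) : posdefmx M -> posdefmx (invmx M).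
Proof.
move=> Mp; have Mu := posdef_unit Mp.
have := @posdef_congr_unit _ M (invmx M) Mp; rewrite unitmx_inv mulVmx// mul1mx.
by rewrite trmx_inv Mp.1; exact.
Qed.

Lemma possemidefD n (M N : 'M[R]_n) :
  possemidefmx M -> possemidefmx N -> possemidefmx (M + N).
Proof.
move=> [Ms Mp] [Ns Np]; split; first by rewrite linearD /= Ms Ns.
by move=> v; rewrite mulmxDr mulmxDl mxE addr_ge0.
Qed.

Lemma posdefD n (M N : 'M[R]_n) :
  posdefmx M -> possemidefmx N -> posdefmx (M + N).
Proof.
move=> [Ms Mp] [Ns Np]; split; first by rewrite linearD /= Ms Ns.
by move=> v v0; rewrite mulmxDr mulmxDl mxE ltr_pwDl// Mp.
Qed.

Lemma posdef_scalar n (a : R) : 0 < a -> posdefmx (a%:M : 'M[R]_n).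
Proof.
move=> a0; split=> [|v v0]; first by rewrite tr_scalar_mx.
by rewrite mul_mx_scalar -scalemxAl mxE pmulr_rgt0// sqnorm_gt0.
Qed.

Lemma possemidef0 n : possemidefmx (0 : 'M[R]_n).
Proof. by split=> [|v]; [rewrite trmx0|rewrite mulmx0 mul0mx mxE]. Qed.

Lemma possemidef_congr n p (M : 'M[R]_n) (L : 'M[R]_(n, p)) :
  possemidefmx M -> possemidefmx (L^T *m M *m L).
Proof.
move=> [Ms Mp]; split; first by rewrite !trmx_mul trmxK Ms mulmxA.
by move=> v; rewrite quadform_congr Mp.
Qed.

Lemma possemidef_unit n (M : 'M[R]_n) :
  possemidefmx M -> M \in unitmx -> posdefmx M.
Proof.
move=> /possemidef_sqrt_comm[Y [[Ys _] YY _]] Mu.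
have Yu : Y \in unitmx by move: Mu; rewrite -YY unitmx_mul => /andP[].
rewrite -YY -[X in X *m _]mulmx1 -{2}Ys; apply: posdef_congr_unit => //.
exact: posdef_scalar.
Qed.

Lemma sqrtmx_posdef n (M : 'M[R]_n) : posdefmx M -> posdefmx (sqrtmx M).
Proof.
move=> Mp; have [Xp XX] := sqrtmxP (posdef_possemidef Mp).
apply: possemidef_unit => //.
by have := posdef_unit Mp; rewrite -{1}XX unitmx_mul => /andP[].
Qed.

Lemma posdef_factor n (M : 'M[R]_n) : posdefmx M ->
  exists X : 'M[R]_n, [/\ X \in unitmx, X^T = X & X *m X = M].
Proof.
move=> Mp; exists (sqrtmx M); have [[Xs _] XX] := sqrtmxP (posdef_possemidef Mp).
by split=> //; exact/posdef_unit/sqrtmx_posdef.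
Qed.

Lemma posdef_det n (M : 'M[R]_n) : posdefmx M -> 0 < \det M.
Proof.
move=> /posdef_factor[X [Xu _ <-]]; rewrite det_mulmx -expr2 exprn_even_gt0//=.
by rewrite -unitfE -unitmxE.
Qed.

(** The square root of [Z] commutes with [X] too, so conjugating [X *m Z] by its inverse gives back
    [X]. *)
Lemma posdef_comm_mul n (X Z : 'M[R]_n) : X^T = X -> posdefmx Z ->
  X *m Z = Z *m X -> posdefmx (X *m Z) -> posdefmx X.
Proof.
move=> Xs Zp XZ XZp.
have [Y [[Ys _] YY Ycomm]] := possemidef_sqrt_comm (posdef_possemidef Zp).
have Yu : Y \in unitmx by move: (posdef_unit Zp); rewrite -YY unitmx_mul => /andP[].
rewrite (_ : X = invmx Y *m (X *m Z) *m (invmx Y)^T).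
  by apply: posdef_congr_unit => //; rewrite unitmx_inv.
rewrite trmx_inv Ys -YY !mulmxA -[_ *m X *m Y]mulmxA (Ycomm _ XZ) mulKmx//.
by rewrite mulmxK.
Qed.

End realmatrix.

Lemma tr_addmx (V : zmodType) n m (M N : 'M[V]_(n, m)) : (M + N)^T = M^T + N^T.
Proof. by apply/matrixP => i j; rewrite !mxE. Qed.

Lemma tr_oppmx (V : zmodType) n m (M : 'M[V]_(n, m)) : (- M)^T = - M^T.
Proof. by apply/matrixP => i j; rewrite !mxE. Qed.

(** Restricted forms of [mxE]: rewriting with [mxE] itself would also unfold the matrix products
    inside the sum. *)
Lemma addmxE (V : zmodType) n m (M N : 'M[V]_(n, m)) i j :
  (M + N) i j = M i j + N i j.
Proof. by rewrite mxE. Qed.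

Lemma oppmxE (V : zmodType) n m (M : 'M[V]_(n, m)) i j : (- M) i j = - M i j.
Proof. by rewrite mxE. Qed.

(** * Woodbury identities and completion of the square *)

Section woodbury.
Context (F : comUnitRingType) (n m : nat).
Implicit Types (P Q : 'M[F]_n) (Z : 'M[F]_m) (B : 'M[F]_(n, m)).

(** Multiply by [E] on the right: since [B^T Q^-1 B = W - Z], the product of the two rank-[m]
    corrections splits into [B Z^-1 B^T - B W^-1 B^T]. No definiteness is available for [Q] or [E],
    so invertibility is assumed of each matrix. *)
Lemma woodbury Q Z B (W : 'M[F]_m := Z + B^T *m invmx Q *m B)
    (E : 'M[F]_n := Q + B *m invmx Z *m B^T) :
  Q \in unitmx -> Z \in unitmx -> E \in unitmx -> W \in unitmx ->
  1%:M - B *m invmx W *m B^T *m invmx Q = Q *m invmx E.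
Proof.
move=> Qu Zu Eu Wu; apply: (canRL (mulmxK Eu)).
rewrite mulmxBl mul1mx {2}/E mulmxDr mulmxKV//.
have -> : B *m invmx W *m B^T *m invmx Q *m (B *m invmx Z *m B^T) =
  B *m invmx Z *m B^T - B *m invmx W *m B^T.
  rewrite (_ : _ *m _ = B *m invmx W *m (W - Z) *m (invmx Z *m B^T)).
    by rewrite mulmxBr mulmxKV// mulmxBl !mulmxA mulmxK.
  by rewrite /W [_ - Z]addrAC subrr add0r !mulmxA.
by rewrite subrKC /E addrK.
Qed.

Lemma woodbury_gram Q Z B (W : 'M[F]_m := Z + B^T *m invmx Q *m B)
    (E : 'M[F]_n := Q + B *m invmx Z *m B^T) :
  Q \in unitmx -> Z \in unitmx -> E \in unitmx -> W \in unitmx ->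
  B *m invmx W *m B^T = Q - Q *m invmx E *m Q.
Proof.
move=> Qu Zu Eu Wu; rewrite -(woodbury Qu Zu Eu Wu) mulmxBl mul1mx mulmxKV//.
by rewrite opprB addrC subrK.
Qed.

(* The minimum over [u] of the left-hand side is the first term on the right. *)
Lemma complete_square Q Z B (W : 'M[F]_m := Z + B^T *m invmx Q *m B)
    (E : 'M[F]_n := Q + B *m invmx Z *m B^T) (x : 'cV[F]_n) (u : 'cV[F]_m)
    (mu := - (invmx W *m B^T *m invmx Q *m x)) :
  Q \in unitmx -> Z \in unitmx -> E \in unitmx -> W \in unitmx ->
  Q^T = Q -> Z^T = Z ->
  u^T *m Z *m u + (x + B *m u)^T *m invmx Q *m (x + B *m u) =
  x^T *m invmx E *m x + (u - mu)^T *m W *m (u - mu).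
Proof.
move=> Qu Zu Eu Wu Qs Zs.
have Ps : (invmx Q)^T = invmx Q by rewrite trmx_inv Qs.
have Ws : W^T = W by rewrite tr_addmx !trmx_mul trmxK Zs Ps mulmxA.
have EE : invmx E = invmx Q - invmx Q *m B *m invmx W *m B^T *m invmx Q.
  rewrite -[LHS]mul1mx -(mulVmx Qu) -mulmxA -(woodbury Qu Zu Eu Wu).
  by rewrite mulmxBr mulmx1 !mulmxA.
have muW : mu^T *m W = - (x^T *m invmx Q *m B).
  by rewrite /mu tr_oppmx !trmx_mul trmxK Ps trmx_inv Ws mulNmx !mulmxA mulmxKV.
have Wmu : W *m mu = - (B^T *m invmx Q *m x).
  by rewrite /mu mulmxN !mulmxA mulmxV// mul1mx.
have -> : (u - mu)^T *m W *m (u - mu) =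
    u^T *m Z *m u + u^T *m B^T *m invmx Q *m B *m u +
    u^T *m B^T *m invmx Q *m x + x^T *m invmx Q *m B *m u +
    x^T *m invmx Q *m B *m invmx W *m B^T *m invmx Q *m x.
  rewrite tr_addmx tr_oppmx mulmxBr !mulmxDl !mulNmx muW -[u^T *m W *m mu]mulmxA.
  have -> : u^T *m W *m u = u^T *m Z *m u + u^T *m B^T *m invmx Q *m B *m u.
    by rewrite /W mulmxDr mulmxDl !mulmxA.
  rewrite Wmu /mu !mulmxN !mulNmx !opprK opprD opprK !mulmxA.
  by apply/matrixP => i j; rewrite !mxE; ring.
rewrite EE tr_addmx trmx_mul mulmxBr !mulmxDl !mulmxDr !mulNmx !mulmxA.
set a := u^T *m Z *m u; set b := x^T *m _ *m x; set c := x^T *m _ *m B *m u.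
set d := u^T *m _ *m _ *m x; set e := u^T *m _ *m _ *m _ *m u.
set f := x^T *m _ *m _ *m _ *m _ *m _ *m x.
by apply/matrixP => i j; rewrite !mxE; ring.
Qed.

End woodbury.

(** * Subtracting Gram matrices from an indefinite matrix *)

Section gram_bound.
Context (R : realType) (n m : nat).
Implicit Types (N G Q : 'M[R]_n) (B : 'M[R]_(n, m)).

(* Expand [0 <= |v - B^T z|^2 + (s - z)^T G (s - z) + z^T (N - G - B B^T) z] at
   [z = N^-1 y]. *)
Lemma gram_bound N G B (v : 'cV[R]_m) (s y : 'cV[R]_n) :
  y = B *m v + G *m s ->
  N^T = N -> N \in unitmx -> possemidefmx G -> possemidefmx (N - G - B *m B^T) ->
  (y^T *m invmx N *m y) 0 0 <= (v^T *m v) 0 0 + (s^T *m G *m s) 0 0.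
Proof.
move=> yE Ns Nu [Gs Gp] [_ Hp].
have [z Nz] : exists z, N *m z = y by exists (invmx N *m y); rewrite mulKVmx.
have zE : z = invmx N *m y by rewrite -Nz mulKmx.
have zN : z^T *m N = y^T by rewrite -Nz [RHS]trmx_mul Ns.
have := addr_ge0 (addr_ge0 (sqnorm_ge0 (v - B^T *m z)) (Gp (s - z))) (Hp z).
rewrite -!addmxE => zp; rewrite -subr_ge0; move: zp.
suff -> : (v - B^T *m z)^T *m (v - B^T *m z) + (s - z)^T *m G *m (s - z) +
    z^T *m (N - G - B *m B^T) *m z =
    v^T *m v + s^T *m G *m s - y^T *m invmx N *m y :> 'M[R]_1.
  by rewrite !(addmxE, oppmxE).
rewrite -[y^T *m _ *m y]mulmxA -zE !tr_addmx !tr_oppmx trmx_mul trmxK.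
rewrite !(mulmxDl, mulmxDr, mulNmx, mulmxN, opprK, opprD) !mulmxA zN.
have -> : y^T *m z = z^T *m B *m v + z^T *m G *m s.
  by rewrite -{1}zN -mulmxA Nz yE mulmxDr !mulmxA.
have tr1 (M : 'M[R]_1) : M^T = M.
  by apply/matrixP => i j; rewrite !ord1 !mxE.
rewrite -[z^T *m B *m v]tr1 -[z^T *m G *m s]tr1 !trmx_mul trmxK Gs !mulmxA.
by apply/matrixP => i j; rewrite !mxE; ring.
Qed.

End gram_bound.

Section gram_perturbation.
Context (R : realType) (n m : nat).
Implicit Types (N G Q : 'M[R]_n) (B : 'M[R]_(n, m)).

(** For [s] in the kernel, [Q s = G s]. With [y = Q s], [gram_bound] gives
    [y^T N^-1 y <= s^T G s = y^T Q^-1 y], which contradicts the positivity of [N^-1 - Q^-1] unless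
    [y = 0]. The absent [B] is a matrix with no columns. *)
Lemma sub_gram_unit N G Q : N^T = N -> N \in unitmx -> Q^T = Q -> Q \in unitmx ->
  posdefmx (invmx N - invmx Q) ->
  possemidefmx G -> possemidefmx (N - G) -> Q - G \in unitmx.
Proof.
move=> Ns Nu Qs Qu [_ Kp] Gp Hp; apply: unitmx_injP => s Qs0.
have QG : Q *m s = G *m s by apply/eqP; rewrite -subr_eq0 -mulmxBl Qs0.
have [//|] := eqVneq (Q *m s) 0; first exact: unitmx_inj.
move=> /Kp; rewrite mulmxBr mulmxBl addmxE oppmxE subr_gt0 ltNge => /negP[].
have := @gram_bound R n 0 N G 0 0 s (Q *m s).
rewrite !mulmx0 add0r mul0mx subr0 => /(_ QG Ns Nu Gp Hp).
rewrite [(0 : 'M[R]_1) 0 0]mxE add0r -[s^T *m G *m s]mulmxA -QG => /le_trans; apply.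
by rewrite trmx_mul Qs mulmxK.
Qed.

(** With [s = S^-1 B v] and [y = Q s = B v + G s], the form at [v] equals
    [|v|^2 + s^T G s - y^T Q^-1 y]. By [gram_bound] this is at least [y^T (N^-1 - Q^-1) y]. *)
Lemma sub_gram_posdef N G Q B (S : 'M[R]_n := Q - G) :
  N^T = N -> N \in unitmx -> Q^T = Q -> Q \in unitmx ->
  posdefmx (invmx N - invmx Q) ->
  possemidefmx G -> possemidefmx (N - G - B *m B^T) -> S \in unitmx ->
  posdefmx (1%:M - B^T *m invmx S *m B).
Proof.
move=> Ns Nu Qs Qu [_ Kp] Gp Hp Su.
have Ss : S^T = S by rewrite tr_addmx tr_oppmx Qs Gp.1.
split=> [|v v0].
  by rewrite tr_addmx tr_oppmx trmx1 !trmx_mul trmxK trmx_inv Ss mulmxA.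
pose s := invmx S *m B *m v.
have Ssv : S *m s = B *m v by rewrite /s !mulmxA mulmxV// mul1mx.
have Qsv : Q *m s = B *m v + G *m s.
  by apply/eqP; rewrite -subr_eq -mulmxBl -/S Ssv.
have -> : v^T *m (1%:M - B^T *m invmx S *m B) *m v =
    v^T *m v + s^T *m G *m s - (Q *m s)^T *m invmx Q *m (Q *m s).
  rewrite mulmxBr mulmx1 mulmxBl -addrA -[in RHS]opprB; congr (_ - _).
  rewrite trmx_mul Qs mulmxK// mulmxA -mulmxBl -mulmxBr -/S.
  rewrite -[RHS]mulmxA Ssv /s !trmx_mul trmx_inv Ss.
  by rewrite !mulmxA.
rewrite !(addmxE, oppmxE).
have := gram_bound Qsv Ns Nu Gp Hp; rewrite -subr_ge0.
(* For [y = 0] the lower bound is not strict, but then [s = 0] and the form reduces to [|v|^2]. *)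
have [Qs0 _|/Kp] := eqVneq (Q *m s) 0.
  have -> : s = 0 by apply: unitmx_inj Qs0.
  by rewrite !mulmx0 [X in _ + X - _]mxE [X in _ - X]mxE addr0 subr0 sqnorm_gt0.
rewrite mulmxBr mulmxBl addmxE oppmxE; lra.
Qed.

(** Because [B B^T = (Q - G) - S'], the matrices [1 + B^T S'^-1 B] and [1 - B^T (Q - G)^-1 B] are
    inverse to each other, and the second is positive definite by [sub_gram_posdef]. *)
Lemma add_gram_posdef N G Q B (S' : 'M[R]_n := Q - G - B *m B^T) :
  N^T = N -> N \in unitmx -> Q^T = Q -> Q \in unitmx ->
  posdefmx (invmx N - invmx Q) ->
  possemidefmx G -> possemidefmx (N - G - B *m B^T) ->
  Q - G \in unitmx -> S' \in unitmx ->
  posdefmx (1%:M + B^T *m invmx S' *m B).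
Proof.
move=> Ns Nu Qs Qu Kp Gp Hp Su S'u.
have Xp := sub_gram_posdef Ns Nu Qs Qu Kp Gp Hp Su.
have BB : B *m B^T = (Q - G) - S' by rewrite /S' opprB addrC subrK.
suff -> : 1%:M + B^T *m invmx S' *m B = invmx (1%:M - B^T *m invmx (Q - G) *m B).
  exact: posdef_inv.
rewrite -[RHS]mul1mx; apply: (canRL (mulmxK (posdef_unit Xp))).
have E : B^T *m invmx S' *m B *m (B^T *m invmx (Q - G) *m B) =
    B^T *m invmx S' *m B - B^T *m invmx (Q - G) *m B.
  rewrite !mulmxA -[_ *m B *m B^T]mulmxA BB mulmxBr mulmxKV// mulmxBl mulmxBl.
  by rewrite mulmxK.
rewrite mulmxDl mul1mx mulmxBr mulmx1 E.
by rewrite subKr subrK.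
Qed.

End gram_perturbation.

(** * Steering the state covariance *)

(** Makes the big-operator lemmas for monoids apply to the transition products in [Phi]. *)
HB.instance Definition _ (R : pzSemiRingType) n :=
  Monoid.isLaw.Build 'M[R]_n 1%:M (@mulmx R n n n)
    (@mulmxA R n n n n) (@mul1mx R n n) (@mulmx1 R n n).

Lemma invmx_mul (F : comUnitRingType) n (M N : 'M[F]_n) :
  M \in unitmx -> N \in unitmx -> invmx (M *m N) = invmx N *m invmx M.
Proof.
move=> Mu Nu; have MNu : M *m N \in unitmx by rewrite unitmx_mul Mu.
have H : M *m N *m (invmx N *m invmx M) = 1%:M by rewrite mulmxA mulmxK// mulmxV.
by rewrite -[LHS]mulmx1 -H mulKmx.
Qed.

Section transition.
Context (R : realType) (n m T : nat).
Context (A : nat -> 'M[R]_n) (Bb : nat -> 'M[R]_(n, m)).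
Hypothesis Au : forall k, (k < T)%N -> A k \in unitmx.

Lemma Phi_diag k : Phi A k k = 1%:M.
Proof. by rewrite /Phi leqnn /index_iota subnn big_nil. Qed.

Lemma Phi0S k : Phi A 0 k.+1 = Phi A 0 k *m invmx (A k).
Proof.
rewrite /Phi; case: k => [|k] /=; last by rewrite big_nat_recr.
by rewrite big_nat1 big_nil mul1mx.
Qed.

Lemma Phi_recl k : (k < T)%N -> Phi A T k = Phi A T k.+1 *m A k.
Proof.
move=> kT; rewrite /Phi (ltnW kT) kT -[index_iota k T](_ : k :: index_iota k.+1 T = _).
  by rewrite rev_cons big_rcons.
by rewrite /index_iota -(subnSK kT).
Qed.

Lemma Phi0A k : (k < T)%N -> Phi A 0 k.+1 *m A k = Phi A 0 k.
Proof. by move=> kT; rewrite Phi0S mulmxKV// Au. Qed.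

Lemma Phi_comp k : (k <= T)%N -> Phi A T 0 *m Phi A 0 k = Phi A T k.
Proof.
elim: k => [|k IH] kT; first by rewrite Phi_diag mulmx1.
by rewrite Phi0S mulmxA IH ?(ltnW kT)// Phi_recl// mulmxK// Au.
Qed.

Lemma Phi0_unit k : (k <= T)%N -> Phi A 0 k \in unitmx.
Proof.
elim: k => [|k IH] kT; first by rewrite Phi_diag unitmx1.
by rewrite Phi0S unitmx_mul IH ?(ltnW kT)// unitmx_inv Au.
Qed.

(** The input matrix transported to time 0. The index is [k.+1] because the control of time [k] acts
    on the next state. *)
Definition Bhat k := Phi A 0 k.+1 *m Bb k.

Definition Ghat k := \sum_(0 <= j < k) Bhat j *m (Bhat j)^T.

Lemma GcE : Gc A Bb T 0 = Ghat T.
Proof.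
by apply: eq_bigr => k _; rewrite /Bhat trmx_mul !mulmxA.
Qed.

Lemma GrE : Gr A Bb T 0 = Phi A T 0 *m Gc A Bb T 0 *m (Phi A T 0)^T.
Proof.
rewrite /Gr /Gc mulmx_sumr mulmx_suml; apply: eq_big_nat => k /andP[_ kT].
by rewrite -(Phi_comp kT) trmx_mul !mulmxA.
Qed.

Lemma possemidef_sum_gram j k :
  possemidefmx (\sum_(j <= i < k) Bhat i *m (Bhat i)^T).
Proof.
apply: big_ind; [exact: possemidef0|exact: possemidefD|].
by move=> i _; have := possemidef_gram (Bhat i)^T; rewrite trmxK.
Qed.

(** The two Gramians are congruent through [Phi A T 0], so invertibility of the reachability Gramian
    passes to [Gc A Bb T 0], which is semidefinite as a sum of Gram matrices. *)
Lemma Gc_posdef : Gr A Bb T 0 \in unitmx -> posdefmx (Gc A Bb T 0).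
Proof.
rewrite GrE !unitmx_mul => /andP[/andP[_ Gu] _].
by apply: possemidef_unit => //; rewrite GcE; exact: possemidef_sum_gram.
Qed.

Lemma Ghat_sub k : (k <= T)%N -> possemidefmx (Ghat T - Ghat k).
Proof.
move=> kT; rewrite /Ghat (big_cat_nat (n := k))//= [X in X - _]addrC addrK.
exact: possemidef_sum_gram.
Qed.

Lemma GhatS k : Ghat k.+1 = Ghat k + Bhat k *m (Bhat k)^T.
Proof. by rewrite /Ghat big_nat_recr. Qed.

Context (Q : nat -> 'M[R]_n).
Hypothesis QS : forall k, (k < T)%N ->
  Q k.+1 = A k *m Q k *m (A k)^T - Bb k *m (Bb k)^T.

Lemma Qhat k : (k <= T)%N ->
  Phi A 0 k *m Q k *m (Phi A 0 k)^T = Q 0%N - Ghat k.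
Proof.
elim: k => [|k IH] kT.
  by rewrite Phi_diag mul1mx trmx1 mulmx1 /Ghat big_geq// subr0.
rewrite QS// GhatS opprD addrA -IH ?(ltnW kT)// mulmxBr mulmxBl.
rewrite /Bhat (trmx_mul _ (Bb k)) !mulmxA; congr (_ - _).
by rewrite Phi0A// -!mulmxA -trmx_mul Phi0A.
Qed.

Hypothesis Gcp : posdefmx (Gc A Bb T 0).
Hypothesis Q0s : (Q 0%N)^T = Q 0%N.
Hypothesis Q0u : Q 0%N \in unitmx.
Hypothesis Kp : posdefmx (invmx (Gc A Bb T 0) - invmx (Q 0%N)).

Lemma Q_sym k : (k <= T)%N -> (Q k)^T = Q k.
Proof.
elim: k => // k IH kT; rewrite QS// tr_addmx tr_oppmx !trmx_mul !trmxK.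
by rewrite IH ?(ltnW kT)// mulmxA.
Qed.

Lemma Qhat_unit k : (k <= T)%N -> Q 0%N - Ghat k \in unitmx.
Proof.
move=> kT; apply: (sub_gram_unit Gcp.1 (posdef_unit Gcp)) => //.
  exact: possemidef_sum_gram.
by rewrite GcE; exact: Ghat_sub.
Qed.

Lemma Q_unit k : (k <= T)%N -> Q k \in unitmx.
Proof.
by move=> kT; have := Qhat_unit kT; rewrite -Qhat// !unitmx_mul => /andP[/andP[]].
Qed.

Lemma Phi0_inv_tr k : (k <= T)%N ->
  (Phi A 0 k)^T *m invmx (Q 0%N - Ghat k) *m Phi A 0 k = invmx (Q k).
Proof.
move=> kT; have Cu := Phi0_unit kT; have Ctu : (Phi A 0 k)^T \in unitmx.
  by rewrite unitmx_tr.
have Qu := Q_unit kT; rewrite -Qhat// !invmx_mul ?unitmx_mul ?Cu//.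
by rewrite !mulmxA mulmxV// mul1mx mulmxKV.
Qed.

(** In time-0 coordinates the transition matrices are absorbed into [Bhat k], and [add_gram_posdef]
    applies with [G = Ghat k]. Its semidefiniteness hypothesis says that the partial sum [Ghat k.+1]
    stays below the full Gramian. *)
Lemma precision_posdef k : (k < T)%N ->
  posdefmx (1%:M + (Bb k)^T *m invmx (Q k.+1) *m Bb k).
Proof.
move=> kT; rewrite -Phi0_inv_tr//.
have -> : (Bb k)^T *m ((Phi A 0 k.+1)^T *m invmx (Q 0%N - Ghat k.+1) *m
    Phi A 0 k.+1) *m Bb k = (Bhat k)^T *m invmx (Q 0%N - Ghat k.+1) *m Bhat k.
  by rewrite /Bhat trmx_mul !mulmxA.
have Gk := possemidef_sum_gram 0 k.
have Hk : possemidefmx (Gc A Bb T 0 - Ghat k - Bhat k *m (Bhat k)^T).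
  by rewrite GcE -addrA -opprD -GhatS; exact: Ghat_sub.
have := Qhat_unit kT; rewrite GhatS opprD addrA => Qu.
apply: (add_gram_posdef Gcp.1 (posdef_unit Gcp)) => //.
exact/Qhat_unit/ltnW.
Qed.

End transition.

(** * The boundary equation and the covariance recursion *)

Lemma symmx_inv (F : comUnitRingType) n (M : 'M[F]_n) : M^T = M -> (invmx M)^T = invmx M.
Proof. by move=> Ms; rewrite trmx_inv Ms. Qed.

Lemma sqr_shift_half (F : numFieldType) n (X M : 'M[F]_n) :
  (X + (2^-1)%:M) *m (X + (2^-1)%:M) = M + (4^-1)%:M -> X *m X + X = M.
Proof.
rewrite mulmxDl !mulmxDr mul_mx_scalar mul_scalar_mx -scalar_mxM => XM.
apply: (addIr (4^-1)%:M); rewrite -XM.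
have E : X = 2^-1 *: X + 2^-1 *: X.
  by rewrite -scalerDl (_ : _ + _ = 1) ?scale1r//; field.
have -> : 4^-1 = 2^-1 / 2 :> F by field.
by rewrite [RHS]addrA -[_ + _ + _ *: X]addrA -E.
Qed.

(* [N], [SfT], [Y] and [q0] are [Gc T 0], [Phi 0 T *m Sfin *m (Phi 0 T)^T],
   [sqrtS] and [Q_0]. The matrix [X = Y - 1/2] is congruent to [N^-1 - q0^-1]
   and satisfies [X^2 + X = S0^(1/2) ST S0^(1/2)]. *)
Section boundary.
Context (R : realType) (n : nat) (N Sini SfT : 'M[R]_n).
Hypotheses (Np : posdefmx N) (Sip : posdefmx Sini) (Sfp : posdefmx SfT).

Let Nh := sqrtmx N.
Let S0 := invmx Nh *m Sini *m invmx Nh.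
Let ST := invmx Nh *m SfT *m invmx Nh.
Let S0h := sqrtmx S0.
Let Y := sqrtmx (S0h *m ST *m S0h + (4^-1)%:M).
Let F : 'M[R]_n := S0 + (2^-1)%:M - Y.
Let q0 := Nh *m S0h *m invmx F *m S0h *m Nh.

Hypothesis Fu : F \in unitmx.

Let Nhp : posdefmx Nh. Proof. exact: sqrtmx_posdef. Qed.
Let Nhu : Nh \in unitmx. Proof. exact: posdef_unit. Qed.
Let Nhi : posdefmx (invmx Nh). Proof. exact: posdef_inv. Qed.
Let NhN : Nh *m Nh = N. Proof. exact: (sqrtmxP (posdef_possemidef Np)).2. Qed.

Let S0p : posdefmx S0.
Proof. by rewrite /S0 -{2}Nhi.1; apply: posdef_congr_unit; rewrite ?unitmx_inv. Qed.

Let S0hp : posdefmx S0h. Proof. exact: sqrtmx_posdef. Qed.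
Let S0hu : S0h \in unitmx. Proof. exact: posdef_unit. Qed.
Let S0hS : S0h *m S0h = S0. Proof. exact: (sqrtmxP (posdef_possemidef S0p)).2. Qed.

Let Mp : posdefmx (S0h *m ST *m S0h).
Proof.
rewrite -{2}S0hp.1; apply: posdef_congr_unit => //; rewrite /ST -{2}Nhi.1.
by apply: posdef_congr_unit; rewrite ?unitmx_inv.
Qed.

Let Y_sqrt : possemidefmx Y /\ Y *m Y = S0h *m ST *m S0h + (4^-1)%:M.
Proof.
apply/sqrtmxP/posdef_possemidef/posdefD => //.
by apply/posdef_possemidef/posdef_scalar; rewrite invr_gt0.
Qed.

Let X : 'M[R]_n := Y - (2^-1)%:M.

Let XE : X *m X + X = S0h *m ST *m S0h.
Proof.
by apply: sqr_shift_half; rewrite /X subrK Y_sqrt.2.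
Qed.

(** [X] commutes with [X + 1 = Y + 1/2], which is positive definite, and by [XE] their product is
    positive definite as well; hence so is [X]. *)
Let Xp : posdefmx X.
Proof.
have Zp : posdefmx (X + 1%:M).
  rewrite (_ : X + _ = (2^-1)%:M + Y).
    by apply: posdefD Y_sqrt.1; apply: posdef_scalar; rewrite invr_gt0.
  apply/matrixP => i j; rewrite !mxE.
  by case: (i == j); rewrite ?mulr1n ?mulr0n; field.
have Xs : X^T = X by rewrite /X tr_addmx tr_oppmx tr_scalar_mx Y_sqrt.1.1.
have E := XE; clearbody X; apply: (posdef_comm_mul Xs Zp).
- by rewrite mulmxDr mulmxDl mulmx1 mul1mx.
- by rewrite mulmxDr mulmx1 E.
Qed.

(** A congruence with [H S0 H^T = N^-1] and [H^T Sini H = 1]. It also takes [F] to [q0^-1], hence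
    [X = S0 - F] to [N^-1 - q0^-1]. *)
Let H := invmx Nh *m invmx S0h.

Let Hu : H \in unitmx. Proof. by rewrite unitmx_mul !unitmx_inv Nhu. Qed.

Let q0E : q0 = invmx (H *m F *m H^T).
Proof.
rewrite /H trmx_mul Nhi.1 (symmx_inv S0hp.1) !invmx_mul ?unitmx_mul ?unitmx_inv ?Nhu ?S0hu ?Fu//.
by rewrite !invmxK /q0 !mulmxA.
Qed.

Lemma q0_unit : q0 \in unitmx.
Proof. have Hu' := Hu; have E := q0E; clearbody q0 H F.
by rewrite E unitmx_inv !unitmx_mul unitmx_tr Hu' Fu. Qed.

Let FX : F = S0 - X.
Proof. by rewrite /F /X opprB addrA. Qed.

Lemma q0_sym : q0^T = q0.
Proof.
rewrite q0E; apply: symmx_inv; have Xs := Xp.1; have Ss := S0p.1; have FE := FX.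
clearbody H F X S0; rewrite !trmx_mul trmxK mulmxA.
by rewrite FE tr_addmx tr_oppmx Xs Ss.
Qed.

Let HS0 : H *m S0 *m H^T = invmx N.
Proof.
rewrite /H trmx_mul Nhi.1 (symmx_inv S0hp.1) -S0hS -NhN invmx_mul//.
by rewrite !mulmxA mulmxKV// mulmxK.
Qed.

Let KE : invmx N - invmx q0 = H *m X *m H^T.
Proof.
rewrite q0E invmxK -HS0 FX; clearbody X H S0.
by rewrite mulmxBr mulmxBl opprB addrC subrK.
Qed.

Lemma q0_gap_posdef : posdefmx (invmx N - invmx q0).
Proof. by rewrite KE; exact: posdef_congr_unit. Qed.

Let HSH : H^T *m Sini *m H = 1%:M.
Proof.
rewrite /H trmx_mul Nhi.1 (symmx_inv S0hp.1).
rewrite (_ : _ *m _ = invmx S0h *m S0 *m invmx S0h); last by rewrite /S0 !mulmxA.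
by rewrite -S0hS mulmxA mulVmx// mul1mx mulmxV.
Qed.

(** Since [H^T Sini H = 1], this is the image under the congruence [H] of the scalar-looking
    equation [X + X^2 = S0h ST S0h], of which the shifted square root [Y - 1/2] is a solution. *)
Lemma q0_boundary (K := invmx N - invmx q0) :
  K + K *m Sini *m K = invmx N *m SfT *m invmx N.
Proof.
rewrite /K KE.
have -> : H *m X *m H^T *m Sini *m (H *m X *m H^T) = H *m (X *m X) *m H^T.
  rewrite (_ : _ *m _ = H *m X *m (H^T *m Sini *m H) *m X *m H^T).
    by rewrite HSH mulmx1 !mulmxA.
  by rewrite !mulmxA.
rewrite -mulmxDl -mulmxDr addrC XE.
rewrite /H (trmx_mul (invmx Nh)) Nhi.1 (symmx_inv S0hp.1) /ST -NhN invmx_mul//.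
by rewrite !mulmxA mulmxKV// mulmxK.
Qed.

End boundary.

(** The left-hand side is the terminal covariance in time-0 coordinates, with [S] the initial
    covariance. It reduces through [qT q0^-1 = N K] and [q0^-1 qT = K N]. *)
Lemma boundary_cov (F : comUnitRingType) n (N q0 S : 'M[F]_n)
    (K : 'M[F]_n := invmx N - invmx q0) (qT : 'M[F]_n := q0 - N) :
  N \in unitmx -> q0 \in unitmx ->
  qT - qT *m (invmx q0 - invmx q0 *m S *m invmx q0) *m qT =
  N *m (K + K *m S *m K) *m N.
Proof.
move=> Nu qu.
have NK : qT *m invmx q0 = N *m K by rewrite mulmxBl mulmxBr !mulmxV.
have KN : invmx q0 *m qT = K *m N by rewrite mulmxBl mulmxBr !mulVmx.
have qTE : qT - N *m K *m qT = N *m K *m N.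
  rewrite -[X in X - _]mul1mx -mulmxBl -[RHS]mulmxA -KN mulmxA; congr (_ *m _).
  by rewrite mulmxBr mulmxV// opprB addrC subrK.
clearbody K qT; rewrite mulmxBr mulmxBl NK.
rewrite (_ : qT *m (_ *m S *m _) *m qT = N *m K *m S *m (K *m N)); last first.
  by rewrite -NK -KN !mulmxA.
by rewrite opprB addrA addrAC qTE mulmxDr mulmxDl !mulmxA.
Qed.

(** By the Woodbury identity the closed-loop matrix factors as [L = Q' E^-1 A] with [E = A Q A^T],
    and the noise covariance is [Q' - Q' E^-1 Q']. The first formula gives the invertibility of [L];
    substituting both gives the recursion. *)
Lemma cov_step (F : comUnitRingType) n m (A Q M' : 'M[F]_n) (Bb : 'M[F]_(n, m))
    (Q' : 'M[F]_n := A *m Q *m A^T - Bb *m Bb^T)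
    (W : 'M[F]_m := 1%:M + Bb^T *m invmx Q' *m Bb)
    (L : 'M[F]_n := A - Bb *m invmx W *m Bb^T *m invmx Q' *m A) :
  A \in unitmx -> Q \in unitmx -> Q' \in unitmx -> W \in unitmx ->
  Q^T = Q -> Q'^T = Q' ->
  L \in unitmx /\
  Q' - Q' *m M' *m Q' =
    L *m (Q - Q *m (A^T *m M' *m A) *m Q) *m L^T + Bb *m invmx W *m Bb^T.
Proof.
move=> Au Qu Q'u Wu Qs Q's.
have Eu : A *m Q *m A^T \in unitmx by rewrite !unitmx_mul unitmx_tr Au Qu.
have Es : (A *m Q *m A^T)^T = A *m Q *m A^T by rewrite !trmx_mul trmxK Qs mulmxA.
have EE : Q' + Bb *m invmx 1%:M *m Bb^T = A *m Q *m A^T.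
  by rewrite invmx1 mulmx1 subrK.
have := @woodbury F n m Q' 1%:M Bb; rewrite EE => /(_ Q'u (unitmx1 _ _) Eu Wu) w1.
have := @woodbury_gram F n m Q' 1%:M Bb; rewrite EE => /(_ Q'u (unitmx1 _ _) Eu Wu).
rewrite -/W => ->.
have LE : L = Q' *m invmx (A *m Q *m A^T) *m A by rewrite -w1 mulmxBl mul1mx.
clearbody L W; split; first by rewrite LE !unitmx_mul unitmx_inv Eu Q'u.
have AEA : A *m (Q - Q *m (A^T *m M' *m A) *m Q) *m A^T =
    A *m Q *m A^T - A *m Q *m A^T *m M' *m (A *m Q *m A^T).
  by rewrite mulmxBr mulmxBl !mulmxA.
clearbody Q'; rewrite LE !trmx_mul Q's (symmx_inv Es).
set E := A *m Q *m A^T in Eu Es AEA EE w1 LE *.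
clearbody E.
rewrite (_ : _ *m A *m _ *m _ = Q' *m invmx E *m (E - E *m M' *m E) *m invmx E *m Q').
  rewrite mulmxBr mulmxKV// !mulmxA mulmxKV// !mulmxBl mulmxK//.
  by rewrite [RHS]addrC [RHS]addrA subrK.
by rewrite -AEA !mulmxA.
Qed.

(** * Definiteness and covariances under Assumption (A) *)

Section steering.
Context (R : realType) (n m T : nat).
Context (A : nat -> 'M[R]_n) (Bb : nat -> 'M[R]_(n, m)) (Sini Sfin : 'M[R]_n).
Hypotheses (Sini_pd : posdefmx Sini) (Sfin_pd : posdefmx Sfin).
Hypothesis HA : assumption_A T A Bb Sini Sfin.
Context (Q : nat -> 'M[R]_n).
Hypothesis Q0E : Q 0%N = Q_0 T A Bb Sini Sfin.
Hypothesis QSE : forall k, (k < T)%N ->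
  Q k.+1 = A k *m Q k *m (A k)^T - Bb k *m (Bb k)^T.

Let N := Gc A Bb T 0.
Let C := Phi A 0.
Let SfT := C T *m Sfin *m (C T)^T.

Let Au k : (k < T)%N -> A k \in unitmx. Proof. by case: HA => + _ _; apply. Qed.

Let Np : posdefmx N.
Proof.
apply: Gc_posdef => //.
by case: HA => _ [kr [/andP[kr1 _] _ H]] _; exact: H.
Qed.

Let Cu k : (k <= T)%N -> C k \in unitmx. Proof. by move=> kT; exact: Phi0_unit kT. Qed.

Let SfTp : posdefmx SfT. Proof. by apply: posdef_congr_unit => //; exact: Cu. Qed.

Let STE : S_T T A Bb Sfin = invsqrtmx N *m SfT *m invsqrtmx N.
Proof. by rewrite /S_T /SfT !mulmxA. Qed.

Let Fu : F_mx T A Bb Sini Sfin \in unitmx.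
Proof. by case: HA => _ _ []. Qed.

Let q0u : Q 0%N \in unitmx.
Proof.
have := Fu; rewrite Q0E /Q_0 /F_mx /sqrtS STE => Fu'.
exact: (@q0_unit _ _ N Sini SfT).
Qed.

Let q0s : (Q 0%N)^T = Q 0%N.
Proof.
have := Fu; rewrite Q0E /Q_0 /F_mx /sqrtS STE => Fu'.
exact: (@q0_sym _ _ N Sini SfT).
Qed.

Let Kp : posdefmx (invmx N - invmx (Q 0%N)).
Proof.
have := Fu; rewrite Q0E /Q_0 /F_mx /sqrtS STE => Fu'.
exact: (@q0_gap_posdef _ _ N Sini SfT).
Qed.

Let boundary : (invmx N - invmx (Q 0%N)) +
  (invmx N - invmx (Q 0%N)) *m Sini *m (invmx N - invmx (Q 0%N)) =
  invmx N *m SfT *m invmx N.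
Proof.
have := Fu; rewrite Q0E /Q_0 /F_mx /sqrtS STE => Fu'.
exact: (@q0_boundary _ _ N Sini SfT).
Qed.

Lemma steering_Q_sym k : (k <= T)%N -> (Q k)^T = Q k.
Proof. exact: (Q_sym QSE q0s). Qed.

Lemma steering_Q_unit k : (k <= T)%N -> Q k \in unitmx.
Proof. exact: (Q_unit Au QSE Np q0s q0u Kp). Qed.

Lemma steering_posdef k : (k < T)%N ->
  posdefmx (1%:M + (Bb k)^T *m invmx (Q k.+1) *m Bb k).
Proof. exact: (precision_posdef Au QSE Np q0s q0u Kp). Qed.

(* Steering by the optimal gains keeps the covariance of the form
   [Q k - Q k M_k Q k] with [M_k = (A k)^T M_(k+1) (A k)]. *)
Lemma steering_covariance : exists Sg : nat -> 'M[R]_n,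
  [/\ Sg 0%N = Sini, Sg T = Sfin & forall k, (k < T)%N ->
    let W := 1%:M + (Bb k)^T *m invmx (Q k.+1) *m Bb k in
    let L := A k - Bb k *m invmx W *m (Bb k)^T *m invmx (Q k.+1) *m A k in
    L \in unitmx /\
    Sg k.+1 = L *m Sg k *m L^T + Bb k *m invmx W *m (Bb k)^T].
Proof.
(* Solves [Q 0 - Q 0 *m M *m Q 0 = Sini], so the initial covariance is correct by construction;
   [C k] then carries [M] to time [k]. *)
pose M : 'M[R]_n := invmx (Q 0%N) - invmx (Q 0%N) *m Sini *m invmx (Q 0%N).
exists (fun k => Q k - Q k *m ((C k)^T *m M *m C k) *m Q k); split.
- rewrite /C Phi_diag trmx1 mul1mx mulmx1 /M mulmxBr mulmxBl mulmxV// mul1mx.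
  by rewrite !mulmxA mulmxV// mul1mx mulmxKV// opprB addrC subrK.
- have CT := Cu (leqnn T); have CTt : (C T)^T \in unitmx by rewrite unitmx_tr.
  apply: (can_inj (mulKmx CT)); apply: (can_inj (mulmxK CTt)).
  rewrite -/SfT mulmxBr mulmxBl.
  have QT : C T *m Q T *m (C T)^T = Q 0%N - N by rewrite /N GcE; exact: (Qhat Au QSE).
  rewrite (_ : C T *m (Q T *m _ *m _) *m _ =
    (C T *m Q T *m (C T)^T) *m M *m (C T *m Q T *m (C T)^T)); last by rewrite !mulmxA.
  rewrite QT [LHS](boundary_cov Sini (posdef_unit Np) q0u) boundary.
  rewrite !mulmxA mulmxV ?posdef_unit//.
  by rewrite mul1mx mulmxKV ?posdef_unit.
- move=> k kT W L.
  have := @cov_step R n m (A k) (Q k) ((C k.+1)^T *m M *m C k.+1) (Bb k).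
  rewrite -QSE// => /(_ (Au kT) (steering_Q_unit (ltnW kT)) (steering_Q_unit kT)).
  move=> /(_ (posdef_unit (steering_posdef kT)) (steering_Q_sym (ltnW kT))).
  rewrite (_ : (A k)^T *m _ *m A k = (C k)^T *m M *m C k).
    by move=> /(_ (steering_Q_sym kT)).
  by rewrite -[C k](Phi0A Au kT) -/C trmx_mul !mulmxA.
Qed.

End steering.

(** * Densities and disintegration *)

Section mdensity.
Local Open Scope ereal_scope.
Context d (T : measurableType d) (R : realType) (mu : {measure set T -> \bar R}).
Context (f : T -> \bar R).
Hypotheses (mf : measurable_fun setT f) (f0 : forall x, 0 <= f x).

(* The hypotheses are arguments so that the measure structure can be inferred. *)
Definition mdensity (_ : measurable_fun setT f) (_ : forall x, 0 <= f x) (A : set T) :=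
  \int[mu]_(x in A) f x.

Local Notation nu := (mdensity mf f0).

Let nu0 : nu set0 = 0. Proof. exact: integral_set0. Qed.

Let nu_ge0 A : 0 <= nu A. Proof. by apply: integral_ge0 => x _. Qed.

Let nu_sigma_additive : semi_sigma_additive nu.
Proof.
move=> F mF tF mUF; rewrite /mdensity ge0_integral_bigcup//.
  by apply: is_cvg_ereal_nneg_natsum_cond => n _ _; exact: nu_ge0.
exact: measurable_funTS.
Qed.

HB.instance Definition _ := isMeasure.Build _ _ _ nu nu0 nu_ge0 nu_sigma_additive.

Import HBNNSimple.

Let nnsfun_mdensity (h : {nnsfun T >-> R}) :
  \int[nu]_x (h x)%:E = \int[mu]_x ((h x)%:E * f x).
Proof.
have mh r : measurable (h @^-1` [set r]) by [].
rewrite integralT_nnsfun sintegralE.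
transitivity (\int[mu]_x \sum_(r \in range h) (r%:E * (f \_ (h @^-1` [set r])) x)).
  rewrite ge0_integral_fsum//.
  - apply: eq_fsbigr => r; rewrite inE => -[x _ <-].
    rewrite ge0_integralZl//; first by rewrite -integral_mkcond.
    + by rewrite -(measurable_restrictT _ (mh _)); exact: measurable_funTS.
    + by move=> y _; exact: erestrict_ge0.
    + by rewrite lee_fin.
  - move=> r; apply: measurable_funeM.
    by rewrite -(measurable_restrictT _ (mh _)); exact: measurable_funTS.
  - move=> r x _; have [->|/set0P[y /= hy]] := eqVneq (h @^-1` [set r]) set0.
      by rewrite patch_set0 mule0.
    by rewrite mule_ge0// ?erestrict_ge0// -hy lee_fin.
apply: eq_integral => x _.
rewrite (fsbigD1 (h x))//=; last by exists x.
rewrite fsbig1 ?adde0; first by rewrite patchE mem_set.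
by move=> r [_ rh]; rewrite patchE memNset ?mule0// => hr; apply: rh; rewrite /= -hr.
Qed.

Lemma ge0_integral_mdensity (g : T -> \bar R) :
  (forall x, f x \is a fin_num) -> measurable_fun setT g ->
  (forall x, 0 <= g x) -> \int[nu]_x g x = \int[mu]_x (g x * f x).
Proof.
move=> ffin mg g0; pose h := nnsfun_approx measurableT mg.
have hg x : (h n x)%:E @[n --> \oo] --> g x by exact: cvg_nnsfun_approx.
have hnd x : {homo (fun n => (h n x)%:E) : a b / (a <= b)%N >-> a <= b}.
  by move=> a b ab; rewrite lee_fin; exact/lefP/nd_nnsfun_approx.
transitivity (limn (fun n => \int[nu]_x (h n x)%:E)).
  rewrite -monotone_convergence//=.
  - by apply: eq_integral => x _; apply/esym/cvg_lim.
  - by move=> n; exact/measurable_EFinP.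
  - by move=> n x _; rewrite lee_fin.
under eq_fun do rewrite nnsfun_mdensity.
rewrite -monotone_convergence//=.
- apply: eq_integral => x _; apply/cvg_lim => //.
  by apply: cvgeZr.
- by move=> n; apply: emeasurable_funM => //; exact/measurable_EFinP.
- by move=> n x _; rewrite mule_ge0// lee_fin.
- by move=> x _ a b ab; rewrite lee_wpmul2r// hnd.
Qed.

End mdensity.

Section disintegration.
Local Open Scope ereal_scope.
Context (R : realType) d d1 d2 (W : measurableType d) (T1 : measurableType d1)
  (T2 : measurableType d2) (P : probability W R) (X : {RV P >-> T1})
  (U : {RV P >-> T2}) (lam : {sigma_finite_measure set T2 -> \bar R})
  (p : T1 -> T2 -> R).
Hypotheses (mp : measurable_fun setT (fun z : T1 * T2 => p z.1 z.2))
  (p0 : forall x v, (0 <= p x v)%R)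
  (XU : forall C D, measurable C -> measurable D ->
    P (X @^-1` C `&` U @^-1` D) =
    \int[P]_(w in X @^-1` C) \int[lam]_(v in D) (p (X w) v)%:E).

Lemma ge0_integral_law (f : T1 -> \bar R) : measurable_fun setT f ->
  (forall x, 0 <= f x) -> \int[P]_w f (X w) = \int[distribution P X]_x f x.
Proof. by move=> mf f0; rewrite ge0_integral_pushforward. Qed.

Let XUm : measurable_fun setT (fun w => (X w, U w)).
Proof. by apply: measurable_fun_pair. Qed.

Let pE := (fun z : T1 * T2 => (p z.1 z.2)%:E).

Let mpE : measurable_fun setT pE. Proof. exact/measurable_EFinP. Qed.

Let pE0 z : 0 <= pE z. Proof. by rewrite lee_fin. Qed.

Let mu := (distribution P X \x lam).

(** Both measures agree on rectangles by [XU] and Tonelli, and the rectangles form a generating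
    class stable under intersection. *)
Let joint A : measurable A ->
  pushforward P (fun w => (X w, U w)) A = mdensity mu mpE pE0 A.
Proof.
have XUi : isMeasurableFun d _ W _ (fun w => (X w, U w)) by split.
pose XU' : {mfun W >-> (T1 * T2)%type} := HB.pack (fun w => (X w, U w)) XUi.
move=> mA.
apply: (@measure_unique _ _ _ [set C `*` D | C in measurable & D in measurable]
  (fun=> setT) _ _ _ _ (distribution P XU') (mdensity mu mpE pE0)) => //.
- exact: measurable_prod_measurableType.
- move=> _ _ [C mC [D mD <-]] [C' mC' [D' mD' <-]]; rewrite -setXI.
  by exists (C `&` C'); [exact: measurableI|exists (D `&` D') => //; exact: measurableI].
- by move=> _; exists setT => //; exists setT => //; rewrite setXTT.
- by rewrite bigcup_const.
- move=> _ [C mC [D mD <-]].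
  have mCD : measurable (C `*` D) by exact: measurableX.
  transitivity (P (X @^-1` C `&` U @^-1` D)); first by [].
  rewrite XU// /mdensity -[LHS]/(\int[P]_(w in X @^-1` C)
    ((fun x => \int[lam]_(v in D) (p x v)%:E) \o X) w).
  rewrite -ge0_integral_pushforward//; first last.
  + by move=> x _; apply: integral_ge0 => v _; rewrite lee_fin.
  + apply: measurable_funTS.
    rewrite (_ : (fun x => _) = fubini_F lam (pE \_ (setT `*` D))).
      apply: measurable_fun_fubini_tonelli_F.
        apply/(measurable_restrictT _ _).1; first exact: measurableX.
        exact: measurable_funTS.
      by move=> z; exact: erestrict_ge0.
    apply/funext => x; rewrite /fubini_F [LHS]integral_mkcond; apply: eq_integral => v _.
    by rewrite !patchE in_setX in_setT.
  have mpCD : measurable_fun setT (pE \_ (C `*` D)).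
    have H : measurable_fun (C `*` D) pE by exact: measurable_funTS.
    exact: (iffLR (measurable_restrictT pE mCD) H).
  have pCD0 z : 0 <= (pE \_ (C `*` D)) z by exact: erestrict_ge0.
  rewrite [RHS]integral_mkcond (fubini_tonelli1 _ mpCD pCD0).
  rewrite [LHS]integral_mkcond; apply: eq_integral => x _.
  rewrite patchE /fubini_F; case: ifPn => xC.
    rewrite [LHS]integral_mkcond; apply: eq_integral => v _.
    by rewrite !patchE in_setX xC.
  by rewrite integral0_eq// => v _; rewrite patchE in_setX (negbTE xC).
- by move=> _; rewrite (le_lt_trans (probability_le1 _ _))// ltry.
Qed.

(** The defining identity [XU] speaks of rectangles only. Once the joint law is known to have
    density [p] with respect to the law of [X] times [lam], Tonelli extends it to all nonnegative
    functions. *)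
Lemma disintegration (f : T1 * T2 -> \bar R) : measurable_fun setT f ->
  (forall z, 0 <= f z) ->
  \int[P]_w f (X w, U w) =
  \int[P]_w \int[lam]_v (f (X w, v) * (p (X w) v)%:E).
Proof.
move=> mf f0.
have mfp : measurable_fun setT (fun z => f z * pE z) by exact: emeasurable_funM.
have fp0 z : 0 <= f z * pE z by rewrite mule_ge0.
have XUi : isMeasurableFun d _ W _ (fun w => (X w, U w)) by split.
pose XU' : {mfun W >-> (T1 * T2)%type} := HB.pack (fun w => (X w, U w)) XUi.
transitivity (\int[distribution P XU']_z f z).
  by rewrite ge0_integral_pushforward.
transitivity (\int[mdensity mu mpE pE0]_z f z).
  by apply: eq_measure_integral => A mA _; exact: joint.
rewrite ge0_integral_mdensity// fubini_tonelli1// [RHS](@ge0_integral_law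
  (fun x => \int[lam]_v (f (x, v) * (p x v)%:E)))//.
- exact: (@measurable_fun_fubini_tonelli_F _ _ _ _ _ lam _ mfp fp0).
- by move=> x; apply: integral_ge0 => v _; exact: (fp0 (x, v)).
Qed.

End disintegration.

(** * Lebesgue measure on column vectors *)

Section measurable_mxops.
Context (R : realType) d (T : measurableType d).

Lemma measurable_mulmx a b c (f : T -> 'M[R]_(a, b)) (g : T -> 'M[R]_(b, c)) :
  measurable_fun setT f -> measurable_fun setT g ->
  measurable_fun setT (fun t => f t *m g t).
Proof.
move=> mf mg; apply: measurable_mxP => i j; under eq_fun do rewrite mxE.
apply: measurable_sum => k; apply: measurable_funM.
- exact: (measurableT_comp (@measurable_mx_entry R a b i k) mf).
- exact: (measurableT_comp (@measurable_mx_entry R b c k j) mg).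
Qed.

Lemma measurable_addmx a b (f g : T -> 'M[R]_(a, b)) :
  measurable_fun setT f -> measurable_fun setT g ->
  measurable_fun setT (fun t => f t + g t).
Proof.
move=> mf mg; apply: measurable_mxP => i j; under eq_fun do rewrite mxE.
apply: measurable_funD.
- exact: (measurableT_comp (@measurable_mx_entry R a b i j) mf).
- exact: (measurableT_comp (@measurable_mx_entry R a b i j) mg).
Qed.

Lemma measurable_oppmx a b (f : T -> 'M[R]_(a, b)) :
  measurable_fun setT f -> measurable_fun setT (fun t => - f t).
Proof.
move=> mf; apply: measurable_mxP => i j; under eq_fun do rewrite mxE.
apply: measurableT_comp => //.
exact: (measurableT_comp (@measurable_mx_entry R a b i j) mf).
Qed.

Lemma measurable_trmx a b (f : T -> 'M[R]_(a, b)) :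
  measurable_fun setT f -> measurable_fun setT (fun t => (f t)^T).
Proof.
move=> mf; apply: measurable_mxP => i j; under eq_fun do rewrite mxE.
exact: (measurableT_comp (@measurable_mx_entry R a b j i) mf).
Qed.

End measurable_mxops.

Section lebesgue_cV_theory.
Local Open Scope ereal_scope.
Context (R : realType).
Notation mu := (@lebesgue_measure R).

(** The image of Lebesgue measure under the shift has the same value on half-open intervals, and
    these determine it. *)
Lemma ge0_integral_shift1 (a : R) (f : R -> \bar R) : measurable_fun setT f ->
  (forall t, 0 <= f t) -> \int[mu]_t f (t + a)%R = \int[mu]_t f t.
Proof.
move=> mf f0.
pose s : measurableTypeR R -> measurableTypeR R := fun t => (t + a)%R.
have ms : measurable_fun setT s by exact: measurable_funD.
rewrite -[LHS](@ge0_integral_pushforward _ _ _ _ _ _ ms mu setT)//.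
have si : isMeasurableFun _ _ _ _ s by split.
pose s' : {mfun measurableTypeR R >-> measurableTypeR R} := HB.pack s si.
apply: eq_measure_integral => A mA _; apply/esym.
apply: (@lebesgue_measure_unique _ (pushforward mu s')) => // _ [[b c]] _ <-.
transitivity (mu `](b - a)%R, (c - a)%R]%classic).
  rewrite !lebesgue_measure_itv/= !lte_fin ltrD2r.
  by case: ifP => // _; rewrite -!EFinD; congr (_%:E); ring.
congr (mu _); apply/seteqP; split=> t /=;
  by rewrite !in_itv/= /s ltrBlDr lerBrDr.
Qed.

Lemma ge0_integral_cV_cons n (f : 'cV[R]_n.+1 -> \bar R) :
  measurable_fun setT f -> (forall x, 0 <= f x) ->
  \int[lebesgue_cV R n.+1]_x f x =
  \int[lebesgue_cV R n]_y \int[mu]_t f (cV_cons (t, y)).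
Proof.
move=> mf f0.
have mc : measurable_fun [set: (measurableTypeR R * 'cV[R]_n)%type] (@cV_cons R n).
  exact: measurable_cV_cons.
have mfc : measurable_fun setT (f \o @cV_cons R n) by exact: measurableT_comp.
rewrite -(@fubini_tonelli2 _ _ _ _ _ mu (lebesgue_cV R n) (f \o @cV_cons R n))//; last first.
  by move=> z; exact: f0.
by rewrite [LHS](@ge0_integral_pushforward _ _ _ _ _ _ mc (mu \x lebesgue_cV R n) setT f).
Qed.

Lemma measurable_integral_cV_cons n (f : 'cV[R]_n.+1 -> \bar R) :
  measurable_fun setT f -> (forall x, 0 <= f x) ->
  measurable_fun setT (fun y : 'cV[R]_n => \int[mu]_t f (cV_cons (t, y))).
Proof.
move=> mf f0.
have mfc : measurable_fun [set: (measurableTypeR R * 'cV[R]_n)%type]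
    (f \o @cV_cons R n).
  by apply: (measurableT_comp mf); exact: measurable_cV_cons.
exact: (@measurable_fun_fubini_tonelli_G _ _ _ _ _ mu _ mfc (fun z => f0 _)).
Qed.

Lemma cV_consD n (t a : R) (y b : 'cV[R]_n) :
  cV_cons ((t + a)%R, (y + b)%R) = (cV_cons (t, y) + cV_cons (a, b))%R.
Proof. rewrite /cV_cons/= (_ : (t + a)%:M = t%:M + a%:M :> 'M[R]_1)%R.
  exact/esym/(@add_col_mx R 1 n 1).
by apply/matrixP => i j; rewrite !ord1 !mxE. Qed.

Lemma ge0_integral_cV_shift n (a : 'cV[R]_n) (f : 'cV[R]_n -> \bar R) :
  measurable_fun setT f -> (forall x, 0 <= f x) ->
  \int[lebesgue_cV R n]_x f (x + a)%R = \int[lebesgue_cV R n]_x f x.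
Proof.
elim: n a f => [|n IH] a f mf f0.
  by apply: eq_integral => x _; congr f; apply/matrixP => -[].
have ma : measurable_fun setT (fun x : 'cV[R]_n.+1 => x + a)%R.
  by apply: measurable_addmx.
have mfa : measurable_fun setT (fun x : 'cV[R]_n.+1 => f (x + a)%R).
  exact: (measurableT_comp mf ma).
rewrite (ge0_integral_cV_cons mfa (fun x => f0 _)) (ge0_integral_cV_cons mf f0).
pose g y := \int[mu]_t f (cV_cons (t, y)).
rewrite -[a]cV_consKV; case: (cV_uncons a) => s b.
transitivity (\int[lebesgue_cV R n]_y g (y + b)%R).
  apply: eq_integral => y _; rewrite /g -[RHS](ge0_integral_shift1 s)//.
    by apply: eq_integral => t _; rewrite cV_consD.
  apply: (measurableT_comp mf); apply: (measurableT_comp (@measurable_cV_cons R n)).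
  exact: measurable_pair2.
apply: IH => [|y]; last by apply: integral_ge0 => t _.
exact: measurable_integral_cV_cons.
Qed.

(* Uniqueness of a translation-invariant measure, in the form needed for linear
   changes of variables: [int f(x) dmu(x) = int int f(x + y) g(y) dmu(x) dy],
   then swap and substitute [y := y - x]. *)
Lemma ge0_integral_linear n (L : 'M[R]_n) (g : 'cV[R]_n -> \bar R) :
  L \in unitmx -> measurable_fun setT g -> (forall x, 0 <= g x) ->
  \int[lebesgue_cV R n]_x g x = 1 ->
  forall f, measurable_fun setT f -> (forall x, 0 <= f x) ->
  \int[lebesgue_cV R n]_x f (L *m x) =
  (\int[lebesgue_cV R n]_x g (- (L *m x))%R) * \int[lebesgue_cV R n]_x f x.
Proof.
move=> Lu mg g0 g1 f mf f0; set lam := lebesgue_cV R n.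
have mL : measurable_fun setT (fun x : 'cV[R]_n => L *m x).
  by apply: measurable_mulmx.
have mfst : measurable_fun setT (fun z : 'cV[R]_n * 'cV[R]_n => L *m z.1).
  exact: (measurableT_comp mL measurable_fst).
transitivity (\int[lam]_y (g y * \int[lam]_x f (L *m x))).
  rewrite ge0_integralZr// ?g1 ?mul1e//.
  by apply: integral_ge0.
transitivity (\int[lam]_y \int[lam]_x (f (L *m x + y)%R * g y)).
  apply: eq_integral => y _; rewrite muleC -ge0_integralZr//.
  (* Invertibility of [L] makes the image measure translation invariant: a shift by [y] after [L] is
     a shift by [invmx L *m y] before it. *)
  - have -> : y = L *m (invmx L *m y) by rewrite mulmxA mulmxV ?mul1mx.
    rewrite -[LHS](ge0_integral_cV_shift (invmx L *m y))//.
    + apply: eq_integral => x _.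
      by rewrite mulmxDr.
    + apply: emeasurable_funM => //; apply: measurableT_comp => //.
    + by move=> x; exact: mule_ge0.
  - exact: (measurableT_comp mf mL).
transitivity (\int[lam]_x \int[lam]_y (f (L *m x + y)%R * g y)).
  apply/esym/(fubini_tonelli (fun z => f (L *m z.1 + z.2)%R * g z.2)).
    apply: emeasurable_funM; last exact: (measurableT_comp mg measurable_snd).
    by apply: (measurableT_comp mf); apply: measurable_addmx.
  by move=> z; exact: mule_ge0.
transitivity (\int[lam]_x \int[lam]_y (f y * g (y - L *m x)%R)).
  apply: eq_integral => x _.
  rewrite -[RHS](ge0_integral_cV_shift (L *m x))//.
  + by apply: eq_integral => y _; rewrite addrK addrC.
  + apply: emeasurable_funM => //; apply: (measurableT_comp mg).
    by apply: measurable_addmx.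
  + by move=> y; exact: mule_ge0.
transitivity (\int[lam]_y \int[lam]_x (f y * g (y - L *m x)%R)).
  apply: (fubini_tonelli (fun z => f z.2 * g (z.2 - L *m z.1)%R)).
    apply: emeasurable_funM; first exact: (measurableT_comp mf measurable_snd).
    apply: (measurableT_comp mg); apply: measurable_addmx => //.
    exact: measurable_oppmx.
  by move=> z; exact: mule_ge0.
have mgL : measurable_fun setT (fun x => g (- (L *m x))%R).
  by apply: (measurableT_comp mg); exact: measurable_oppmx.
rewrite muleC -ge0_integralZr//; last by apply: integral_ge0.
apply: eq_integral => y _; rewrite ge0_integralZl//; last first.
  apply: (measurableT_comp mg); apply: measurable_addmx => //.
  exact: measurable_oppmx.
congr (_ * _).
have -> : y = L *m (invmx L *m y) by rewrite mulmxA mulmxV ?mul1mx.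
rewrite -[LHS](ge0_integral_cV_shift (invmx L *m y))//.
- by apply: eq_integral => x _; rewrite mulmxDr opprD addrCA subrr addr0.
- apply: (measurableT_comp mg); apply: measurable_addmx => //.
  exact: measurable_oppmx.
Qed.

End lebesgue_cV_theory.

(** * Gaussian vectors *)

Section gauss_integral.
Context (R : realType).

Lemma integral_expR_sqr (a b : R) : 0 < a ->
  (\int[@lebesgue_measure R]_t (expR (- (2^-1 * (a * (t + b) ^+ 2))))%:E =
   (Num.sqrt (2 * pi / a))%:E)%E.
Proof.
move=> a0; pose s := Num.sqrt a^-1.
have s2 : s ^+ 2 = a^-1 by rewrite sqr_sqrtr// invr_ge0 ltW.
have s0 : s != 0 by rewrite gt_eqF// sqrtr_gt0 invr_gt0.
have c0 : 0 < 2 * pi / a :> R by rewrite divr_gt0// mulr_gt0// pi_gt0.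
have nE t : expR (- (2^-1 * (a * (t + b) ^+ 2))) =
    Num.sqrt (2 * pi / a) * normal_pdf (- b) s t.
  rewrite normal_pdfE// /normal_peak /normal_fun s2.
  rewrite (_ : a^-1 * pi *+ 2 = 2 * pi / a); last by rewrite -mulr_natl; ring.
  rewrite mulVKf ?gt_eqF ?sqrtr_gt0//; congr expR; rewrite opprK.
  by field; rewrite gt_eqF.
under eq_integral do rewrite nE EFinM.
rewrite integralZl//; last exact: integrable_normal_pdf.
by rewrite integral_normal_pdf mule1.
Qed.

(** The Schur complement of the corner entry: integrating the first coordinate out of a Gaussian
    with precision [P] leaves one with this precision. *)
Definition schur n (P : 'M[R]_(1 + n)) : 'M[R]_n :=
  drsubmx P - (P 0 0)^-1 *: ((ursubmx P)^T *m ursubmx P).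

Lemma symmx_blocks n (P : 'M[R]_(1 + n)) : P^T = P ->
  P = block_mx (P 0 0)%:M (ursubmx P) (ursubmx P)^T (drsubmx P).
Proof.
move=> Ps; rewrite -{1}[P]submxK; congr block_mx.
- apply/matrixP => i j; rewrite !ord1 !mxE eqxx mulr1n.
  by congr (P _ _); exact: val_inj.
- by rewrite -{1}Ps trmx_ursub.
Qed.

Lemma det_schur n (P : 'M[R]_(1 + n)) : P^T = P -> P 0 0 != 0 ->
  \det P = P 0 0 * \det (schur P).
Proof.
move=> /symmx_blocks PE P0.
pose U : 'M[R]_(1 + n) := block_mx 1%:M (- (P 0 0)^-1 *: ursubmx P) 0 1%:M.
have <- : \det (P *m U) = \det P.
  by rewrite det_mulmx /U det_ublock !det1 !mulr1.
rewrite PE /U mulmx_block -PE !mulmx1 !mulmx0 !addr0.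
rewrite (_ : _ *m (- _ *: _) + ursubmx P = 0) ?det_lblock ?det_scalar1; last first.
  by rewrite mul_scalar_mx scalerA mulrN divff// scaleN1r addNr.
congr (_ * \det _); rewrite -scalemxAr scaleNr addrC.
by rewrite /schur.
Qed.

Lemma quad_schur n (P : 'M[R]_(1 + n)) (t : R) (y : 'cV[R]_n)
    (v := col_mx t%:M y : 'cV[R]_(1 + n)) : P^T = P -> P 0 0 != 0 ->
  (v^T *m P *m v) 0 0 =
  P 0 0 * (t + (P 0 0)^-1 * (ursubmx P *m y) 0 0) ^+ 2 + (y^T *m schur P *m y) 0 0.
Proof.
move=> /symmx_blocks PE P0; set a := P 0 0 in P0 PE *.
have sc (c : R) (M : 'M[R]_1) : (c%:M *m M) 0 0 = c * M 0 0.
  by rewrite mul_scalar_mx mxE.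
have tE : (t%:M : 'M[R]_1)^T = t%:M by rewrite tr_scalar_mx.
set r := ursubmx P in PE *; set D := drsubmx P in PE *.
rewrite {1}PE /v tr_col_mx mul_row_block mul_row_col tE.
rewrite !mulmxDl !addmxE -!mulmxA !sc.
have -> : (y^T *m (r^T *m t%:M)) 0 0 = t * (r *m y) 0 0.
  rewrite mul_mx_scalar -scalemxAr mxE; congr (_ * _).
  by rewrite -trmx_mul mxE.
have -> : (t%:M : 'M[R]_1) 0 0 = t by rewrite mxE eqxx mulr1n.
rewrite /schur -/r -/D -/a mulmxBl mulmxBr addmxE oppmxE -scalemxAl -scalemxAr.
rewrite [((_ *: _) : 'M[R]_1) 0 0]mxE.
have -> : (y^T *m (r^T *m r *m y)) 0 0 = ((r *m y) 0 0) ^+ 2.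
  by rewrite !mulmxA -trmx_mul -mulmxA mxE big_ord1 mxE expr2.
by field.
Qed.

Lemma schur_posdef n (P : 'M[R]_(1 + n)) : posdefmx P ->
  0 < P 0 0 /\ posdefmx (schur P).
Proof.
move=> [Ps Pp].
have P0 : 0 < P 0 0.
  have := Pp (delta_mx 0 0); rewrite trmx_delta -rowE -colE !mxE; apply.
  by apply/eqP => /colP/(_ 0); rewrite !mxE eqxx => /eqP; rewrite oner_eq0.
have P00 : P 0 0 != 0 by rewrite gt_eqF.
split=> //; split=> [|y y0].
  rewrite /schur tr_addmx tr_oppmx linearZ /= trmx_mul trmxK.
  by rewrite trmx_drsub Ps.
pose t := - ((P 0 0)^-1 * (ursubmx P *m y) 0 0).
have := Pp (col_mx t%:M y); rewrite quad_schur// /t addNr expr0n mulr0 add0r.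
apply; apply: contra_neq y0 => /(congr1 (@dsubmx _ 1 n 1)).
by rewrite col_mxKd => ->; rewrite linear0.
Qed.

Lemma measurable_quad d (T : measurableType d) n (P : 'M[R]_n)
    (f : T -> 'cV[R]_n) : measurable_fun setT f ->
  measurable_fun setT (fun t => ((f t)^T *m P *m f t) 0 0).
Proof.
move=> mf; apply: (measurableT_comp (@measurable_mx_entry R 1 1 0 0)).
by apply: measurable_mulmx => //; apply: measurable_mulmx => //; exact: measurable_trmx.
Qed.

Lemma measurable_expR_quad d (T : measurableType d) n (P : 'M[R]_n) (c : R)
    (f : T -> 'cV[R]_n) : measurable_fun setT f ->
  measurable_fun setT (fun t => expR (- (c * ((f t)^T *m P *m f t) 0 0))).
Proof.
move=> mf; apply: measurableT_comp => //; apply: measurableT_comp => //.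
by apply: measurable_funM => //; exact: measurable_quad.
Qed.

(** Induction along the recursive definition of [lebesgue_cV]. By [quad_schur] the inner integral is
    a shifted one-dimensional Gaussian of precision [P 0 0], the outer one has precision [schur P],
    and the determinants multiply by [det_schur]. *)
Lemma integral_expR_quad n (P : 'M[R]_n) : posdefmx P ->
  (\int[lebesgue_cV R n]_v (expR (- (2^-1 * (v^T *m P *m v) 0 0)))%:E =
   (Num.sqrt ((2 * pi) ^+ n / \det P))%:E)%E.
Proof.
elim: n P => [|n IH] P Pp.
  rewrite integral_dirac//; last first.
    by apply/measurable_EFinP; exact: measurable_expR_quad.
  by rewrite diracT mul1e trmx0 !mul0mx mxE mulr0 oppr0 expR0 det_mx00 expr0 divr1 sqrtr1.
have [P0 Sp] := @schur_posdef n P Pp; have P00 : P 0 0 != 0 by rewrite gt_eqF.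
have c0 : 0 <= 2 * pi / P 0 0 :> R by rewrite divr_ge0 ?ltW// mulr_gt0// pi_gt0.
have mE : measurable_fun setT (fun v : 'cV[R]_n.+1 =>
    (expR (- (2^-1 * (v^T *m P *m v) 0 0)))%:E).
  by apply/measurable_EFinP; exact: measurable_expR_quad.
rewrite ge0_integral_cV_cons//.
transitivity (\int[lebesgue_cV R n]_y ((Num.sqrt (2 * pi / P 0 0))%:E *
    (expR (- (2^-1 * (y^T *m schur P *m y) 0 0)))%:E))%E.
  apply: eq_integral => y _.
  rewrite -(integral_expR_sqr ((P 0 0)^-1 * (@ursubmx _ 1 n 1 n P *m y) 0 0) P0).
  rewrite -ge0_integralZr//.
  - apply: eq_integral => t _; rewrite -EFinM -expRD; congr (expR _)%:E.
    by rewrite (@quad_schur n P t y Pp.1 P00); ring.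
  - apply/measurable_EFinP; apply: measurableT_comp => //; apply: measurableT_comp => //.
    apply: measurable_funM => //; apply: measurable_funM => //.
    by apply: measurable_funX; exact: measurable_funD.
rewrite ge0_integralZl//.
- rewrite IH// -EFinM -sqrtrM// (@det_schur n P Pp.1 P00); congr (Num.sqrt _)%:E.
  by have := posdef_det Sp; rewrite exprS => S0; field; rewrite P00 gt_eqF.
- by apply/measurable_EFinP; exact: measurable_expR_quad.
Qed.

Lemma gauss_pdf_gt0 n (mu : 'cV[R]_n) (S : 'M[R]_n) v : posdefmx S ->
  0 < gauss_pdf mu S v.
Proof.
move=> Sp; rewrite mulr_gt0 ?expR_gt0// invr_gt0 sqrtr_gt0 mulr_gt0 ?posdef_det//.
by rewrite exprn_gt0// mulr_gt0// pi_gt0.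
Qed.

Lemma gauss_pdf_ge0 n (mu : 'cV[R]_n) (S : 'M[R]_n) v : 0 <= gauss_pdf mu S v.
Proof. by rewrite mulr_ge0 ?expR_ge0// invr_ge0 sqrtr_ge0. Qed.

Lemma measurable_gauss_pdf d (T : measurableType d) n (S : 'M[R]_n)
    (f g : T -> 'cV[R]_n) : measurable_fun setT f -> measurable_fun setT g ->
  measurable_fun setT (fun t => gauss_pdf (f t) S (g t)).
Proof.
move=> mf mg; apply: measurable_funM => //.
apply: (@measurable_expR_quad _ _ _ _ _ (fun t => g t - f t)).
by apply: measurable_addmx => //; exact: measurable_oppmx.
Qed.

Lemma integral_gauss_pdf n (mu : 'cV[R]_n) (S : 'M[R]_n) : posdefmx S ->
  (\int[lebesgue_cV R n]_v (gauss_pdf mu S v)%:E = 1)%E.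
Proof.
move=> Sp; rewrite -(ge0_integral_cV_shift mu); first last.
- by move=> v; rewrite lee_fin gauss_pdf_ge0.
- by apply/measurable_EFinP; exact: measurable_gauss_pdf.
under eq_integral do rewrite /gauss_pdf addrK EFinM.
rewrite ge0_integralZl//; first last.
- by apply/measurable_EFinP; exact: measurable_expR_quad.
rewrite integral_expR_quad; last exact: posdef_inv.
rewrite det_inv invrK -EFinM mulVf// gt_eqF// sqrtr_gt0 mulr_gt0 ?posdef_det//.
by rewrite exprn_gt0// mulr_gt0// pi_gt0.
Qed.

(** The constant is the trace of [S]: Cauchy-Schwarz for the form of [S^-1], tested against [S e_i],
    gives [v_i^2 <= S_ii (v^T S^-1 v)], and the sum over [i] is the claim. *)
Lemma posdef_sqnorm_bound n (S : 'M[R]_n) : posdefmx S ->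
  exists2 c : R, 0 <= c &
    forall v : 'cV[R]_n, (v^T *m v) 0 0 <= c * (v^T *m invmx S *m v) 0 0.
Proof.
move=> Sp; have Su := posdef_unit Sp; have [Si0 Sip] := posdef_possemidef (posdef_inv Sp).
have Sii i : 0 < S i i.
  have := Sp.2 (delta_mx i 0); rewrite trmx_delta -rowE -colE !mxE; apply.
  by apply/eqP => /colP/(_ i); rewrite !mxE !eqxx => /eqP; rewrite oner_eq0.
exists (\sum_i S i i) => [|v]; first by apply: sumr_ge0 => i _; exact: ltW.
rewrite mxE mulr_suml; apply: ler_sum => i _; rewrite mxE.
set q := (_ *m _ *m v) 0 0.
have := Sip (v - (v i 0 / S i i) *: (S *m delta_mx i 0)).
suff -> : ((v - (v i 0 / S i i) *: (S *m delta_mx i 0))^T *m invmx S *m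
    (v - (v i 0 / S i i) *: (S *m delta_mx i 0))) 0 0 = q - v i 0 ^+ 2 / S i i.
  by rewrite subr_ge0 ler_pdivrMr// expr2 [q * _]mulrC.
set e := delta_mx i 0; set c := v i 0 / S i i.
have ve : (v^T *m e) 0 0 = v i 0 by rewrite /e -colE !mxE.
have ev : (e^T *m v) 0 0 = v i 0 by rewrite /e trmx_delta -rowE !mxE.
have eSe : (e^T *m S *m e) 0 0 = S i i by rewrite /e trmx_delta -rowE -colE !mxE.
rewrite tr_addmx tr_oppmx linearZ /= trmx_mul Sp.1 mulmxDr !mulmxDl.
rewrite !(mulmxN, mulNmx) opprK -!scalemxAl -!scalemxAr mulmxK//.
rewrite (mulmxA _ S e) mulmxKV// (mulmxA _ S e) !(addmxE, oppmxE).
rewrite ![(_ *: _ : 'M[R]_1) 0 0]mxE ve ev -/q eSe /c.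
by field; rewrite gt_eqF.
Qed.

(** Half of the exponent pays for the square: with [q = v^T S^-1 v], one has [|v|^2 <= c q] and
    [q exp(-q/4) <= 4]. The other half is a Gaussian of precision [S^-1 / 2], whose integral is
    finite. *)
Lemma gauss_second_moment n (S : 'M[R]_n) : posdefmx S ->
  (\int[lebesgue_cV R n]_v (((v^T *m v) 0 0)%:E * (gauss_pdf 0 S v)%:E) < +oo)%E.
Proof.
move=> Sp; have Sip := posdef_inv Sp; have [c c0 cP] := posdef_sqnorm_bound Sp.
set k := (Num.sqrt ((2 * pi) ^+ n * \det S))^-1.
have k0 : 0 <= k by rewrite invr_ge0 sqrtr_ge0.
have Hp : posdefmx (2^-1 *: invmx S).
  split=> [|v v0]; first by rewrite linearZ /= Sip.1.
  by rewrite -scalemxAr -scalemxAl mxE mulr_gt0 ?invr_gt0// Sip.2.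
pose f (v : 'cV[R]_n) := expR (- (2^-1 * (v^T *m (2^-1 *: invmx S) *m v) 0 0)).
have mf : measurable_fun setT f by exact: measurable_expR_quad.
apply: (@le_lt_trans _ _ (\int[lebesgue_cV R n]_v ((4 * c * k)%:E * (f v)%:E))%E).
  apply: ge0_le_integral => //.
  - by move=> v _; rewrite -EFinM lee_fin mulr_ge0 ?sqnorm_ge0 ?gauss_pdf_ge0.
  - apply: emeasurable_funM; apply/measurable_EFinP; last exact: measurable_gauss_pdf.
    under eq_fun do rewrite -[_^T]mulmx1; exact: measurable_quad.
  - by apply/measurable_EFinP; exact: measurable_funM.
  - move=> v _; rewrite -!EFinM lee_fin /gauss_pdf subr0 -/k.
    set q := (v^T *m invmx S *m v) 0 0.
    have -> : f v = expR (- (4^-1 * q)).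
      rewrite /f -scalemxAr -scalemxAl mxE -/q; congr expR.
      by field.
    have -> : expR (- (2^-1 * q)) = expR (- (4^-1 * q)) * expR (- (4^-1 * q)).
      by rewrite -expRD; congr expR; field.
    rewrite [X in _ <= X](_ : _ = (4 * c) * (k * expR (- (4^-1 * q)))); last by ring.
    rewrite [X in X <= _](_ : _ = ((v^T *m v) 0 0 * expR (- (4^-1 * q))) *
      (k * expR (- (4^-1 * q)))); last by ring.
    rewrite ler_wpM2r ?mulr_ge0 ?expR_ge0//.
    have q4 : q * expR (- (4^-1 * q)) <= 4.
      have := expR_ge1Dx (4^-1 * q); rewrite expRN => q1.
      by rewrite ler_pdivrMr ?expR_gt0//; lra.
    apply: (@le_trans _ _ (c * q * expR (- (4^-1 * q)))).
      by rewrite ler_wpM2r ?expR_ge0// cP.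
    by rewrite -mulrA [4 * c]mulrC ler_wpM2l.
rewrite ge0_integralZl//.
- by rewrite /f integral_expR_quad// -EFinM ltry.
- exact/measurable_EFinP.
- by move=> v _; rewrite lee_fin expR_ge0.
- by rewrite lee_fin !mulr_ge0.
Qed.

End gauss_integral.

Section gaussian_rv_theory.
Local Open Scope ereal_scope.
Context (R : realType) d (W : measurableType d) (P : probability W R).

Lemma ge0_integral_gaussian_rv n (X : {RV P >-> 'cV[R]_n}) (mu : 'cV[R]_n)
    (S : 'M[R]_n) (f : 'cV[R]_n -> \bar R) :
  gaussian_rv X mu S -> measurable_fun setT f -> (forall x, 0 <= f x) ->
  \int[P]_w f (X w) = \int[lebesgue_cV R n]_x (f x * (gauss_pdf mu S x)%:E).
Proof.
move=> XS mf f0; rewrite ge0_integral_law//.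
have mg : measurable_fun setT (fun x : 'cV[R]_n => (gauss_pdf mu S x)%:E).
  by apply/measurable_EFinP; exact: measurable_gauss_pdf.
have g0 (x : 'cV[R]_n) : 0 <= (gauss_pdf mu S x)%:E by rewrite lee_fin gauss_pdf_ge0.
transitivity (\int[mdensity (lebesgue_cV R n) mg g0]_x f x).
  by apply: eq_measure_integral => C mC _; exact: XS.
by rewrite ge0_integral_mdensity.
Qed.

(** Testing on the constant 1 forces [c] to be the Gaussian normalization, as [P] has mass 1.
    Changes of variables may therefore carry unevaluated constants, and no Jacobian has to be
    identified with a determinant. *)
Lemma gaussian_rv_normalize n (X : {RV P >-> 'cV[R]_n}) (S : 'M[R]_n) (c : \bar R) :
  posdefmx S ->
  (forall f : 'cV[R]_n -> \bar R, measurable_fun setT f -> (forall x, 0 <= f x) ->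
    \int[P]_w f (X w) = c * \int[lebesgue_cV R n]_z
      (f z * (expR (- (2^-1 * (z^T *m invmx S *m z) 0 0)))%:E)) ->
  gaussian_rv X 0 S.
Proof.
move=> Sp Xc.
set G := Num.sqrt ((2 * pi) ^+ n * \det S).
have G0 : (0 < G)%R.
  rewrite sqrtr_gt0 mulr_gt0 ?posdef_det// exprn_gt0// mulr_gt0// pi_gt0//.
have cG : c = (G^-1)%:E.
  have := Xc (cst 1) (measurable_cst _) (fun=> lee01).
  have -> : \int[P]_w cst 1 (X w) = 1 :> \bar R.
    by rewrite integral_cst// mul1e; exact: probability_setT.
  under [X in _ = _ * X]eq_integral do rewrite mul1e.
  rewrite integral_expR_quad; last exact: posdef_inv.
  rewrite det_inv invrK -/G => /(congr1 (fun x => x * (G^-1)%:E)).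
  by rewrite mul1e -muleA -EFinM mulfV ?mule1 ?gt_eqF.
move=> C mC.
have mI : measurable_fun setT (fun x : 'cV[R]_n => (\1_C x)%:E : \bar R).
  by apply/measurable_EFinP; exact: measurable_indic.
transitivity (\int[P]_w (\1_C (X w))%:E).
  rewrite (ge0_integral_law X mI) ?integral_indic ?setIT//.
rewrite [LHS](Xc (fun x => (\1_C x)%:E))//.
rewrite cG -ge0_integralZl//.
- rewrite [RHS]integral_mkcond; apply: eq_integral => x _.
  rewrite patchE indicE; case: (x \in C); last by rewrite mul0e mule0.
  by rewrite mul1e -EFinM /gauss_pdf subr0.
- apply: emeasurable_funM => //; apply/measurable_EFinP; exact: measurable_expR_quad.
- by rewrite lee_fin invr_ge0 ltW.
Qed.

End gaussian_rv_theory.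

(** * One step of the closed-loop dynamics *)

Section gaussian_step.
Local Open Scope ereal_scope.
Context (R : realType) (n m : nat) (A L : 'M[R]_n) (B : 'M[R]_(n, m))
  (K : 'M[R]_(m, n)) (Sg : 'M[R]_n) (Sp : 'M[R]_m).
Hypotheses (Sgp : posdefmx Sg) (Spp : posdefmx Sp) (Lu : L \in unitmx)
  (LE : L = (A + B *m K)%R).
Let E : 'M[R]_n := (L *m Sg *m L^T + B *m Sp *m B^T)%R.

Let Qp : posdefmx (L *m Sg *m L^T).
Proof. exact: posdef_congr_unit. Qed.

Lemma gaussian_step_posdef : posdefmx E.
Proof.
apply: posdefD => //; rewrite -{1}[B]trmxK.
exact/possemidef_congr/posdef_possemidef.
Qed.

(** The precision of the noise [v] conditional on the next state [z = L x + B v]. *)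
Let Wm : 'M[R]_m := (invmx Sp + B^T *m invmx (L *m Sg *m L^T) *m B)%R.

Let Wp : posdefmx Wm.
Proof.
apply: posdefD; first exact: posdef_inv.
exact/possemidef_congr/posdef_possemidef/posdef_inv.
Qed.

(** [complete_square] for [- B]: the joint exponent of noise and present state is regrouped as that
    of the next state plus that of the noise given the next state. *)
Let conv_quad (z : 'cV[R]_n) (v : 'cV[R]_m)
    (mu := (invmx Wm *m B^T *m invmx (L *m Sg *m L^T) *m z)%R) :
  ((v^T *m invmx Sp *m v) 0 0 +
   ((invmx L *m (z - B *m v))^T *m invmx Sg *m (invmx L *m (z - B *m v))) 0 0 =
   (z^T *m invmx E *m z) 0 0 + ((v - mu)^T *m Wm *m (v - mu)) 0 0)%R.
Proof.
have Spi := posdef_inv Spp.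
have Ltu : L^T \in unitmx by rewrite unitmx_tr.
have Sgu := posdef_unit Sgp.
have := @complete_square R n m (L *m Sg *m L^T) (invmx Sp) (- B) z v
  (posdef_unit Qp) (posdef_unit Spi).
rewrite invmxK tr_oppmx !(mulNmx, mulmxN) !opprK => /(_ (posdef_unit gaussian_step_posdef)).
move=> /(_ (posdef_unit Wp) Qp.1 Spi.1) /matrixP/(_ 0%R 0%R).
rewrite -/Wm -/mu -/E !addmxE => <-; congr (_ + _)%R.
rewrite -quadform_congr; congr ((_ *m _ *m _) 0 0)%R.
by rewrite !invmx_mul ?unitmx_mul ?Lu// trmx_inv !mulmxA.
Qed.

(** The kernel need only be Gaussian almost everywhere, since the state law has a density; the
    uniqueness induction supplies no more. Recentring the control at [K x] produces the closed loop
    [L], the substitution [z = L x + B v] isolates the next state, and integrating out [v] leaves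
    the exponent of [E] times a constant. *)
Lemma gaussian_step d (W : measurableType d) (P : probability W R)
    (X X' : {RV P >-> 'cV[R]_n}) (U : {RV P >-> 'cV[R]_m})
    (p : 'cV[R]_n -> 'cV[R]_m -> R) :
  measurable_fun setT (fun z : 'cV[R]_n * 'cV[R]_m => p z.1 z.2) ->
  (forall x v, (0 <= p x v)%R) ->
  (forall C D, measurable C -> measurable D -> P (X @^-1` C `&` U @^-1` D) =
    \int[P]_(w in X @^-1` C) \int[lebesgue_cV R m]_(v in D) (p (X w) v)%:E) ->
  (forall w, X' w = (A *m X w + B *m U w)%R) ->
  gaussian_rv X 0 Sg ->
  {ae lebesgue_cV R n, forall x, {ae lebesgue_cV R m, forall v,
    p x v = gauss_pdf (K *m x) Sp v}} ->
  gaussian_rv X' 0 E.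
Proof.
move=> mp p0 XU X'E XS pE; set ln := lebesgue_cV R n; set lm := lebesgue_cV R m.
have mgx : measurable_fun setT (fun x : 'cV[R]_n => (gauss_pdf 0 Sg x)%:E).
  by apply/measurable_EFinP; exact: measurable_gauss_pdf.
have mgv : measurable_fun setT (fun v : 'cV[R]_m => (gauss_pdf 0 Sp v)%:E).
  by apply/measurable_EFinP; exact: measurable_gauss_pdf.
have mL a b c (M : 'M[R]_(a, b)) : measurable_fun setT (fun x : 'M[R]_(b, c) => M *m x).
  by apply: measurable_mulmx.
(* The Jacobian of [L], kept as an unknown constant. *)
have [c c0 lin] : exists2 c : \bar R, 0 <= c & forall g : 'cV[R]_n -> \bar R,
    measurable_fun setT g -> (forall x, 0 <= g x) ->
    \int[ln]_x g (L *m x) = c * \int[ln]_x g x.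
  pose z1 : 'cV[R]_n -> R := gauss_pdf 0 1%:M.
  have mz1 : measurable_fun setT (fun x => (z1 x)%:E).
    by apply/measurable_EFinP; exact: measurable_gauss_pdf.
  have z10 x : 0 <= (z1 x)%:E by rewrite lee_fin gauss_pdf_ge0.
  exists (\int[ln]_x (z1 (- (L *m x))%R)%:E); first by apply: integral_ge0 => x _.
  exact: (ge0_integral_linear Lu mz1 z10 (integral_gauss_pdf 0 (posdef_scalar n ltr01))).
pose k := ((Num.sqrt ((2 * pi) ^+ m * \det Sp))^-1 *
  (Num.sqrt ((2 * pi) ^+ n * \det Sg))^-1 * Num.sqrt ((2 * pi) ^+ m / \det Wm))%R.
have k0 : (0 <= k)%R by rewrite !mulr_ge0// ?invr_ge0 sqrtr_ge0.
apply: (@gaussian_rv_normalize _ _ _ _ _ _ _ (c * k%:E)); first exact: gaussian_step_posdef.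
move=> f mf f0.
have mAB : measurable_fun setT (fun z : 'cV[R]_n * 'cV[R]_m => A *m z.1 + B *m z.2)%R.
  by apply: measurable_addmx; apply: measurable_mulmx.
have mfAB : measurable_fun setT (fun z : 'cV[R]_n * 'cV[R]_m => f (A *m z.1 + B *m z.2)%R).
  exact: (measurableT_comp mf mAB).
have mh : measurable_fun setT (fun z : 'cV[R]_n * 'cV[R]_m =>
    f (A *m z.1 + B *m z.2)%R * (p z.1 z.2)%:E).
  by apply: emeasurable_funM => //; exact/measurable_EFinP.
have h0 (z : 'cV[R]_n * 'cV[R]_m) : 0 <= f (A *m z.1 + B *m z.2)%R * (p z.1 z.2)%:E.
  by rewrite mule_ge0// lee_fin.
under eq_integral do rewrite X'E.
rewrite [LHS](disintegration (lam := lm) mp p0 XU mfAB (fun=> f0 _)).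
rewrite [LHS](ge0_integral_gaussian_rv (f := fun x => \int[lm]_v
  (f (A *m x + B *m v)%R * (p x v)%:E)) XS); first last.
- by move=> x; apply: integral_ge0 => v _; exact: (h0 (x, v)).
- exact: (@measurable_fun_fubini_tonelli_F _ _ _ _ _ lm _ mh h0).
pose gx (x : 'cV[R]_n) := (gauss_pdf 0 Sg x)%:E; pose gv (v : 'cV[R]_m) := (gauss_pdf 0 Sp v)%:E.
have gx0 x : 0 <= gx x by rewrite lee_fin gauss_pdf_ge0.
have gv0 v : 0 <= gv v by rewrite lee_fin gauss_pdf_ge0.
have mLB : measurable_fun setT (fun z : 'cV[R]_n * 'cV[R]_m => L *m z.1 + B *m z.2)%R.
  by apply: measurable_addmx; apply: measurable_mulmx.
have mH : measurable_fun setT (fun z : 'cV[R]_n * 'cV[R]_m =>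
    f (L *m z.1 + B *m z.2)%R * (gv z.2 * gx z.1)).
  apply: emeasurable_funM; first exact: (measurableT_comp mf mLB).
  apply: emeasurable_funM; first exact: (measurableT_comp mgv measurable_snd).
  exact: (measurableT_comp mgx measurable_fst).
have H0 (z : 'cV[R]_n * 'cV[R]_m) : 0 <= f (L *m z.1 + B *m z.2)%R * (gv z.2 * gx z.1).
  by rewrite !mule_ge0.
(* Replaces [p] by the Gaussian kernel, discarding null sets first in [x] and then in [v], and
   shifts [v] by [K x]. *)
transitivity (\int[ln]_x \int[lm]_v (f (L *m x + B *m v)%R * (gv v * gx x))).
  apply: ge0_ae_eq_integral => //.
  - apply: emeasurable_funM; last exact: mgx.
    exact: (@measurable_fun_fubini_tonelli_F _ _ _ _ _ lm _ mh h0).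
  - exact: (@measurable_fun_fubini_tonelli_F _ _ _ _ _ lm _ mH H0).
  - move=> x _; apply: mule_ge0; last exact: gx0.
    by apply: integral_ge0 => v _; exact: (h0 (x, v)).
  - by move=> x _; apply: integral_ge0 => v _; exact: (H0 (x, v)).
  apply: filterS pE => x pxE _.
  have mBv a : measurable_fun setT (fun v : 'cV[R]_m => f (a + B *m v)%R).
    by apply: (measurableT_comp mf); apply: measurable_addmx => //; exact: mL.
  have mfp : measurable_fun setT (fun v : 'cV[R]_m => f (A *m x + B *m v)%R * (p x v)%:E).
    apply: emeasurable_funM => //; apply/measurable_EFinP.
    exact: (measurableT_comp mp (measurable_pair1 x)).
  rewrite -(ge0_integralZr _ measurableT mfp (fun v _ => h0 (x, v)) (gx0 x)).
  pose F v := f (A *m x + B *m v)%R * (gauss_pdf (K *m x) Sp v)%:E * gx x.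
  have mF : measurable_fun setT F.
    apply: emeasurable_funM => //; apply: emeasurable_funM => //; apply/measurable_EFinP.
    exact: measurable_gauss_pdf.
  have F0 v : 0 <= F v by rewrite !mule_ge0// lee_fin gauss_pdf_ge0.
  transitivity (\int[lm]_v F v).
    apply: ge0_ae_eq_integral => //.
    - exact: emeasurable_funM.
    - by move=> v _; rewrite !mule_ge0// lee_fin.
    by apply: filterS pxE => v pxv _; rewrite /F pxv.
  rewrite -(ge0_integral_cV_shift (K *m x) mF F0); apply: eq_integral => v _.
  rewrite /F /gv /gauss_pdf addrK subr0 -muleA; congr (f _ * _).
  by rewrite mulmxDr LE mulmxDl -mulmxA -addrA [(B *m v + _)%R]addrC.
rewrite [LHS](fubini_tonelli _ mH H0).
pose H2 (y : 'cV[R]_m * 'cV[R]_n) :=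
  f y.2 * (gv y.1 * gx (invmx L *m (y.2 - B *m y.1))%R).
have mH2 : measurable_fun setT H2.
  apply: emeasurable_funM; first exact: (measurableT_comp mf measurable_snd).
  apply: emeasurable_funM; first exact: (measurableT_comp mgv measurable_fst).
  apply: (measurableT_comp mgx); apply: measurable_mulmx => //.
  by apply: measurable_addmx => //; apply: measurable_oppmx; exact: measurable_mulmx.
have H20 y : 0 <= H2 y by rewrite !mule_ge0.
(* The substitution [z = L x + B v] at fixed [v]: the linear part costs the factor [c], the
   translation nothing. *)
transitivity (\int[lm]_v (c * \int[ln]_z H2 (v, z))).
  apply: eq_integral => v _ /=.
  pose F (y : 'cV[R]_n) := f (y + B *m v)%R * (gv v * gx (invmx L *m y)).
  have mF : measurable_fun setT F.
    apply: emeasurable_funM; first by apply: (measurableT_comp mf); exact: measurable_addmx.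
    by apply: emeasurable_funM => //; apply: (measurableT_comp mgx); exact: mL.
  have F0 y : 0 <= F y by rewrite !mule_ge0.
  transitivity (\int[ln]_x F (L *m x)).
    by apply: eq_integral => x _; rewrite /F mulmxA mulVmx// mul1mx.
  transitivity (c * \int[ln]_z F z); first exact: (lin F mF F0).
  apply: (congr1 (fun t => c * t)).
  rewrite -(ge0_integral_cV_shift (- (B *m v)) mF F0); apply: eq_integral => z _.
  by rewrite /F /H2/= subrK.
rewrite ge0_integralZl//; last 2 first.
- exact: (@measurable_fun_fubini_tonelli_F _ _ _ _ _ ln _ mH2 H20).
- by move=> v _; apply: integral_ge0 => z _.
rewrite -muleA; congr *%E.
rewrite [LHS](fubini_tonelli _ mH2 H20) -ge0_integralZl//; last 2 first.
- apply: emeasurable_funM => //; apply/measurable_EFinP; exact: measurable_expR_quad.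
- by move=> z _; rewrite mule_ge0// lee_fin expR_ge0.
apply: eq_integral => z _.
pose mu := (invmx Wm *m B^T *m invmx (L *m Sg *m L^T) *m z)%R.
pose e (v : 'cV[R]_m) := (expR (- (2^-1 * ((v - mu)^T *m Wm *m (v - mu)) 0 0)))%:E.
have me : measurable_fun setT e.
  apply/measurable_EFinP; apply: measurable_expR_quad.
  by apply: measurable_addmx.
have e0 v : 0 <= e v by rewrite lee_fin expR_ge0.
have Ie : \int[lm]_v e v = (Num.sqrt ((2 * pi) ^+ m / \det Wm))%:E.
  rewrite -(ge0_integral_cV_shift mu me e0) -(integral_expR_quad Wp).
  by apply: eq_integral => v _; rewrite /e addrK.
pose kk := ((Num.sqrt ((2 * pi) ^+ m * \det Sp))^-1 *
  (Num.sqrt ((2 * pi) ^+ n * \det Sg))^-1)%R.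
have kk0 : (0 <= kk)%R by rewrite mulr_ge0// invr_ge0 sqrtr_ge0.
transitivity (\int[lm]_v (f z * (kk * expR (- (2^-1 * (z^T *m invmx E *m z) 0 0)))%:E * e v)).
  apply: eq_integral => v _; rewrite /H2/= -muleA; congr (_ * _).
  rewrite /gv /gx /e -!EFinM /gauss_pdf !subr0; congr (_%:E).
  rewrite mulrACA -/kk -expRD -opprD -mulrDr conv_quad -/mu.
  by rewrite mulrDr opprD expRD mulrA.
rewrite ge0_integralZl//.
  rewrite Ie (_ : k = kk * Num.sqrt ((2 * pi) ^+ m / \det Wm))%R//.
  by rewrite -muleA [RHS]muleCA -!EFinM mulrAC.
by rewrite mule_ge0// lee_fin mulr_ge0// expR_ge0.
Qed.

End gaussian_step.

(** * Existence of the closed-loop process *)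

Section gauss_prob.
Local Open Scope ereal_scope.
Context (R : realType).

Lemma gauss_prob_exists n (mu : 'cV[R]_n) (S : 'M[R]_n) : posdefmx S ->
  exists P : probability 'cV[R]_n R, forall C, measurable C ->
    P C = \int[lebesgue_cV R n]_(v in C) (gauss_pdf mu S v)%:E.
Proof.
move=> Sp.
have mg : measurable_fun setT (fun x : 'cV[R]_n => (gauss_pdf mu S x)%:E).
  by apply/measurable_EFinP; exact: measurable_gauss_pdf.
have g0 (x : 'cV[R]_n) : 0 <= (gauss_pdf mu S x)%:E by rewrite lee_fin gauss_pdf_ge0.
pose nu := mdensity (lebesgue_cV R n) mg g0.
have nu1 : nu setT = 1 by exact: integral_gauss_pdf.
pose nui := @Measure_isProbability.Build _ _ _ nu nu1.
by exists (HB.pack_for (probability 'cV[R]_n R) nu nui).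
Qed.

Lemma gauss_pdf_shift n (a : 'cV[R]_n) (S : 'M[R]_n) (D : set 'cV[R]_n) :
  measurable D ->
  \int[lebesgue_cV R n]_(v in (fun v => v + a)%R @^-1` D) (gauss_pdf 0 S v)%:E =
  \int[lebesgue_cV R n]_(v in D) (gauss_pdf a S v)%:E.
Proof.
move=> mD.
have mg : measurable_fun D (fun v : 'cV[R]_n => (gauss_pdf a S v)%:E).
  by apply: measurable_funTS; apply/measurable_EFinP; exact: measurable_gauss_pdf.
rewrite integral_mkcond [RHS]integral_mkcond -[RHS](ge0_integral_cV_shift a).
- apply: eq_integral => v _; rewrite !patchE.
  rewrite (_ : (v \in _) = ((v + a)%R \in D)); last by apply/idP/idP; rewrite !inE.
  by case: ifP => // _; rewrite /gauss_pdf addrK subr0.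
- exact: (iffLR (measurable_restrictT _ mD) mg).
- by move=> v; apply: erestrict_ge0 => y _; rewrite lee_fin gauss_pdf_ge0.
Qed.

End gauss_prob.

Definition mfun_of d1 d2 (T1 : measurableType d1) (T2 : measurableType d2)
    (f : T1 -> T2) (mf : measurable_fun setT f) : {mfun T1 >-> T2} :=
  HB.pack_for {mfun T1 >-> T2} f (isMeasurableFun.Build _ _ _ _ f mf).

Section extension.
Local Open Scope ereal_scope.
Context (R : realType) d (W : measurableType d) (P : probability W R)
  d' (V : measurableType d') (G : probability V R).

Lemma product_fst (A : set W) : measurable A -> (P \x G) (fst @^-1` A) = P A.
Proof.
move=> mA; rewrite (_ : _ @^-1` _ = A `*` setT).
  rewrite [LHS](@product_measure1E _ _ _ _ _ P G)//.
  by rewrite -[RHS]mule1 -(probability_setT G).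
by apply/seteqP; split=> [z /= Az|z []].
Qed.

Lemma integral_product_fst (A : set W) (f : W -> \bar R) : measurable A ->
  measurable_fun setT f -> (forall w, 0 <= f w) ->
  \int[(P \x G)]_(z in fst @^-1` A) f z.1 = \int[P]_(w in A) f w.
Proof.
move=> mA mf f0.
have mfst := @measurable_fst _ _ W V.
rewrite -[LHS](@ge0_integral_pushforward _ _ _ _ _ _ mfst ((P \x G)) A)//; last first.
  exact: measurable_funTS.
by apply: eq_measure_integral => B mB _; exact: product_fst.
Qed.

End extension.

Section realization.
Local Open Scope ereal_scope.
Context (R : realType) (n m : nat) (A : nat -> 'M[R]_n) (B : nat -> 'M[R]_(n, m))
  (K : nat -> 'M[R]_(m, n)) (S : nat -> 'M[R]_m) (Sini : 'M[R]_n).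

Let p k (x : 'cV[R]_n) : 'cV[R]_m -> R := gauss_pdf (K k *m x) (S k).

(** The constraints up to horizon [k] without the terminal one, so that the process can be built by
    induction on the horizon; the terminal law is a consequence of the covariance recursion. *)
Definition realizes k d (W : measurableType d) (P : probability W R)
    (x : nat -> {RV P >-> 'cV[R]_n}) (u : nat -> {RV P >-> 'cV[R]_m}) :=
  [/\ forall j, (j < k)%N -> forall w, x j.+1 w = (A j *m x j w + B j *m u j w)%R,
      gaussian_rv (x 0%N) 0 Sini &
      forall j, (j < k)%N -> forall C D, measurable C -> measurable D ->
        P (x j @^-1` C `&` u j @^-1` D) =
        \int[P]_(w in x j @^-1` C) \int[lebesgue_cV R m]_(v in D) (p j (x j w) v)%:E].

Lemma measurable_gauss_kernel d (W : measurableType d) j (D : set 'cV[R]_m)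
    (X : W -> 'cV[R]_n) : measurable D -> measurable_fun setT X ->
  measurable_fun setT (fun w => \int[lebesgue_cV R m]_(v in D) (p j (X w) v)%:E).
Proof.
move=> mD mX.
have mpE : measurable_fun setT (fun z : W * 'cV[R]_m => (p j (X z.1) z.2)%:E).
  apply/measurable_EFinP; apply: measurable_gauss_pdf => //.
  by apply: measurable_mulmx => //; exact: (measurableT_comp mX measurable_fst).
have mTD : measurable ([set: W] `*` D) by exact: measurableX.
have mpD : measurable_fun setT ((fun z : W * 'cV[R]_m => (p j (X z.1) z.2)%:E) \_ (setT `*` D)).
  have H := measurable_funTS mpE.
  exact: (iffLR (measurable_restrictT _ mTD) (H _)).
rewrite (_ : (fun w => _) = fubini_F (lebesgue_cV R m)
    ((fun z : W * 'cV[R]_m => (p j (X z.1) z.2)%:E) \_ (setT `*` D))).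
  apply: measurable_fun_fubini_tonelli_F => //.
  by move=> z; apply: erestrict_ge0 => y; rewrite lee_fin gauss_pdf_ge0.
apply/funext => w; rewrite /fubini_F [LHS]integral_mkcond; apply: eq_integral => v _.
by rewrite !patchE in_setX in_setT.
Qed.

Lemma gauss_kernel_ge0 j (D : set 'cV[R]_m) (y : 'cV[R]_n) :
  0 <= \int[lebesgue_cV R m]_(v in D) (p j y v)%:E.
Proof. by apply: integral_ge0 => v _; rewrite lee_fin gauss_pdf_ge0. Qed.

(** Each stage multiplies the sample space by an independent centred Gaussian noise, to which the
    feedback [K k *m x k] is added. The earlier variables are read through the first projection. *)
Lemma realization_exists T : posdefmx Sini -> (forall k, (k < T)%N -> posdefmx (S k)) ->
  exists d (W : measurableType d) (P : probability W R)
    (x : nat -> {RV P >-> 'cV[R]_n}) (u : nat -> {RV P >-> 'cV[R]_m}),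
    realizes T x u.
Proof.
move=> Sinip; elim: T => [|k IH] Sp.
  have [P PE] := gauss_prob_exists 0 Sinip.
  exists _, _, P, (fun=> mfun_of (@measurable_id _ 'cV[R]_n setT)), (fun=> cst 0%R); split => //.
have [|d [W [P [x [u [dyn x0 cond]]]]]] := IH; first by move=> j jk; exact/Sp/ltnW.
have [G GE] := gauss_prob_exists 0 (Sp k (ltnSn k)).
pose P' : probability (W * 'cV[R]_m)%type R := (P \x G).
pose uk (z : W * 'cV[R]_m) := (K k *m x k z.1 + z.2)%R.
have mx1 j : measurable_fun setT (fun z : W * 'cV[R]_m => x j z.1).
  exact: (measurableT_comp (measurable_funPT (x j)) measurable_fst).
have mu1 j : measurable_fun setT (fun z : W * 'cV[R]_m => u j z.1).
  exact: (measurableT_comp (measurable_funPT (u j)) measurable_fst).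
have muk : measurable_fun setT uk.
  by apply: measurable_addmx => //; exact: measurable_mulmx.
pose xk (z : W * 'cV[R]_m) := (A k *m x k z.1 + B k *m uk z)%R.
have mxk : measurable_fun setT xk by apply: measurable_addmx; exact: measurable_mulmx.
(* States are inherited up to time [k] but controls only before [k]: the old [u k] is unconstrained
   and gets replaced. *)
pose xf j := if (j <= k)%N then fun z : W * 'cV[R]_m => x j z.1 else xk.
pose uf j := if (j < k)%N then fun z : W * 'cV[R]_m => u j z.1 else uk.
have mxf j : measurable_fun setT (xf j) by rewrite /xf; case: ifP.
have muf j : measurable_fun setT (uf j) by rewrite /uf; case: ifP.
exists _, _, P', (fun j => mfun_of (mxf j)), (fun j => mfun_of (muf j)).
have xfE j : (j <= k)%N -> xf j = fun z => x j z.1 by move=> jk; rewrite /xf jk.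
have ufE j : (j < k)%N -> uf j = fun z => u j z.1 by move=> jk; rewrite /uf jk.
split.
- move=> j; rewrite ltnS leq_eqVlt => /orP[/eqP->|jk] w /=.
    by rewrite /xf /uf ltnn leqnn.
  by rewrite !xfE ?ufE// ?dyn// ltnW.
- move=> C mC; rewrite -x0// /distribution /pushforward /= xfE//.
  by rewrite -[RHS](product_fst P G)// -[X in measurable X]setTI; exact: (measurable_funPT (x 0%N)).
- move=> j; rewrite ltnS leq_eqVlt => /orP[/eqP->|jk] C D mC mD /=.
    rewrite /uf ltnn xfE//=.
    have mxC : measurable (x k @^-1` C) by rewrite -[X in measurable X]setTI; exact: measurable_funPT.
    rewrite [RHS](@integral_product_fst _ _ _ P _ _ G (x k @^-1` C)
      (fun w => \int[lebesgue_cV R m]_(v in D) (p k (x k w) v)%:E))//; last 2 first.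
    + exact: measurable_gauss_kernel.
    + by move=> w; exact: gauss_kernel_ge0.
    rewrite [RHS]integral_mkcond; apply: eq_integral => w _ /=; rewrite patchE.
    have mD' : measurable ((fun v : 'cV[R]_m => v + K k *m x k w)%R @^-1` D).
      by rewrite -[X in measurable X]setTI; apply: measurable_addmx.
    have [xC|xC] := boolP (w \in x k @^-1` C).
      rewrite -gauss_pdf_shift// -GE//; congr (G _); apply/seteqP; split=> v /=.
        by rewrite /xsection/= inE => -[_]; rewrite /uk/= addrC.
      by rewrite /xsection/= inE => vD; split; [exact: set_mem xC|rewrite /= /uk/= addrC].
    rewrite (_ : xsection _ _ = set0) ?measure0//; apply/seteqP; split=> v //.
    by rewrite /xsection/= inE => -[/= xkC _]; move: xC; rewrite notin_setE; apply.
  rewrite xfE ?ufE// ?(ltnW jk)//=.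
  have mxC : measurable (x j @^-1` C) by rewrite -[X in measurable X]setTI; exact: measurable_funPT.
  have muD : measurable (u j @^-1` D) by rewrite -[X in measurable X]setTI; exact: measurable_funPT.
  rewrite [RHS](@integral_product_fst _ _ _ P _ _ G (x j @^-1` C) (fun w => \int[lebesgue_cV R m]_(v in D) (p j (x j w) v)%:E))//.
  + by rewrite -cond//; apply: (product_fst P G); exact: measurableI.
  + exact: measurable_gauss_kernel.
  + by move=> w; exact: gauss_kernel_ge0.
Qed.

End realization.

(** * Relative entropy *)

Section klfun.
Context (R : realType).

(* The integrand of the relative entropy of densities, made nonnegative by a
   term of integral zero. *)
Definition klfun (a b : R) : R := a * (ln a - ln b) - a + b.

(** With [t = ln b - ln a] this is [a (exp t - 1 - t)], so that nonnegativity and the equality case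
    are those of the tangent bound for the exponential. *)
Lemma klfunE (a b : R) : 0 < a -> 0 < b ->
  klfun a b = a * (expR (ln b - ln a) - (1 + (ln b - ln a))).
Proof.
move=> a0 b0; rewrite expRD expRN !lnK ?posrE// /klfun.
by field; rewrite gt_eqF.
Qed.

Lemma klfun_ge0 (a b : R) : 0 <= a -> 0 < b -> 0 <= klfun a b.
Proof.
rewrite le_eqVlt => /predU1P[<- b0|a0 b0].
  by rewrite /klfun mul0r subr0 add0r ltW.
by rewrite klfunE// mulr_ge0 ?(ltW a0)// subr_ge0 expR_ge1Dx.
Qed.

Lemma klfun_eq0 (a b : R) : 0 <= a -> 0 < b -> klfun a b = 0 -> a = b.
Proof.
rewrite le_eqVlt => /predU1P[<- b0|a0 b0].
  by rewrite /klfun mul0r subr0 add0r.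
rewrite klfunE// => /eqP; rewrite mulf_eq0 gt_eqF//= subr_eq0 => /eqP E.
have [ba|/expR_gt1Dx] := eqVneq (ln b - ln a) 0; last by rewrite E ltxx.
by apply: ln_inj; rewrite ?posrE//; apply/esym/eqP; rewrite -subr_eq0 ba.
Qed.

Lemma klfun_same (a : R) : klfun a a = 0.
Proof. by rewrite /klfun subrr mulr0 sub0r addNr. Qed.

Lemma klfun_chain (p r s h : R) : 0 <= p -> h = ln s - ln r ->
  klfun p r + s = klfun p s + r + p * h.
Proof. by move=> p0 ->; rewrite /klfun; ring. Qed.

Lemma maxr0_split (a : R) : Num.max a 0 = a + Num.max (- a) 0.
Proof. by case: (leP a 0) => a0; case: (leP (- a) 0) => a1; lra. Qed.

Lemma kl_integrandE (a b : R) : 0 <= a -> 0 < b ->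
  kl_integrand a b = (a * (ln a - ln b))%:E.
Proof.
move=> a0 b0; rewrite /kl_integrand (gt_eqF b0); case: eqP => [->|/eqP a1].
  by rewrite mul0r.
by rewrite ln_div// posrE lt0r a1.
Qed.

Lemma measurable_klfun d (T : measurableType d) (f g : T -> R) :
  measurable_fun setT f -> measurable_fun setT g ->
  measurable_fun setT (fun t => klfun (f t) (g t)).
Proof.
move=> mf mg; have ml (h : T -> R) : measurable_fun setT h ->
    measurable_fun setT (fun t => ln (h t)).
  by move=> mh; exact: (measurableT_comp (@measurable_ln R) mh).
apply: measurable_funD => //; apply: measurable_funB => //.
by apply: measurable_funM => //; apply: measurable_funB; exact: ml.
Qed.

Local Open Scope ereal_scope.

(** Writing [f] for the signed integrand, [klfun >= 0] reads [f >= p - q], so the negative part of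
    [f] is at most [q] and has finite integral. The masses of [p] and [q], both 1, cancel. *)
Lemma kl_divE m (p q : 'cV[R]_m -> R) :
  measurable_fun setT p -> measurable_fun setT q ->
  (forall v, (0 <= p v)%R) -> (forall v, (0 < q v)%R) ->
  \int[lebesgue_cV R m]_v (p v)%:E = 1 -> \int[lebesgue_cV R m]_v (q v)%:E = 1 ->
  kl_div p q = \int[lebesgue_cV R m]_v (klfun (p v) (q v))%:E.
Proof.
move=> mp mq p0 q0 p1 q1; set lam := lebesgue_cV R m.
pose f v := (p v * (ln (p v) - ln (q v)))%R.
have mf : measurable_fun setT f.
  apply: measurable_funM => //; apply: measurable_funB;
    by apply: (measurableT_comp (@measurable_ln R)).
have mk := measurable_klfun mp mq.
have k0 v : (0 <= klfun (p v) (q v))%R by rewrite klfun_ge0.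
have -> : kl_div p q = \int[lam]_v (f v)%:E.
  by apply: eq_integral => v _; rewrite kl_integrandE.
have mfE : measurable_fun setT (EFin \o f) by exact/measurable_EFinP.
have mfp := measurable_funepos mfE; have mfn := measurable_funeneg mfE.
have mpE : measurable_fun setT (EFin \o p) by exact/measurable_EFinP.
have mqE : measurable_fun setT (EFin \o q) by exact/measurable_EFinP.
have mkE : measurable_fun setT (fun v => (klfun (p v) (q v))%:E) by exact/measurable_EFinP.
have fnq v : (EFin \o f)^\- v <= (q v)%:E.
  rewrite funenegE /= -EFin_max lee_fin ge_max (ltW (q0 v)) andbT.
  by have := k0 v; rewrite /klfun -/(f v); have := p0 v; lra.
have fnfin : \int[lam]_v (EFin \o f)^\- v \is a fin_num.
  rewrite ge0_fin_numE; last by apply: integral_ge0.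
  by apply: (@le_lt_trans _ _ 1); rewrite ?ltry// -q1; apply: ge0_le_integral => // v _;
    rewrite lee_fin ltW.
(* Stated without subtraction: every term is the integral of a nonnegative function, and the
   relative entropy may be infinite. *)
have fpn : \int[lam]_v (klfun (p v) (q v))%:E + 1 + \int[lam]_v (EFin \o f)^\- v =
    \int[lam]_v (EFin \o f)^\+ v + 1.
  rewrite -[X in _ + X + _ = _]p1 -[in RHS]q1.
  rewrite -!ge0_integralD//.
  - apply: eq_integral => v _; rewrite funenegE funeposE /= -!EFin_max -!EFinD.
    congr (_%:E); rewrite /klfun -/(f v).
    by rewrite (maxr0_split (f v)); ring.
  - by move=> v _; rewrite lee_fin ltW.
  - by move=> v _; rewrite -EFinD lee_fin addr_ge0.
  - exact: emeasurable_funD.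
  - by move=> v _; rewrite lee_fin.
  - by move=> v _; rewrite lee_fin.
rewrite integralE -/lam.
move: fpn fnfin; set a := \int[lam]_v (klfun _ _)%:E; set b := \int[lam]_v _^\- v.
set c := \int[lam]_v _^\+ v => abc bfin.
have -> : c = a + b.
  by rewrite -[c](@addeK _ 1%E)// -abc addeAC addeK.
by rewrite addeK.
Qed.

End klfun.

(** * Change of reference density in the relative entropy *)

Section kl_step.
Local Open Scope ereal_scope.
Context (R : realType) d d1 d2 (W : measurableType d) (T1 : measurableType d1)
  (T2 : measurableType d2) (P : probability W R) (X : {RV P >-> T1})
  (U : {RV P >-> T2}) (lam : {sigma_finite_measure set T2 -> \bar R}).

Lemma measurable_section_integral (g : T1 * T2 -> \bar R) :
  measurable_fun setT g -> (forall z, 0 <= g z) ->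
  measurable_fun setT (fun w => \int[lam]_v g (X w, v)).
Proof.
move=> mg g0.
exact: (measurableT_comp
  (@measurable_fun_fubini_tonelli_F _ _ _ _ _ lam _ mg g0) (measurable_funPT X)).
Qed.

Context (p s : T1 -> T2 -> R) (r : T2 -> R).
Hypotheses (mp : measurable_fun setT (fun z : T1 * T2 => p z.1 z.2))
  (ms : measurable_fun setT (fun z : T1 * T2 => s z.1 z.2))
  (mr : measurable_fun setT r)
  (p0 : forall x v, (0 <= p x v)%R) (s0 : forall x v, (0 < s x v)%R)
  (r0 : forall v, (0 < r v)%R)
  (s1 : forall x, \int[lam]_v (s x v)%:E = 1) (r1 : \int[lam]_v (r v)%:E = 1)
  (XU : forall C D, measurable C -> measurable D ->
    P (X @^-1` C `&` U @^-1` D) =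
    \int[P]_(w in X @^-1` C) \int[lam]_(v in D) (p (X w) v)%:E).

Let h (z : T1 * T2) : R := (ln (s z.1 z.2) - ln (r z.2))%R.

Hypothesis ih : P.-integrable setT (fun w => (h (X w, U w))%:E).

Let mr2 : measurable_fun setT (fun z : T1 * T2 => r z.2).
Proof. exact: (measurableT_comp mr measurable_snd). Qed.

Let mh : measurable_fun setT h.
Proof.
apply: measurable_funB; first exact: (measurableT_comp (@measurable_ln R) ms).
exact: (measurableT_comp (@measurable_ln R) mr2).
Qed.

Let hp z : R := Num.max (h z) 0%R.
Let hn z : R := Num.max (- h z)%R 0%R.

Let hp0 z : (0 <= hp z)%R. Proof. by rewrite /hp le_max lexx orbT. Qed.
Let hn0 z : (0 <= hn z)%R. Proof. by rewrite /hn le_max lexx orbT. Qed.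

Let mhp : measurable_fun setT hp. Proof. exact: measurable_maxr. Qed.
Let mhn : measurable_fun setT hn.
Proof. by apply: measurable_maxr => //; exact: measurableT_comp. Qed.

Let kr (z : T1 * T2) : \bar R := (klfun (p z.1 z.2) (r z.2))%:E.
Let ks (z : T1 * T2) : \bar R := (klfun (p z.1 z.2) (s z.1 z.2))%:E.

Let mkr : measurable_fun setT kr. Proof. by apply/measurable_EFinP; exact: measurable_klfun. Qed.
Let mks : measurable_fun setT ks. Proof. by apply/measurable_EFinP; exact: measurable_klfun. Qed.
Let kr0 z : 0 <= kr z. Proof. by rewrite lee_fin klfun_ge0. Qed.
Let ks0 z : 0 <= ks z. Proof. by rewrite lee_fin klfun_ge0. Qed.

Let pw (f : T1 * T2 -> R) (z : T1 * T2) : \bar R := (f z)%:E * (p z.1 z.2)%:E.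

Let mpw f : measurable_fun setT f -> measurable_fun setT (pw f).
Proof. by move=> mf; apply: emeasurable_funM; exact/measurable_EFinP. Qed.

Let pw0 f z : (forall z, (0 <= f z)%R) -> 0 <= pw f z.
Proof. by move=> f0; rewrite /pw -EFinM lee_fin mulr_ge0. Qed.

Let sect (g : T1 * T2 -> \bar R) : measurable_fun setT g ->
  forall x, measurable_fun setT (fun v => g (x, v)).
Proof. by move=> mg x; exact: (measurableT_comp mg (measurable_pair1 x)). Qed.

(** [klfun_chain] integrated at fixed [x], the two units being the masses of [s x] and [r]. For an
    individual [x] the weighted integrals of [h] may diverge, so its positive and negative parts are
    kept on opposite sides. *)
Let pointwise x :
  \int[lam]_v kr (x, v) + 1 + \int[lam]_v pw hn (x, v) =
  \int[lam]_v ks (x, v) + 1 + \int[lam]_v pw hp (x, v).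
Proof.
have msE : measurable_fun setT (fun v => (s x v)%:E).
  by apply/measurable_EFinP; exact: (measurableT_comp ms (measurable_pair1 x)).
have mrE : measurable_fun setT (fun v => (r v)%:E) by exact/measurable_EFinP.
have mk1 := sect mkr x; have mk2 := sect mks x.
have mn := sect (mpw mhn) x; have mpp := sect (mpw mhp) x.
rewrite -[in LHS](s1 x) -[in RHS]r1.
rewrite -(ge0_integralD lam measurableT (fun v _ => kr0 (x, v)) mk1); first last.
- exact: msE.
- by move=> v _; rewrite lee_fin ltW.
rewrite -(ge0_integralD lam measurableT _ _ (fun v _ => pw0 (x, v) hn0) mn); first last.
- exact: emeasurable_funD.
- by move=> v _; apply: adde_ge0; [exact: kr0 | rewrite lee_fin ltW].
rewrite -(ge0_integralD lam measurableT (fun v _ => ks0 (x, v)) mk2); first last.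
- exact: mrE.
- by move=> v _; rewrite lee_fin ltW.
rewrite -(ge0_integralD lam measurableT _ _ (fun v _ => pw0 (x, v) hp0) mpp); first last.
- exact: emeasurable_funD.
- by move=> v _; apply: adde_ge0; [exact: ks0 | rewrite lee_fin ltW].
apply: eq_integral => v _; rewrite /kr /ks /pw /= -!EFinM -!EFinD; congr (_%:E).
rewrite (@klfun_chain _ _ _ (s x v) (h (x, v)))// /hp (maxr0_split (h _)) -/(hn _).
by ring.
Qed.

(** After averaging over [X], disintegration turns the weighted parts of [h] into expectations along
    [(X, U)]. These are finite by [ih] and can be moved across, while either entropy may still be
    infinite. *)
Lemma kl_step :
  \int[P]_w \int[lam]_v (klfun (p (X w) v) (r v))%:E =
  \int[P]_w \int[lam]_v (klfun (p (X w) v) (s (X w) v))%:E +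
  \int[P]_w (h (X w, U w))%:E.
Proof.
have mXU : measurable_fun setT (fun w => (X w, U w)) by exact: measurable_fun_pair.
have disint (f : T1 * T2 -> R) : measurable_fun setT f -> (forall z, (0 <= f z)%R) ->
    \int[P]_w \int[lam]_v pw f (X w, v) = \int[P]_w (f (X w, U w))%:E.
  move=> mf f0; apply/esym; apply: (@disintegration _ _ _ _ _ _ _ P X U lam p mp p0 XU
    (EFin \o f)); first exact/measurable_EFinP.
  by move=> z; rewrite /= lee_fin.
have hE : \int[P]_w (h (X w, U w))%:E =
    \int[P]_w (hp (X w, U w))%:E - \int[P]_w (hn (X w, U w))%:E.
  rewrite integralE; congr (_ - _); apply: eq_integral => w _.
  - by rewrite funeposE -EFin_max.
  - by rewrite funenegE -EFin_max.
have fin (f : T1 * T2 -> R) : measurable_fun setT f -> (forall z, (0 <= f z)%R) ->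
    (forall z, (f z <= `|h z|)%R) -> \int[P]_w (f (X w, U w))%:E \is a fin_num.
  move=> mf f0 fh; rewrite ge0_fin_numE; last by apply: integral_ge0 => w _; rewrite lee_fin.
  have /integrableP[mhX] := ih; apply: le_lt_trans; apply: ge0_le_integral => //.
  - by move=> w _; rewrite lee_fin.
  - apply/measurable_EFinP; exact: (measurableT_comp mf mXU).
  - exact: measurableT_comp.
  - by move=> w _; rewrite lee_fin.
have finp := fin _ mhp hp0; have finn := fin _ mhn hn0.
have {}finp : \int[P]_w (hp (X w, U w))%:E \is a fin_num.
  by apply: finp => z; rewrite /hp ge_max ler_norm normr_ge0.
have {}finn : \int[P]_w (hn (X w, U w))%:E \is a fin_num.
  by apply: finn => z; rewrite /hn ge_max normr_ge0 -normrN ler_norm.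
have mS g : measurable_fun setT g -> (forall z, 0 <= g z) ->
    measurable_fun setT (fun w => \int[lam]_v g (X w, v)).
  exact: measurable_section_integral.
have S0 (g : T1 * T2 -> \bar R) : (forall z, 0 <= g z) -> forall w, setT w ->
    0 <= \int[lam]_v g (X w, v) by move=> g0 w _; apply: integral_ge0.
have P1 : \int[P]_w (1 : \bar R) = 1.
  by rewrite integral_cst// mul1e; exact: probability_setT.
have sum2 (g1 g2 : T1 * T2 -> \bar R) : measurable_fun setT g1 -> measurable_fun setT g2 ->
    (forall z, 0 <= g1 z) -> (forall z, 0 <= g2 z) ->
    \int[P]_w (\int[lam]_v g1 (X w, v) + 1 + \int[lam]_v g2 (X w, v)) =
    \int[P]_w \int[lam]_v g1 (X w, v) + 1 + \int[P]_w \int[lam]_v g2 (X w, v).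
  move=> mg1 mg2 g10 g20.
  rewrite (ge0_integralD P measurableT _ _ (S0 _ g20) (mS _ mg2 g20)).
  - by rewrite (ge0_integralD P measurableT (S0 _ g10) (mS _ mg1 g10))// P1.
  - by move=> w _; rewrite adde_ge0// S0.
  - by apply: emeasurable_funD => //; exact: mS.
have : \int[P]_w (\int[lam]_v kr (X w, v) + 1 + \int[lam]_v pw hn (X w, v)) =
    \int[P]_w (\int[lam]_v ks (X w, v) + 1 + \int[lam]_v pw hp (X w, v)).
  by apply: eq_integral => w _; exact: pointwise.
rewrite (sum2 _ _ mkr (mpw mhn) kr0 (fun z => pw0 z hn0)).
rewrite (sum2 _ _ mks (mpw mhp) ks0 (fun z => pw0 z hp0)).
rewrite (disint _ mhn hn0) (disint _ mhp hp0) hE.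
have alg (a b c e : \bar R) : c \is a fin_num -> e \is a fin_num ->
    a + 1 + e = b + 1 + c -> a = b + (c - e).
  move=> cf ef abc.
  have : a + 1 + e - 1 - e = b + 1 + c - 1 - e by rewrite abc.
  by rewrite addeAC addeK// addeK// => ->; rewrite [b + 1 + c]addeAC addeK// addeA.
exact: alg finp finn.
Qed.

End kl_step.

(** * Second moments *)

Section quadratic_bounds.
Context (R : realType).

Lemma enorm_sqr n (v : 'cV[R]_n) : enorm v ^+ 2 = (v^T *m v) 0 0.
Proof.
rewrite /enorm sqr_sqrtr; last by apply: sumr_ge0 => i _; exact: sqr_ge0.
by rewrite mxE; apply: eq_bigr => i _; rewrite mxE expr2.
Qed.

Lemma sqnorm_entry n (v : 'cV[R]_n) i : v i 0 ^+ 2 <= (v^T *m v) 0 0.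
Proof.
rewrite mxE (bigD1 i)//= mxE -expr2 lerDl sumr_ge0// => j _.
by rewrite mxE -expr2 sqr_ge0.
Qed.

Lemma quad_bound n (M : 'M[R]_n) : exists2 c : R, 0 <= c &
  forall v : 'cV[R]_n, `|(v^T *m M *m v) 0 0| <= c * (v^T *m v) 0 0.
Proof.
exists (\sum_i \sum_j `|M j i|) => [|v].
  by apply: sumr_ge0 => i _; exact: sumr_ge0.
rewrite mxE (le_trans (ler_norm_sum _ _ _))// mulr_suml ler_sum// => i _.
rewrite mxE mulr_suml (le_trans (ler_norm_sum _ _ _))// mulr_suml ler_sum// => j _.
rewrite mxE !normrM -mulrA mulrCA ler_wpM2l//.
have := sqnorm_entry v i; have := sqnorm_entry v j.
rewrite -[v i 0 ^+ 2]real_normK ?num_real// -[v j 0 ^+ 2]real_normK ?num_real//.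
by have := sqr_ge0 (`|v i 0| - `|v j 0|); nra.
Qed.

Lemma sqnormD_bound n (x y : 'cV[R]_n) :
  ((x + y)^T *m (x + y)) 0 0 <= 2 * (x^T *m x) 0 0 + 2 * (y^T *m y) 0 0.
Proof.
rewrite -subr_ge0 (_ : _ - _ = ((x - y)^T *m (x - y)) 0 0) ?sqnorm_ge0//.
rewrite !tr_addmx tr_oppmx !mulmxDr !mulmxDl !(mulmxN, mulNmx) opprK.
by rewrite !(addmxE, oppmxE); ring.
Qed.

Lemma affine_sqnorm_bound n m (A : 'M[R]_n) (B : 'M[R]_(n, m)) : exists2 c : R, 0 <= c &
  forall (x : 'cV[R]_n) (u : 'cV[R]_m), ((A *m x + B *m u)^T *m (A *m x + B *m u)) 0 0 <=
    c * ((x^T *m x) 0 0 + (u^T *m u) 0 0).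
Proof.
have [a a0 aP] := quad_bound (A^T *m A); have [b b0 bP] := quad_bound (B^T *m B).
exists (2 * (a + b)) => [|x u]; first by rewrite mulr_ge0 ?addr_ge0.
apply: le_trans (sqnormD_bound _ _) _.
have := le_trans (ler_norm _) (aP x); have := le_trans (ler_norm _) (bP u).
rewrite !trmx_mul !mulmxA; have := sqnorm_ge0 x; have := sqnorm_ge0 u.
by nra.
Qed.

End quadratic_bounds.

Section second_moments.
Local Open Scope ereal_scope.
Context (R : realType) d (W : measurableType d) (P : probability W R).

Lemma probability_integral_cst (c : \bar R) : \int[P]_w c = c.
Proof.
rewrite integral_cst//; transitivity (c * 1); last exact: mule1.
by apply: (congr1 (fun t => c * t)); exact: probability_setT.
Qed.

Definition finite_second_moment n (X : {RV P >-> 'cV[R]_n}) : Prop :=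
  \int[P]_w (((X w)^T *m X w) 0 0)%R%:E < +oo.

Lemma measurable_sqnorm d' (T : measurableType d') n (f : T -> 'cV[R]_n) :
  measurable_fun setT f -> measurable_fun setT (fun t => ((f t)^T *m f t) 0%R 0%R).
Proof.
by move=> mf; under eq_fun do rewrite -[_^T]mulmx1; exact: measurable_quad.
Qed.

Lemma gaussian_second_moment n (X : {RV P >-> 'cV[R]_n}) (S : 'M[R]_n) :
  posdefmx S -> gaussian_rv X 0 S -> finite_second_moment X.
Proof.
move=> Sp XG; rewrite /finite_second_moment.
rewrite (ge0_integral_gaussian_rv (f := fun x => ((x^T *m x) 0 0)%R%:E) XG).
- exact: gauss_second_moment.
- by apply/measurable_EFinP; exact: measurable_sqnorm.
- by move=> x; rewrite lee_fin sqnorm_ge0.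
Qed.

Lemma affine_second_moment n m (A : 'M[R]_n) (B : 'M[R]_(n, m))
    (X X' : {RV P >-> 'cV[R]_n}) (U : {RV P >-> 'cV[R]_m}) :
  (forall w, X' w = (A *m X w + B *m U w)%R) ->
  finite_second_moment X -> finite_second_moment U -> finite_second_moment X'.
Proof.
move=> X'E fX fU; have [c c0 cP] := affine_sqnorm_bound A B.
have mX : measurable_fun setT (fun w => (((X w)^T *m X w) 0 0)%R%:E).
  by apply/measurable_EFinP; exact: measurable_sqnorm.
have mU : measurable_fun setT (fun w => (((U w)^T *m U w) 0 0)%R%:E).
  by apply/measurable_EFinP; exact: measurable_sqnorm.
apply: (@le_lt_trans _ _ (\int[P]_w (c%:E *
    ((((X w)^T *m X w) 0 0)%R%:E + (((U w)^T *m U w) 0 0)%R%:E)))).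
  apply: ge0_le_integral => //.
  - by move=> w _; rewrite lee_fin sqnorm_ge0.
  - by apply/measurable_EFinP; exact: measurable_sqnorm.
  - by apply: emeasurable_funM => //; exact: emeasurable_funD.
  - by move=> w _; rewrite -EFinD -EFinM lee_fin X'E.
rewrite ge0_integralZl//; first last.
- by move=> w _; rewrite adde_ge0// lee_fin sqnorm_ge0.
- exact: emeasurable_funD.
rewrite ge0_integralD//; first last.
- by move=> w _; rewrite lee_fin sqnorm_ge0.
- by move=> w _; rewrite lee_fin sqnorm_ge0.
rewrite lte_mul_pinfty// ?lee_fin//.
exact: lte_add_pinfty.
Qed.

Lemma quad_integrable n (M : 'M[R]_n) (X : {RV P >-> 'cV[R]_n}) :
  finite_second_moment X ->
  P.-integrable setT (fun w => (((X w)^T *m M *m X w) 0 0)%R%:E).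
Proof.
move=> fX; have [c c0 cP] := quad_bound M.
have mX : measurable_fun setT (fun w => (((X w)^T *m X w) 0 0)%R%:E).
  by apply/measurable_EFinP; exact: measurable_sqnorm.
apply/integrableP; split; first by apply/measurable_EFinP; exact: measurable_quad.
apply: (@le_lt_trans _ _ (\int[P]_w (c%:E * (((X w)^T *m X w) 0 0)%R%:E))).
  apply: ge0_le_integral => //.
  - apply: measurableT_comp => //; apply/measurable_EFinP; exact: measurable_quad.
  - exact: emeasurable_funM.
  - by move=> w _; rewrite -EFinM lee_fin.
rewrite ge0_integralZl//; last by move=> w _; rewrite lee_fin sqnorm_ge0.
by rewrite lte_mul_pinfty.
Qed.

(** The constant must not depend on the mean [a], which will be a random feedback [K x]; it is twice
    the second moment of the centred Gaussian. *)
Lemma gauss_mean_second_moment m (S : 'M[R]_m) : posdefmx S ->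
  exists2 c : R, (0 <= c)%R & forall a : 'cV[R]_m,
    \int[lebesgue_cV R m]_v (((v^T *m v) 0 0)%R%:E * (gauss_pdf a S v)%:E) <=
    (c + 2 * (a^T *m a) 0 0)%R%:E.
Proof.
move=> Sp; have g2 := gauss_second_moment Sp.
set M := \int[_]_v _ in g2.
have M0 : 0 <= M.
  by apply: integral_ge0 => v _; rewrite -EFinM lee_fin mulr_ge0 ?sqnorm_ge0 ?gauss_pdf_ge0.
have Mf : M \is a fin_num by rewrite ge0_fin_numE.
have msq : measurable_fun setT (fun v : 'cV[R]_m => ((v^T *m v) 0 0)%R%:E).
  by apply/measurable_EFinP; exact: measurable_sqnorm.
have mg (a : 'cV[R]_m) : measurable_fun setT (fun v => (gauss_pdf a S v)%:E).
  by apply/measurable_EFinP; exact: measurable_gauss_pdf.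
exists (2 * fine M)%R => [|a]; first by rewrite mulr_ge0// fine_ge0.
rewrite -(ge0_integral_cV_shift a); first last.
- by move=> v; rewrite -EFinM lee_fin mulr_ge0 ?sqnorm_ge0 ?gauss_pdf_ge0.
- exact: emeasurable_funM.
apply: (@le_trans _ _ (\int[lebesgue_cV R m]_v (2%:E *
    (((v^T *m v) 0 0)%R%:E * (gauss_pdf 0 S v)%:E) +
    (2 * (a^T *m a) 0 0)%R%:E * (gauss_pdf 0 S v)%:E))).
  apply: ge0_le_integral => //.
  - by move=> v _; rewrite -EFinM lee_fin mulr_ge0 ?sqnorm_ge0 ?gauss_pdf_ge0.
  - apply: emeasurable_funM; apply/measurable_EFinP.
      by apply: measurable_sqnorm; apply: measurable_addmx.
    by apply: measurable_gauss_pdf => //; apply: measurable_addmx.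
  - apply: emeasurable_funD; apply: emeasurable_funM => //; exact: emeasurable_funM.
  - move=> v _; rewrite -!EFinM -EFinD lee_fin /gauss_pdf addrK subr0.
    rewrite mulrA -mulrDl ler_wpM2r ?sqnormD_bound// mulr_ge0 ?expR_ge0//.
rewrite ge0_integralD//.
- rewrite !ge0_integralZl//.
  + by rewrite -/M integral_gauss_pdf// mule1 -(fineK Mf) -EFinM -EFinD.
  + by move=> v _; rewrite lee_fin gauss_pdf_ge0.
  + by rewrite lee_fin mulr_ge0 ?sqnorm_ge0.
  + exact: emeasurable_funM.
  + by move=> v _; rewrite -EFinM lee_fin mulr_ge0 ?sqnorm_ge0 ?gauss_pdf_ge0.
- by move=> v _; rewrite -!EFinM lee_fin !mulr_ge0 ?sqnorm_ge0 ?gauss_pdf_ge0.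
- by apply: emeasurable_funM => //; exact: emeasurable_funM.
- by move=> v _; rewrite -EFinM lee_fin !mulr_ge0 ?sqnorm_ge0 ?gauss_pdf_ge0.
- exact: emeasurable_funM.
Qed.

Lemma gauss_kernel_second_moment n m (K : 'M[R]_(m, n)) (S : 'M[R]_m)
    (X : {RV P >-> 'cV[R]_n}) (U : {RV P >-> 'cV[R]_m}) : posdefmx S ->
  (forall C D, measurable C -> measurable D -> P (X @^-1` C `&` U @^-1` D) =
    \int[P]_(w in X @^-1` C) \int[lebesgue_cV R m]_(v in D)
      (gauss_pdf (K *m X w) S v)%:E) ->
  finite_second_moment X -> finite_second_moment U.
Proof.
move=> Sp XU fX; have [c c0 cP] := gauss_mean_second_moment Sp.
have [b b0 bP] := affine_sqnorm_bound (0 : 'M[R]_m) K.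
have mp : measurable_fun setT (fun z : 'cV[R]_n * 'cV[R]_m => gauss_pdf (K *m z.1) S z.2).
  by apply: measurable_gauss_pdf => //; exact: measurable_mulmx.
have msq : measurable_fun setT (fun z : 'cV[R]_n * 'cV[R]_m => ((z.2^T *m z.2) 0 0)%R%:E).
  by apply/measurable_EFinP; exact: measurable_sqnorm.
have mX : measurable_fun setT (fun w => (((X w)^T *m X w) 0 0)%R%:E).
  by apply/measurable_EFinP; exact: measurable_sqnorm.
rewrite /finite_second_moment.
rewrite (disintegration (lam := lebesgue_cV R m)
  (p := fun x v => gauss_pdf (K *m x) S v) (X := X) (U := U)
  (f := fun z => ((z.2^T *m z.2) 0 0)%R%:E) mp _ XU msq); first last.
- by move=> z; rewrite lee_fin sqnorm_ge0.
- by move=> x v; exact: gauss_pdf_ge0.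
apply: (@le_lt_trans _ _ (\int[P]_w (c%:E + (2 * b)%:E * (((X w)^T *m X w) 0 0)%R%:E))).
  apply: ge0_le_integral => //.
  - by move=> w _; apply: integral_ge0 => v _; rewrite -EFinM lee_fin mulr_ge0 ?sqnorm_ge0 ?gauss_pdf_ge0.
  - apply: (measurable_section_integral X (lebesgue_cV R m)
      (g := fun z => ((z.2^T *m z.2) 0 0)%R%:E * (gauss_pdf (K *m z.1) S z.2)%:E)).
      by apply: emeasurable_funM => //; exact/measurable_EFinP.
    by move=> z; rewrite -EFinM lee_fin mulr_ge0 ?sqnorm_ge0 ?gauss_pdf_ge0.
  - by apply: emeasurable_funD => //; exact: emeasurable_funM.
  - move=> w _; apply: le_trans (cP (K *m X w)) _.
    rewrite -EFinM -EFinD lee_fin lerD2l -mulrA ler_wpM2l//.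
    by have := bP 0%R (X w); rewrite !mul0mx !add0r trmx0 mul0mx [X in (X + _)%R]mxE add0r.
rewrite ge0_integralD//.
- rewrite probability_integral_cst ge0_integralZl//.
  + by rewrite lte_add_pinfty ?ltry// lte_mul_pinfty ?lee_fin ?mulr_ge0.
  + by move=> w _; rewrite lee_fin sqnorm_ge0.
  + by rewrite lee_fin mulr_ge0.
- by move=> w _; rewrite -EFinM lee_fin mulr_ge0 ?sqnorm_ge0// mulr_ge0.
- exact: emeasurable_funM.
Qed.

End second_moments.

Section same_law.
Local Open Scope ereal_scope.
Context (R : realType) d d' (W : measurableType d) (W' : measurableType d')
  (P : probability W R) (P' : probability W' R).

(** Lets boundary terms be compared across different probability spaces. As [f] has no sign, the law
    is applied to its positive and negative parts separately. *)
Lemma gaussian_rv_integral_eq n (X : {RV P >-> 'cV[R]_n}) (X' : {RV P' >-> 'cV[R]_n})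
    (mu : 'cV[R]_n) (S : 'M[R]_n) (f : 'cV[R]_n -> R) :
  gaussian_rv X mu S -> gaussian_rv X' mu S -> measurable_fun setT f ->
  \int[P]_w (f (X w))%:E = \int[P']_w (f (X' w))%:E.
Proof.
move=> XG X'G mf.
have mf' : measurable_fun setT (EFin \o f) by exact/measurable_EFinP.
have same (g : 'cV[R]_n -> \bar R) : measurable_fun setT g -> (forall x, 0 <= g x) ->
    \int[P]_w g (X w) = \int[P']_w g (X' w).
  move=> mg g0; rewrite (ge0_integral_gaussian_rv XG mg g0).
  by rewrite (ge0_integral_gaussian_rv X'G mg g0).
rewrite integralE [RHS]integralE; congr (_ - _).
- under eq_integral do rewrite funeposE; under [RHS]eq_integral do rewrite funeposE.
  apply: (same (fun x => maxe (f x)%:E 0)); first exact: measurable_maxe.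
  by move=> x; rewrite le_max lexx orbT.
- under eq_integral do rewrite funenegE; under [RHS]eq_integral do rewrite funenegE.
  apply: (same (fun x => maxe (- (f x)%:E) 0)); last by move=> x; rewrite le_max lexx orbT.
  by apply: measurable_maxe => //; exact: measurableT_comp.
Qed.

End same_law.

(** * Decomposition of the cost *)

Definition feedback (R : realType) n m (A : nat -> 'M[R]_n) (B : nat -> 'M[R]_(n, m))
    (Srho : nat -> 'M[R]_m) (Q : nat -> 'M[R]_n) (k : nat) : 'M[R]_(m, n) :=
  - (Sigma_pi B Srho Q k *m (B k)^T *m invmx (Q k.+1) *m A k).

Section one_step.
Context (R : realType) (n m : nat) (A : nat -> 'M[R]_n) (B : nat -> 'M[R]_(n, m)).
Context (Srho : nat -> 'M[R]_m) (Q : nat -> 'M[R]_n) (k : nat).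
Hypotheses (Srho_pd : posdefmx (Srho k)) (Au : A k \in unitmx).
Hypothesis Qu : Q k \in unitmx.
Hypotheses (Q's : (Q k.+1)^T = Q k.+1) (Q'u : Q k.+1 \in unitmx).
Hypothesis QSE :
  Q k.+1 = A k *m Q k *m (A k)^T - Brho B Srho k *m (Brho B Srho k)^T.

Let Bb := Brho B Srho k.
Let W0 : 'M[R]_m := 1%:M + Bb^T *m invmx (Q k.+1) *m Bb.
Hypothesis W0p : posdefmx W0.

Let Z : 'M[R]_m := invmx (Srho k) + 1%:M.
Let W : 'M[R]_m := Z + (B k)^T *m invmx (Q k.+1) *m B k.
Let K := feedback A B Srho Q k.

Let Zp : posdefmx Z.
Proof.
by apply: posdefD; [exact: posdef_inv | apply/posdef_possemidef/posdef_scalar].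
Qed.

Let Zh := sqrtmx Z.
Let Zhs : Zh^T = Zh. Proof. by case: (sqrtmx_posdef Zp). Qed.
Let Zhu : Zh \in unitmx. Proof. exact/posdef_unit/sqrtmx_posdef. Qed.
Let ZhZh : Zh *m Zh = Z. Proof. by case: (sqrtmxP (posdef_possemidef Zp)). Qed.

(** Rescaling the control by the square root of [Z] turns the pair [(B k, Z)] into [(Bb, 1)], the
    normalized setting of the steering results. *)
Let BbE : Bb *m Zh = B k. Proof. by rewrite /Bb /Brho /invsqrtmx -/Z -/Zh mulmxKV. Qed.

Let WE : W = Zh *m W0 *m Zh.
Proof.
by rewrite /W -ZhZh -BbE trmx_mul Zhs /W0 mulmxDr mulmxDl mulmx1 !mulmxA.
Qed.

Let BZB : B k *m invmx Z *m (B k)^T = Bb *m Bb^T.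
Proof.
rewrite -BbE -ZhZh invmx_mul// trmx_mul Zhs !mulmxA mulmxK//.
by rewrite mulmxKV.
Qed.

Lemma Sigma_pi_posdef : posdefmx (Sigma_pi B Srho Q k).
Proof.
rewrite /Sigma_pi -/Z -/W; apply: posdef_inv; rewrite WE -{2}Zhs.
exact: posdef_congr_unit.
Qed.

Let BWB : B k *m Sigma_pi B Srho Q k *m (B k)^T = Bb *m invmx W0 *m Bb^T.
Proof.
have W0u := posdef_unit W0p.
rewrite /Sigma_pi -/Z -/W WE !invmx_mul ?unitmx_mul ?Zhu ?W0u// -BbE trmx_mul Zhs.
by rewrite !mulmxA mulmxK// mulmxKV.
Qed.

Lemma mu_piE x : mu_pi A B Srho Q k x = K *m x.
Proof. by rewrite /mu_pi /feedback mulNmx. Qed.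

Lemma closed_loopE :
  A k + B k *m K = A k - Bb *m invmx W0 *m Bb^T *m invmx (Q k.+1) *m A k.
Proof. by rewrite /K /feedback mulmxN !mulmxA BWB. Qed.

Lemma closed_loop_noiseE :
  B k *m Sigma_pi B Srho Q k *m (B k)^T = Bb *m invmx W0 *m Bb^T.
Proof. exact: BWB. Qed.

Lemma ln_gauss_pdf p (a : 'cV[R]_p) (S : 'M[R]_p) v : posdefmx S ->
  ln (gauss_pdf a S v) = ln (Num.sqrt ((2 * pi) ^+ p * \det S))^-1
    - 2^-1 * ((v - a)^T *m invmx S *m (v - a)) 0 0.
Proof.
move=> Sp; rewrite /gauss_pdf lnM ?posrE ?expR_gt0//; last first.
  by rewrite invr_gt0 sqrtr_gt0 mulr_gt0 ?posdef_det// exprn_gt0// mulr_gt0 ?pi_gt0.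
by rewrite expRK.
Qed.

Lemma pi_rho_log_ratio : exists c : R, forall x v,
  ln (pi_rho A B Srho Q k x v) - ln (gauss_pdf 0 (Srho k) v) =
  c + 2^-1 * (x^T *m invmx (Q k) *m x) 0 0 - 2^-1 * (v^T *m v) 0 0
    - 2^-1 * ((A k *m x + B k *m v)^T *m invmx (Q k.+1) *m (A k *m x + B k *m v)) 0 0.
Proof.
(* Only the logarithms of the two normalizing factors remain; everything depending on [x] and [v] is
   quadratic. *)
exists (ln (Num.sqrt ((2 * pi) ^+ m * \det (Sigma_pi B Srho Q k)))^-1 -
        ln (Num.sqrt ((2 * pi) ^+ m * \det (Srho k)))^-1) => x v.
rewrite /pi_rho !ln_gauss_pdf//; last exact: Sigma_pi_posdef.
rewrite subr0 /Sigma_pi invmxK -/Z -/W.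
have Zu := posdef_unit Zp.
have Wu : W \in unitmx by rewrite WE !unitmx_mul Zhu (posdef_unit W0p).
(* The recursion for [Q] read backwards. Evaluated at [A k *m x], the inverse of this matrix gives
   the form of [invmx (Q k)] at [x]. *)
have EE : Q k.+1 + B k *m invmx Z *m (B k)^T = A k *m Q k *m (A k)^T.
  by rewrite BZB QSE subrK.
have Eu : Q k.+1 + B k *m invmx Z *m (B k)^T \in unitmx.
  by rewrite EE !unitmx_mul unitmx_tr Au Qu.
have := @complete_square _ _ _ (Q k.+1) Z (B k) (A k *m x) v Q'u Zu Eu Wu Q's Zp.1.
rewrite EE; rewrite (_ : - (_ *m (A k *m x)) = mu_pi A B Srho Q k x); last first.
  by rewrite /mu_pi /Sigma_pi -/Z -/W !mulmxA.
rewrite -/W => /(congr1 (fun M : 'M[R]_1 => M 0 0)).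
have -> : v^T *m Z *m v = v^T *m invmx (Srho k) *m v + v^T *m v.
  by rewrite /Z mulmxDr mulmxDl mulmx1.
rewrite !addmxE.
have -> : (A k *m x)^T *m invmx (A k *m Q k *m (A k)^T) *m (A k *m x) =
    x^T *m invmx (Q k) *m x.
  rewrite !invmx_mul ?unitmx_mul ?unitmx_tr ?Au ?Qu// trmx_mul !mulmxA.
  by rewrite mulmxK ?unitmx_tr// mulmxKV.
by move=> sq; lra.
Qed.

End one_step.

Section cost_decomposition.
Local Open Scope ereal_scope.
Context (R : realType) (n m T : nat) (A : nat -> 'M[R]_n) (B : nat -> 'M[R]_(n, m)).
Context (Sini Sfin : 'M[R]_n) (rho : nat -> 'cV[R]_m -> R) (Srho : nat -> 'M[R]_m).
Context (Q : nat -> 'M[R]_n) (c : nat -> R).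
Hypothesis Sini_pd : posdefmx Sini.
Hypothesis Srho_pd : forall k, (k < T)%N -> posdefmx (Srho k).
Hypothesis rhoE : forall k, (k < T)%N -> rho k = gauss_pdf 0 (Srho k).
Hypothesis Sigma_pd : forall k, (k < T)%N -> posdefmx (Sigma_pi B Srho Q k).

Definition value k (x : 'cV[R]_n) : R := (2^-1 * (x^T *m invmx (Q k) *m x) 0 0)%R.

Hypothesis log_ratio : forall k, (k < T)%N -> forall x v,
  (ln (pi_rho A B Srho Q k x v) - ln (rho k v) =
   c k + value k x - 2^-1 * (v^T *m v) 0 0 - value k.+1 (A k *m x + B k *m v))%R.

Lemma measurable_value k : measurable_fun setT (value k).
Proof. by apply: measurable_funM => //; exact: measurable_quad. Qed.

Lemma measurable_pi_rho k :
  measurable_fun setT (fun z : 'cV[R]_n * 'cV[R]_m => pi_rho A B Srho Q k z.1 z.2).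
Proof.
apply: measurable_gauss_pdf => //; under eq_fun do rewrite mu_piE.
exact: measurable_mulmx.
Qed.

Let rho0 k v : (k < T)%N -> (0 < rho k v)%R.
Proof. by move=> kT; rewrite rhoE//; exact/gauss_pdf_gt0/Srho_pd. Qed.

Let mrho k : (k < T)%N -> measurable_fun setT (rho k).
Proof. by move=> kT; rewrite rhoE//; exact: measurable_gauss_pdf. Qed.

Let rho1 k : (k < T)%N -> \int[lebesgue_cV R m]_v (rho k v)%:E = 1.
Proof. by move=> kT; rewrite rhoE//; exact/integral_gauss_pdf/Srho_pd. Qed.

Lemma pi_rho_policy : is_policy T (pi_rho A B Srho Q).
Proof.
move=> k kT; split; first exact: measurable_pi_rho.
- by move=> x u; exact: gauss_pdf_ge0.
- by move=> x; exact/integral_gauss_pdf/Sigma_pd.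
Qed.

Context d (W : measurableType d) (P : probability W R)
  (x : nat -> {RV P >-> 'cV[R]_n}) (u : nat -> {RV P >-> 'cV[R]_m})
  (pi : nat -> 'cV[R]_n -> 'cV[R]_m -> R).

(** The expected relative entropy from [pi_rho], written with [klfun] so that it lies in [[0, +oo]]
    without any integrability condition. *)
Definition gap k : \bar R :=
  \int[P]_w \int[lebesgue_cV R m]_v
    (klfun (pi k (x k w) v) (pi_rho A B Srho Q k (x k w) v))%:E.

Hypotheses (piP : is_policy T pi) (xuP : feasible T A B Sini Sfin pi x u).

Let mpi k : (k < T)%N ->
  measurable_fun setT (fun z : 'cV[R]_n * 'cV[R]_m => pi k z.1 z.2).
Proof. by move=> /piP[]. Qed.

Let pi0 k y v : (k < T)%N -> (0 <= pi k y v)%R.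
Proof. by move=> /piP[]. Qed.

Lemma gap_ge0 k : (k < T)%N -> 0 <= gap k.
Proof.
move=> kT; apply: integral_ge0 => w _; apply: integral_ge0 => v _.
by rewrite lee_fin klfun_ge0// ?pi0//; exact/gauss_pdf_gt0/Sigma_pd.
Qed.

Lemma kl_div_prior k y : (k < T)%N ->
  kl_div (pi k y) (rho k) = \int[lebesgue_cV R m]_v (klfun (pi k y v) (rho k v))%:E.
Proof.
move=> kT; apply: kl_divE; [|exact: mrho|..].
- exact: (measurableT_comp (mpi kT) (measurable_pair1 y)).
- by move=> v; exact: pi0.
- by move=> v; exact: rho0.
- by case: (piP kT).
- exact: rho1.
Qed.

Lemma kl_div_prior_ge0 k y : (k < T)%N -> 0 <= kl_div (pi k y) (rho k).
Proof.
move=> kT; rewrite kl_div_prior//; apply: integral_ge0 => v _.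
by rewrite lee_fin klfun_ge0 ?pi0 ?rho0.
Qed.

Lemma measurable_kl_div_prior k : (k < T)%N ->
  measurable_fun setT (fun w => kl_div (pi k (x k w)) (rho k)).
Proof.
move=> kT; under eq_fun do rewrite kl_div_prior//.
apply: (measurable_section_integral (x k) (lebesgue_cV R m)
  (g := fun z => (klfun (pi k z.1 z.2) (rho k z.2))%:E)).
  apply/measurable_EFinP; apply: measurable_klfun; first exact: mpi.
  exact: (measurableT_comp (mrho kT) measurable_snd).
by move=> z; rewrite lee_fin klfun_ge0 ?pi0 ?rho0.
Qed.

Lemma costE : cost T pi rho x u = \sum_(k < T)
  (\int[P]_w (2^-1 * ((u k w)^T *m u k w) 0 0)%:E +
   \int[P]_w kl_div (pi k (x k w)) (rho k)).
Proof.
have mu k : measurable_fun setT (fun w => (2^-1 * ((u k w)^T *m u k w) 0 0)%:E).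
  by apply/measurable_EFinP; apply: measurable_funM => //; exact: measurable_sqnorm.
have u0 k w : 0 <= (2^-1 * ((u k w)^T *m u k w) 0 0)%:E.
  by rewrite lee_fin mulr_ge0// sqnorm_ge0.
rewrite /cost; under eq_integral do under eq_bigr do rewrite enorm_sqr.
rewrite ge0_integral_sum//; first last.
- by move=> k w _; rewrite adde_ge0// kl_div_prior_ge0.
- by move=> k; apply: emeasurable_funD => //; exact: measurable_kl_div_prior.
apply: eq_bigr => k _; rewrite ge0_integralD//.
- by move=> w _; rewrite kl_div_prior_ge0.
- exact: measurable_kl_div_prior.
Qed.

Lemma finite_cost_control_moment k : (k < T)%N ->
  cost T pi rho x u < +oo -> finite_second_moment (u k).
Proof.
move=> kT; have int0 j : 0 <= \int[P]_w (2^-1 * ((u j w)^T *m u j w) 0 0)%:E.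
  by apply: integral_ge0 => w _; rewrite lee_fin mulr_ge0// sqnorm_ge0.
have kl0 (j : 'I_T) : 0 <= \int[P]_w kl_div (pi j (x j w)) (rho j).
  by apply: integral_ge0 => w _; exact: kl_div_prior_ge0.
rewrite costE (bigD1 (Ordinal kT))//= => costoo.
have : \int[P]_w (2^-1 * ((u k w)^T *m u k w) 0 0)%:E < +oo.
  apply: le_lt_trans costoo; rewrite -addeA leeDl// adde_ge0 ?(kl0 (Ordinal kT))//.
  by apply: sume_ge0 => j _; rewrite adde_ge0.
under eq_integral do rewrite EFinM; rewrite ge0_integralZl//; first last.
- by move=> w _; rewrite lee_fin sqnorm_ge0.
- by apply/measurable_EFinP; exact: measurable_sqnorm.
rewrite /finite_second_moment; set M := \int[P]_w _ => Moo.
rewrite ltey; apply: contraTneq Moo => ->.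
by rewrite gt0_muley ?lte_fin ?invr_gt0// ltxx.
Qed.

Hypothesis u_moment : forall k, (k < T)%N -> finite_second_moment (u k).

Lemma state_moment k : (k <= T)%N -> finite_second_moment (x k).
Proof.
case: xuP => xS x0 _ _; elim: k => [_|k IH kT]; first exact: gaussian_second_moment x0.
by apply: affine_second_moment (xS _ kT) _ _; [exact/IH/ltnW | exact: u_moment].
Qed.

Lemma value_integrable k : (k <= T)%N ->
  P.-integrable setT (fun w => (value k (x k w))%:E).
Proof.
move=> /state_moment/(quad_integrable (2^-1 *: invmx (Q k))).
apply: eq_integrable => // w _; rewrite /value -scalemxAr -scalemxAl.
by rewrite [in LHS]mxE.
Qed.

Let effort_integrable k : (k < T)%N ->
  P.-integrable setT (fun w => (2^-1 * ((u k w)^T *m u k w) 0 0)%:E).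
Proof.
move=> /u_moment/(quad_integrable (2^-1)%:M); apply: eq_integrable => // w _.
by rewrite mul_mx_scalar -scalemxAl [in LHS]mxE.
Qed.

(** [kl_step] exchanges the prior for [pi_rho] at the price of the expected log ratio. That ratio
    contains the effort with a minus sign, which cancels the running cost and leaves a difference of
    values, finite by the moment bounds. *)
Lemma stage_costE k : (k < T)%N ->
  \int[P]_w (2^-1 * ((u k w)^T *m u k w) 0 0)%:E +
    \int[P]_w kl_div (pi k (x k w)) (rho k) =
  gap k + (c k + fine (\int[P]_w (value k (x k w))%:E)
               - fine (\int[P]_w (value k.+1 (x k.+1 w))%:E))%:E.
Proof.
move=> kT; case: (xuP) => xS _ _ xuE.
have iV := value_integrable (ltnW kT); have iV' := value_integrable kT.
have iu := effort_integrable kT.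
have ic : P.-integrable setT (EFin \o cst (c k)) by exact: finite_measure_integrable_cst.
have hE : (fun w => (ln (pi_rho A B Srho Q k (x k w) (u k w)) - ln (rho k (u k w)))%:E) =
    (fun w => (EFin \o cst (c k)) w + (value k (x k w))%:E
      - (2^-1 * ((u k w)^T *m u k w) 0 0)%:E - (value k.+1 (x k.+1 w))%:E).
  by apply/funext => w; rewrite log_ratio// xS.
have i1 := integrableD measurableT ic iV; have i2 := integrableB measurableT i1 iu.
have i3 := integrableB measurableT i2 iV'.
have inth : \int[P]_w (ln (pi_rho A B Srho Q k (x k w) (u k w)) - ln (rho k (u k w)))%:E =
    (c k)%:E + \int[P]_w (value k (x k w))%:E
    - \int[P]_w (2^-1 * ((u k w)^T *m u k w) 0 0)%:E
    - \int[P]_w (value k.+1 (x k.+1 w))%:E.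
  transitivity (\int[P]_w ((EFin \o cst (c k)) w + (value k (x k w))%:E
      - (2^-1 * ((u k w)^T *m u k w) 0 0)%:E - (value k.+1 (x k.+1 w))%:E)).
    by apply: eq_integral => w _; exact: (congr1 (fun f => f w) hE).
  rewrite (integralB measurableT i2 iV') (integralB measurableT i1 iu).
  by rewrite (integralD measurableT ic iV) /= probability_integral_cst.
have fV := integrable_fin_num measurableT iV; have fV' := integrable_fin_num measurableT iV'.
have fu := integrable_fin_num measurableT iu.
under [X in _ + X = _]eq_integral do rewrite kl_div_prior//.
rewrite (kl_step (X := x k) (U := u k) (lam := lebesgue_cV R m)
  (p := pi k) (s := pi_rho A B Srho Q k) (r := rho k)) /=.
- rewrite inth -(fineK fV) -(fineK fV') -(fineK fu) addeCA; congr (_ + _).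
  by rewrite /= -!(EFinD, EFinN); congr (_%:E); ring.
- exact: mpi.
- exact: measurable_pi_rho.
- exact: mrho.
- by move=> y v; exact: pi0.
- by move=> y v; exact/gauss_pdf_gt0/Sigma_pd.
- by move=> v; exact: rho0.
- by move=> y; exact/integral_gauss_pdf/Sigma_pd.
- exact: rho1.
- exact: xuE.
- by rewrite hE.
Qed.

Lemma cost_gapE : cost T pi rho x u = \sum_(k < T) gap k +
  (\sum_(k < T) c k + fine (\int[P]_w (value 0 (x 0%N w))%:E)
    - fine (\int[P]_w (value T (x T w))%:E))%:E.
Proof.
rewrite costE (eq_bigr _ (fun k _ => stage_costE (ltn_ord k))) big_split/=.
congr (_ + _); rewrite sumEFin; congr (_%:E).
pose e k := fine (\int[P]_w (value k (x k w))%:E).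
rewrite -/(e 0%N) -/(e T) (eq_bigr (fun k : 'I_T => c k - (e k.+1 - e k)))%R.
  rewrite sumrB -(big_mkord xpredT (fun k => e k.+1 - e k))%R telescope_sumr//.
  by rewrite opprB addrA.
by move=> k _; rewrite -/(e k) -/(e k.+1); ring.
Qed.

End cost_decomposition.

(** * Optimality and uniqueness *)

Section optimality.
Local Open Scope ereal_scope.
Context (R : realType) (n m T : nat) (A : nat -> 'M[R]_n) (B : nat -> 'M[R]_(n, m)).
Context (Sini Sfin : 'M[R]_n) (rho : nat -> 'cV[R]_m -> R) (Srho : nat -> 'M[R]_m).
Context (Q : nat -> 'M[R]_n).
Hypotheses (Sini_pd : posdefmx Sini) (Sfin_pd : posdefmx Sfin).
Hypothesis Srho_pd : forall k, (k < T)%N -> posdefmx (Srho k).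
Hypothesis rhoE : forall k, (k < T)%N -> rho k = gauss_pdf 0 (Srho k).
Hypothesis HA : assumption_A T A (Brho B Srho) Sini Sfin.
Hypothesis Q0E : Q 0%N = Q_0 T A (Brho B Srho) Sini Sfin.
Hypothesis QSE : forall k, (k < T)%N ->
  Q k.+1 = (A k *m Q k *m (A k)^T - Brho B Srho k *m (Brho B Srho k)^T)%R.

Lemma pi_rhoE : pi_rho A B Srho Q =
  fun k y => gauss_pdf (feedback A B Srho Q k *m y) (Sigma_pi B Srho Q k).
Proof. by apply/funext => k; apply/funext => y; rewrite /pi_rho mu_piE. Qed.

Lemma steering_Sigma_pi_posdef k : (k < T)%N -> posdefmx (Sigma_pi B Srho Q k).
Proof.
move=> kT; apply: Sigma_pi_posdef; first exact: Srho_pd.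
exact: steering_posdef Q0E QSE _ kT.
Qed.

Let Sp := steering_Sigma_pi_posdef.

Lemma steering_log_ratio : exists c : nat -> R, forall k, (k < T)%N -> forall x v,
  (ln (pi_rho A B Srho Q k x v) - ln (rho k v) =
   c k + value Q k x - 2^-1 * (v^T *m v) 0 0 - value Q k.+1 (A k *m x + B k *m v))%R.
Proof.
suff H k : exists ck : R, (k < T)%N -> forall x v,
  (ln (pi_rho A B Srho Q k x v) - ln (rho k v) =
   ck + value Q k x - 2^-1 * (v^T *m v) 0 0 - value Q k.+1 (A k *m x + B k *m v))%R.
  by have [c cP] := choice H; exists c.
(* Times beyond the horizon receive a default constant, so that choice yields a total sequence. *)
case: (ltnP k T) => kT; last by exists 0%R.
have Qs := steering_Q_sym Sini_pd Sfin_pd HA Q0E QSE kT.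
have Qu := steering_Q_unit Sini_pd Sfin_pd HA Q0E QSE.
have [Au _ _] := HA.
have [ck ckP] := pi_rho_log_ratio (Srho_pd kT) (Au _ kT) (Qu _ (ltnW kT)) Qs
  (Qu _ kT) (QSE kT) (steering_posdef Sini_pd Sfin_pd HA Q0E QSE kT).
by exists ck => _ x v; rewrite rhoE.
Qed.

Lemma steering_state_covariance : exists Sg : nat -> 'M[R]_n,
  [/\ Sg 0%N = Sini, Sg T = Sfin, forall k, (k <= T)%N -> posdefmx (Sg k) &
    forall k, (k < T)%N -> let L := (A k + B k *m feedback A B Srho Q k)%R in
      L \in unitmx /\
      Sg k.+1 = (L *m Sg k *m L^T + B k *m Sigma_pi B Srho Q k *m (B k)^T)%R].
Proof.
have [Sg [Sg0 SgT SgS]] := steering_covariance Sini_pd Sfin_pd HA Q0E QSE.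
have SgS' k : (k < T)%N -> let L := (A k + B k *m feedback A B Srho Q k)%R in
    L \in unitmx /\
    Sg k.+1 = (L *m Sg k *m L^T + B k *m Sigma_pi B Srho Q k *m (B k)^T)%R.
  move=> kT; have W0p := steering_posdef Sini_pd Sfin_pd HA Q0E QSE kT.
  rewrite /= (closed_loopE A (Srho_pd kT) W0p) (closed_loop_noiseE (Srho_pd kT) W0p).
  exact: SgS.
exists Sg; split=> //; elim=> [_|k IH kT]; first by rewrite Sg0.
have [Lu ->] := SgS' k kT.
by apply: gaussian_step_posdef => //; [exact/IH/ltnW | exact: Sp].
Qed.

(** Agreement with [pi_rho] is asked only before time [k] and almost everywhere. The statement thus
    covers both [pi_rho] itself and, inside the uniqueness proof, a competitor that has been
    identified up to time [k]. *)
Lemma state_law (Sg : nat -> 'M[R]_n) k d (W : measurableType d) (P : probability W R)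
    (x : nat -> {RV P >-> 'cV[R]_n}) (u : nat -> {RV P >-> 'cV[R]_m})
    (pi : nat -> 'cV[R]_n -> 'cV[R]_m -> R) :
  Sg 0%N = Sini -> (forall k, (k <= T)%N -> posdefmx (Sg k)) ->
  (forall k, (k < T)%N -> let L := (A k + B k *m feedback A B Srho Q k)%R in
      L \in unitmx /\
      Sg k.+1 = (L *m Sg k *m L^T + B k *m Sigma_pi B Srho Q k *m (B k)^T)%R) ->
  is_policy T pi ->
  (forall k, (k < T)%N -> forall w, x k.+1 w = (A k *m x k w + B k *m u k w)%R) ->
  gaussian_rv (x 0%N) 0 Sini ->
  (forall k, (k < T)%N -> forall C D, measurable C -> measurable D ->
    P (x k @^-1` C `&` u k @^-1` D) =
    \int[P]_(w in x k @^-1` C) \int[lebesgue_cV R m]_(v in D) (pi k (x k w) v)%:E) ->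
  (forall j, (j < k)%N -> {ae lebesgue_cV R n, forall y, {ae lebesgue_cV R m, forall v,
     pi j y v = pi_rho A B Srho Q j y v}}) ->
  (k <= T)%N -> gaussian_rv (x k) 0 (Sg k).
Proof.
move=> Sg0 Sgp SgS piP xS x0 xuE; elim: k => [_ _|k IH piE kT]; first by rewrite Sg0.
have [Lu ->] := SgS k kT; have [mp p0 _] := piP k kT.
have xk : gaussian_rv (x k) 0 (Sg k).
  by apply: IH => [j jk|]; [exact/piE/ltnW | exact: ltnW].
apply: (gaussian_step (Sgp _ (ltnW kT)) (Sp kT) Lu erefl mp p0 (xuE k kT) (xS k kT) xk).
apply: filterS (piE k (ltnSn k)) => y; apply: filterS => v ->.
by rewrite pi_rhoE.
Qed.

(** The inner integral vanishes almost everywhere for the state law, whose density is positive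
    everywhere, hence almost everywhere for Lebesgue measure. The same argument in the control
    variable and the equality case of [klfun] conclude. *)
Lemma gap_eq0 k (S : 'M[R]_n) d (W : measurableType d) (P : probability W R)
    (x : nat -> {RV P >-> 'cV[R]_n}) (pi : nat -> 'cV[R]_n -> 'cV[R]_m -> R) :
  (k < T)%N -> is_policy T pi -> posdefmx S -> gaussian_rv (x k) 0 S ->
  gap A B Srho Q x pi k = 0 ->
  {ae lebesgue_cV R n, forall y, {ae lebesgue_cV R m, forall v,
     pi k y v = pi_rho A B Srho Q k y v}}.
Proof.
move=> kT piP Spd xG gap0; have [mp p0 _] := piP k kT.
pose g (z : 'cV[R]_n * 'cV[R]_m) := (klfun (pi k z.1 z.2) (pi_rho A B Srho Q k z.1 z.2))%:E.
have g0 z : 0 <= g z.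
  by rewrite lee_fin klfun_ge0//; exact/gauss_pdf_gt0/Sp.
have mg : measurable_fun setT g.
  by apply/measurable_EFinP; apply: measurable_klfun => //; exact: measurable_pi_rho.
pose F (y : 'cV[R]_n) := \int[lebesgue_cV R m]_v g (y, v).
have F0 y : 0 <= F y by apply: integral_ge0.
have mF : measurable_fun setT F.
  exact: (@measurable_fun_fubini_tonelli_F _ _ _ _ _ (lebesgue_cV R m) _ mg g0).
have mG : measurable_fun setT (fun y => F y * (gauss_pdf 0 S y)%:E).
  by apply: emeasurable_funM => //; apply/measurable_EFinP; exact: measurable_gauss_pdf.
have : ae_eq (lebesgue_cV R n) setT (fun y => F y * (gauss_pdf 0 S y)%:E) (cst 0).
  apply/ae_eq_integral_abs => //.
  transitivity (\int[lebesgue_cV R n]_y (F y * (gauss_pdf 0 S y)%:E)).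
    apply: eq_integral => y _; rewrite gee0_abs// mule_ge0// lee_fin.
    exact: gauss_pdf_ge0.
  by rewrite -(ge0_integral_gaussian_rv xG mF F0).
apply: filterS => y /(_ I)/= /eqP; rewrite mule_eq0 => /orP[/eqP Fy0|]; last first.
  by rewrite eqe => /eqP S0; have := gauss_pdf_gt0 0 y Spd; rewrite S0 ltxx.
have mgy : measurable_fun setT (fun v => g (y, v)).
  exact: (measurableT_comp mg (measurable_pair1 y)).
have : ae_eq (lebesgue_cV R m) setT (fun v => g (y, v)) (cst 0).
  apply/ae_eq_integral_abs => //; rewrite -[RHS]Fy0.
  by apply: eq_integral => v _; rewrite gee0_abs.
apply: filterS => v /(_ I)/= gv0; apply: klfun_eq0; [exact: p0 | | exact: EFin_inj gv0].
exact/gauss_pdf_gt0/Sp.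
Qed.

Lemma gap_pi_rho k d (W : measurableType d) (P : probability W R)
    (x : nat -> {RV P >-> 'cV[R]_n}) : gap A B Srho Q x (pi_rho A B Srho Q) k = 0.
Proof.
apply: integral0_eq => w _; apply: integral0_eq => v _.
by rewrite klfun_same.
Qed.

Lemma pi_rho_feasible :
  exists d (W : measurableType d) (P : probability W R)
    (x : nat -> {RV P >-> 'cV[R]_n}) (u : nat -> {RV P >-> 'cV[R]_m}),
    feasible T A B Sini Sfin (pi_rho A B Srho Q) x u.
Proof.
have [Sg [Sg0 SgT Sgp SgS]] := steering_state_covariance.
have [d [W [P [x [u [xS x0 xuE]]]]]] :=
  realization_exists A B (feedback A B Srho Q) Sini_pd Sp.
exists d, W, P, x, u.
have {}xuE k : (k < T)%N -> forall C D, measurable C -> measurable D ->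
    P (x k @^-1` C `&` u k @^-1` D) =
    \int[P]_(w in x k @^-1` C) \int[lebesgue_cV R m]_(v in D)
      (pi_rho A B Srho Q k (x k w) v)%:E.
  by move=> kT; rewrite pi_rhoE; exact: xuE.
have xT : gaussian_rv (x T) 0 (Sg T).
  apply: (state_law Sg0 Sgp SgS (pi_rho_policy A Sp) xS x0 xuE) (leqnn T) => j jT.
  by apply: aeW => y; exact: aeW.
by rewrite SgT in xT.
Qed.

Lemma pi_rho_control_moment d (W : measurableType d) (P : probability W R)
    (x : nat -> {RV P >-> 'cV[R]_n}) (u : nat -> {RV P >-> 'cV[R]_m}) k :
  feasible T A B Sini Sfin (pi_rho A B Srho Q) x u -> (k < T)%N ->
  finite_second_moment (u k).
Proof.
move=> [xS x0 _ xuE] kT.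
have [Sg [Sg0 SgT Sgp SgS]] := steering_state_covariance.
have xk : gaussian_rv (x k) 0 (Sg k).
  apply: (state_law Sg0 Sgp SgS (pi_rho_policy A Sp) xS x0 xuE) (ltnW kT) => j jT.
  by apply: aeW => y; exact: aeW.
apply: (gauss_kernel_second_moment (K := feedback A B Srho Q k) (X := x k) (Sp kT)).
  by move: xuE; rewrite pi_rhoE => /(_ _ kT).
by apply: gaussian_second_moment xk; exact/Sgp/ltnW.
Qed.

(** [C] is read off one chosen realization; it is the same for all, since it involves the process
    only through its prescribed laws at times 0 and [T]. The two clauses differ in the source of the
    control moments: Gaussian kernels for [pi_rho], finite cost for a competitor. *)
Lemma optimal_costE : exists C : R,
  (forall d (W : measurableType d) (P : probability W R)
    (x : nat -> {RV P >-> 'cV[R]_n}) (u : nat -> {RV P >-> 'cV[R]_m}),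
    feasible T A B Sini Sfin (pi_rho A B Srho Q) x u ->
    cost T (pi_rho A B Srho Q) rho x u = C%:E) /\
  (forall d (W : measurableType d) (P : probability W R)
    (x : nat -> {RV P >-> 'cV[R]_n}) (u : nat -> {RV P >-> 'cV[R]_m})
    (pi : nat -> 'cV[R]_n -> 'cV[R]_m -> R),
    is_policy T pi -> feasible T A B Sini Sfin pi x u -> cost T pi rho x u < +oo ->
    cost T pi rho x u = \sum_(k < T) gap A B Srho Q x pi k + C%:E).
Proof.
have [c cP] := steering_log_ratio.
have [d0 [W0 [P0 [x0 [u0 x0P]]]]] := pi_rho_feasible.
pose C := (\sum_(k < T) c k + fine (\int[P0]_w (value Q 0 (x0 0%N w))%:E) -
  fine (\int[P0]_w (value Q T (x0 T w))%:E))%R.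
have H d (W : measurableType d) (P : probability W R)
    (x : nat -> {RV P >-> 'cV[R]_n}) (u : nat -> {RV P >-> 'cV[R]_m})
    (pi : nat -> 'cV[R]_n -> 'cV[R]_m -> R) :
    is_policy T pi -> feasible T A B Sini Sfin pi x u ->
    (forall k, (k < T)%N -> finite_second_moment (u k)) ->
    cost T pi rho x u = \sum_(k < T) gap A B Srho Q x pi k + C%:E.
  move=> piP xuP um; apply: eq_trans (cost_gapE Sini_pd Srho_pd rhoE Sp cP piP xuP um) _.
  have [_ i0 iT _] := xuP; have [_ j0 jT _] := x0P.
  by rewrite (gaussian_rv_integral_eq i0 j0 (@measurable_value _ _ Q 0))
    (gaussian_rv_integral_eq iT jT (@measurable_value _ _ Q T)).
exists C; split=> d W P x u => [xuP|pi piP xuP costoo].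
  have uM k : (k < T)%N -> finite_second_moment (u k) by exact: pi_rho_control_moment xuP.
  apply: eq_trans (H _ _ _ _ _ _ (pi_rho_policy A Sp) xuP uM) _.
  by rewrite big1 ?add0e// => k _; exact: gap_pi_rho.
apply: (H _ _ _ _ _ _ piP xuP) => k kT.
exact (finite_cost_control_moment Srho_pd rhoE piP kT costoo).
Qed.

Lemma pi_rho_optimal : optimal_policy T A B Sini Sfin rho (pi_rho A B Srho Q).
Proof.
have [C [C_pi_rho CP]] := optimal_costE; have Pp := pi_rho_policy A Sp.
split; [exact: Pp | exact: pi_rho_feasible|].
move=> d W P x u xuP pi d' W' P' x' u' piP xuP'.
apply: (le_trans (y := C%:E)); first by rewrite (C_pi_rho _ _ _ _ _ xuP).
have [->|] := eqVneq (cost T pi rho x' u') +oo; first exact: leey.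
rewrite -ltey => costoo; rewrite (CP _ _ _ _ _ _ piP xuP' costoo).
by rewrite leeDr// sume_ge0// => k _; exact: (gap_ge0 A Sp x' piP).
Qed.

(** The realization contained in [optimal_policy] supplies a process on which costs can be compared.
    Optimality against [pi_rho] bounds its cost by the finite [C], so the sum of gaps is zero, and
    with it each gap. *)
Lemma optimal_policy_unique (pi : nat -> 'cV[R]_n -> 'cV[R]_m -> R) :
  optimal_policy T A B Sini Sfin rho pi -> forall k, (k < T)%N ->
  {ae lebesgue_cV R n, forall x, {ae lebesgue_cV R m, forall u,
    pi k x u = pi_rho A B Srho Q k x u}}.
Proof.
move=> [piP [d [W [P [x [u xuP]]]]] opt].
have [C [C_pi_rho CP]] := optimal_costE; have Pp := pi_rho_policy A Sp.
have [d0 [W0 [P0 [x0 [u0 x0P]]]]] := pi_rho_feasible.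
have costC : cost T pi rho x u <= C%:E.
  rewrite -(C_pi_rho _ _ _ _ _ x0P); exact: opt xuP _ _ _ _ _ _ Pp x0P.
have costoo : cost T pi rho x u < +oo by apply: le_lt_trans costC _; exact: ltry.
move: costC; rewrite (CP _ _ _ _ _ _ piP xuP costoo).
have gap0 (k : 'I_T) : 0 <= gap A B Srho Q x pi k by exact: (gap_ge0 A Sp x piP).
rewrite -[leRHS]add0e leeD2rE// => sum_gap.
have {sum_gap} sum0 : \sum_(k < T) gap A B Srho Q x pi k = 0.
  by apply/eqP; rewrite eq_le sum_gap sume_ge0.
have gap_0 k : (k < T)%N -> gap A B Srho Q x pi k = 0.
  move=> kT; apply/eqP; rewrite eq_le (gap0 (Ordinal kT)) andbT -sum0.
  by rewrite (bigD1 (Ordinal kT))//= leeDl// sume_ge0.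
have [Sg [Sg0 SgT Sgp SgS]] := steering_state_covariance.
have [xS xi _ xuE] := xuP.
elim/ltn_ind => k IH kT.
(* A zero gap identifies the policy only where the state law has a density, and the induction
   hypothesis makes that law the Gaussian with covariance [Sg k]. *)
apply: (gap_eq0 kT piP (Sgp _ (ltnW kT)) _ (gap_0 k kT)).
apply: (state_law Sg0 Sgp SgS piP xS xi xuE) (ltnW kT) => j jk.
by apply: IH => //; exact: ltn_trans kT.
Qed.

End optimality.

Theorem theorem15 (R : realType) (n m T : nat) (T_ge1 : (1 <= T)%N)
    (A : nat -> 'M[R]_n) (B : nat -> 'M[R]_(n, m)) (Sini Sfin : 'M[R]_n)
    (Sini_pd : posdefmx Sini) (Sfin_pd : posdefmx Sfin)
    (rho : nat -> 'cV[R]_m -> R) (Srho : nat -> 'M[R]_m)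
    (Srho_pd : forall k, (k < T)%N -> posdefmx (Srho k))
    (rhoE : forall k, (k < T)%N -> rho k = gauss_pdf 0 (Srho k))
    (HA : assumption_A T A (Brho B Srho) Sini Sfin)
    (Q : nat -> 'M[R]_n)
    (Q0E : Q 0%N = Q_0 T A (Brho B Srho) Sini Sfin)
    (QSE : forall k, (k < T)%N ->
       Q k.+1 = A k *m Q k *m (A k)^T - Brho B Srho k *m (Brho B Srho k)^T) :
  [/\ forall k, (k < T)%N -> posdefmx (Sigma_pi B Srho Q k),
      optimal_policy T A B Sini Sfin rho (pi_rho A B Srho Q) &
      forall pi : nat -> 'cV[R]_n -> 'cV[R]_m -> R,
        optimal_policy T A B Sini Sfin rho pi ->
        forall k, (k < T)%N ->
          {ae lebesgue_cV R n, forall x, {ae lebesgue_cV R m, forall u,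
             pi k x u = pi_rho A B Srho Q k x u}}].
Proof.
split.
- by move=> k; apply: (steering_Sigma_pi_posdef Sini_pd Sfin_pd Srho_pd HA Q0E QSE).
- exact: (pi_rho_optimal Sini_pd Sfin_pd Srho_pd rhoE HA Q0E QSE).
- by move=> p; apply: (optimal_policy_unique Sini_pd Sfin_pd Srho_pd rhoE HA Q0E QSE).
Qed.
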